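(* There is an awfs on the Kleene–Vesley topos $\mathcal{KV}$ where the maps that admit the structure of a right map are precisely the computable Hurewicz fibrations.
   Context: $\mathcal{K}_2$ is Kleene's second (function realizability) partial combinatory algebra on $\mathbb{N}^{\mathbb{N}}$, and $\mathcal{K}_2^{\mathrm{rec}}$ its sub-pca of total recursive functions. The Kleene–Vesley topos $\mathcal{KV}$ is the relative realizability topos $\mathbf{RT}(\mathcal{K}_2^{\mathrm{rec}},\mathcal{K}_2)$ (realizers taken from $\mathcal{K}_2$, maps tracked by elements of $\mathcal{K}_2^{\mathrm{rec}}$). The interval $[0,1]\subseteq\mathbb{R}$ is viewed as an object of $\mathcal{KV}$ via the assembly with underlying set $[0,1]$ and existence predicate $E(x)$ the set of (functions encoding) Cauchy sequences of rationals converging to $x$; the endpoint inclusion $\delta_0\colon 1\to[0,1]$ is computable and so is a map in $\mathcal{KV}$. A map in $\mathcal{KV}$ is a computable Hurewicz fibration if it has the fibred right lifting property against $\delta_0\colon1\to[0,1]$ regarded as a family of maps over $1$; equivalently, if it has the right lifting property against $\delta_0\times X\colon X\to X\times[0,1]$ for every object $X$ of $\mathcal{KV}$. An awfs (algebraic weak factorisation system) $(L,R)$ on a category is a functorial factorisation $f=Rf\circ Lf$ with $L$ underlying a comonad over the domain functor and $R$ underlying a monad over the codomain functor on the arrow category, with counit and unit given by $Rf$ and $Lf$, satisfying the usual distributive law condition. A map admits the structure of a right map if it carries an algebra structure for the monad $R$. *)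

(* Defs.v *)
From Corelib Require Import RelationClasses.
From Corelib Require Setoid Morphisms.
From mathcomp Require Import all_boot all_order all_algebra.
From mathcomp Require Import boolp classical_sets reals interval_inference.
From mathcomp Require Import topology normedtype sequences.

Set Implicit Arguments.
Unset Strict Implicit.
Unset Printing Implicit Defensive.

Import Order.TTheory GRing.Theory Num.Theory numFieldNormedType.Exports.

(* Total recursive functions, as the least class of total functions that
   contains the basic functions and is closed under composition, primitive
   recursion and minimization of regular functions. By Kleene's normal form
   theorem these are the partial recursive functions that happen to be total. *)

Inductive recursive : forall k, (k.-tuple nat -> nat) -> Prop :=
| rec_zero : recursive (fun _ : 0.-tuple nat => 0)
| rec_succ : recursive (fun t : 1.-tuple nat => (tnth t ord0).+1)
| rec_proj k (i : 'I_k) : recursive (fun t : k.-tuple nat => tnth t i)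
| rec_comp k m (f : m.-tuple nat -> nat) (g : 'I_m -> k.-tuple nat -> nat) :
    recursive f -> (forall i, recursive (g i)) ->
    recursive (fun t : k.-tuple nat => f [tuple g i t | i < m])
| rec_prim k (f : k.-tuple nat -> nat) (g : k.+2.-tuple nat -> nat)
    (h : k.+1.-tuple nat -> nat) :
    recursive f -> recursive g ->
    (forall t : k.-tuple nat, h [tuple of 0 :: t] = f t) ->
    (forall n (t : k.-tuple nat),
      h [tuple of n.+1 :: t] = g [tuple of n :: h [tuple of n :: t] :: t]) ->
    recursive h
| rec_min k (f : k.+1.-tuple nat -> nat) (h : k.-tuple nat -> nat) :
    recursive f ->
    (forall t : k.-tuple nat, f [tuple of h t :: t] = 0 /\
       forall n, n < h t -> f [tuple of n :: t] <> 0) ->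
    recursive h.

Definition total_recursive (a : nat -> nat) : Prop :=
  recursive (fun t : 1.-tuple nat => a (tnth t ord0)).

Lemma rec_ext k (f g : k.-tuple nat -> nat) : recursive f -> f =1 g -> recursive g.
Proof. by move=> hf /funext <-. Qed.

Definition rec2 (F : nat -> nat -> nat) :=
  recursive (fun t : 2.-tuple nat => F (tnth t ord0) (tnth t (lift ord0 ord0))).

Local Notation bt := behead_tuple.

Lemma tnth_bt k (t : k.+1.-tuple nat) (i : 'I_k) : tnth (bt t) i = tnth t (lift ord0 i).
Proof.
by rewrite tnth_behead; congr tnth; apply: val_inj; rewrite /= inordK ?ltnS.
Qed.

Lemma rec_app1 k F (f : k.-tuple nat -> nat) :
  total_recursive F -> recursive f -> recursive (fun t => F (f t)).
Proof.
move=> hF hf; apply: rec_ext (rec_comp (g := fun _ => f) hF (fun _ => hf)) _ => t.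
by rewrite tnth_mktuple.
Qed.

Lemma rec_app2 k F (f g : k.-tuple nat -> nat) :
  rec2 F -> recursive f -> recursive g -> recursive (fun t => F (f t) (g t)).
Proof.
move=> hF hf hg.
apply: rec_ext (rec_comp (g := fun i : 'I_2 => if i == ord0 then f else g) hF _) _.
  by move=> i; case: eqP.
by move=> t; rewrite !tnth_mktuple.
Qed.

Lemma rec_bt k (f : k.-tuple nat -> nat) :
  recursive f -> recursive (fun t : k.+1.-tuple nat => f (bt t)).
Proof.
move=> hf.
apply: rec_ext (rec_comp (g := fun i (t : k.+1.-tuple nat) => tnth t (lift ord0 i)) hf _) _.
  by move=> i; exact: rec_proj.
move=> t; congr f; apply: eq_from_tnth => i; by rewrite tnth_mktuple tnth_bt.
Qed.

Lemma rec_S k (f : k.-tuple nat -> nat) : recursive f -> recursive (fun t => (f t).+1).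
Proof. exact: (rec_app1 (F := S) rec_succ). Qed.

Lemma rec_const k c : recursive (fun _ : k.-tuple nat => c).
Proof.
elim: c => [|c IH]; last exact: rec_S.
apply: rec_ext (rec_comp (g := fun i : 'I_0 => fun _ => 0) rec_zero _) _ => //.
by case.
Qed.

Lemma rec_sub k m (f : m.-tuple nat -> nat) (g : 'I_m -> k.-tuple nat -> nat) (h : k.-tuple nat -> nat):
  recursive f -> (forall i, recursive (g i)) -> (forall t, h t = f [tuple g i t | i < m]) -> recursive h.
Proof. by move=> hf hg e; apply: rec_ext (rec_comp hf hg) _ => t. Qed.

Fixpoint loop (x : nat) (F : nat -> nat -> nat) (n : nat) :=
  if n is m.+1 then F m (loop x F m) else x.

Lemma rec_loop k (n x : k.-tuple nat -> nat) (F : nat -> nat -> k.-tuple nat -> nat) :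
  recursive n -> recursive x ->
  recursive (fun u : k.+2.-tuple nat =>
    F (tnth u ord0) (tnth u (lift ord0 ord0)) (bt (bt u))) ->
  recursive (fun t => loop (x t) (fun i r => F i r t) (n t)).
Proof.
move=> hn hx hF.
have H : recursive (fun u : k.+1.-tuple nat =>
    loop (x (bt u)) (fun i r => F i r (bt u)) (tnth u ord0)).
  apply: (rec_prim hx hF) => [t|m t] /=.
    by rewrite ?(tnth_nth 0) /=; congr x; exact: val_inj.
  rewrite ?(tnth_nth 0) /=.
  have -> : bt [tuple of m.+1 :: t] = t by exact: val_inj.
  have -> : bt [tuple of m :: t] = t by exact: val_inj.
  congr F; exact: val_inj.
apply: (rec_sub (g := fun i => if unlift ord0 i is Some j then (tnth (T:=nat))^~ j else n) H).
  by move=> i; case: unlift => // j; exact: rec_proj.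
move=> t; have -> : bt [tuple (if unlift ord0 i is Some j then (tnth (T:=nat))^~ j else n) t | i < k.+1] = t.
  apply: eq_from_tnth => i; by rewrite tnth_bt tnth_mktuple liftK.
by rewrite tnth_mktuple unlift_none.
Qed.

Lemma rec_mu k (f : nat -> k.-tuple nat -> nat) (h : k.-tuple nat -> nat) :
  recursive (fun u : k.+1.-tuple nat => f (tnth u ord0) (bt u)) ->
  (forall t, f (h t) t = 0 /\ forall n, n < h t -> f n t <> 0) -> recursive h.
Proof.
move=> hf H; apply: (rec_min hf) => t; have [H1 H2] := H t.
have E n : bt [tuple of n :: t] = t by exact: val_inj.
split=> [|n /H2]; by rewrite !(tnth_nth 0) /= E.
Qed.

Definition ifz (c x y : nat) := if c == 0 then x else y.

Ltac rsub := first
 [ assumption | exact: rec_proj | exact: rec_const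
 | match goal with H : recursive _ |- _ =>
     first [exact: (rec_bt H) | exact: (rec_bt (rec_bt H))] end
 | apply: rec_S; rsub ].

Lemma rec_ifz k (c x y : k.-tuple nat -> nat) :
  recursive c -> recursive x -> recursive y -> recursive (fun t => ifz (c t) (x t) (y t)).
Proof.
move=> hc hx hy.
apply: rec_ext (rec_loop (F := fun _ _ t => y t) hc hx _) _.
  by rsub.
by move=> t; rewrite /ifz; case: (c t).
Qed.

Lemma rec_pred k (f : k.-tuple nat -> nat) : recursive f -> recursive (fun t => (f t).-1).
Proof.
move=> hf; apply: rec_ext (rec_loop (F := fun i _ _ => i) hf (rec_const k 0) _) _; first exact: rec_proj.
by move=> t; case: (f t).
Qed.

Lemma rec_add k (f g : k.-tuple nat -> nat) : recursive f -> recursive g -> recursive (fun t => f t + g t).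
Proof.
move=> hf hg; apply: rec_ext (rec_loop (F := fun _ r _ => r.+1) hf hg _) _; first by rsub.
by move=> t; elim: (f t) => //= n ->; rewrite addSn.
Qed.

Lemma rec_subn k (f g : k.-tuple nat -> nat) : recursive f -> recursive g -> recursive (fun t => f t - g t).
Proof.
move=> hf hg; apply: rec_ext (rec_loop (F := fun _ r _ => r.-1) hg hf _) _.
  by apply: rec_pred; rsub.
by move=> t; elim: (g t) => /= [|n ->]; rewrite ?subn0 ?subnS.
Qed.

Lemma rec_mul k (f g : k.-tuple nat -> nat) : recursive f -> recursive g -> recursive (fun t => f t * g t).
Proof.
move=> hf hg.
apply: rec_ext (rec_loop (F := fun _ r t => g t + r) hf (rec_const k 0) _) _.
  by apply: rec_add; rsub.
by move=> t; elim: (f t) => /= [|n ->]; rewrite ?mulSn.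
Qed.

Lemma rec_exp2 k (f : k.-tuple nat -> nat) : recursive f -> recursive (fun t => 2 ^ f t).
Proof.
move=> hf; apply: rec_ext (rec_loop (F := fun _ r _ => r + r) hf (rec_const k 1) _) _.
  by apply: rec_add; rsub.
by move=> t; elim: (f t) => //= n ->; rewrite addnn expnS mul2n.
Qed.

Lemma rec_odd k (f : k.-tuple nat -> nat) : recursive f -> recursive (fun t => odd (f t) : nat).
Proof.
move=> hf; apply: rec_ext (rec_loop (F := fun _ r _ => 1 - r) hf (rec_const k 0) _) _.
  by apply: rec_subn; rsub.
by move=> t; elim: (f t) => //= n ->; case: odd.
Qed.

Lemma rec_half k (f : k.-tuple nat -> nat) : recursive f -> recursive (fun t => (f t)./2).
Proof.
move=> hf; apply: rec_ext (rec_loop (F := fun i r _ => odd i + r) hf (rec_const k 0) _) _.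
  by apply: rec_add; [apply: rec_odd|]; rsub.
by move=> t; elim: (f t) => //= n ->; rewrite uphalf_half.
Qed.

Local Notation code := CodeSeq.code.
Local Notation decode := CodeSeq.decode.

Lemma rec_cons k (x m : k.-tuple nat -> nat) : recursive x -> recursive m ->
  recursive (fun t => code (x t :: decode (m t))).
Proof.
move=> hx hm; apply: rec_ext (_ : recursive (fun t => 2 ^ x t * (m t + m t).+1)) _.
  by apply: rec_mul; [exact: rec_exp2 | apply: rec_S; exact: rec_add].
by move=> t; rewrite /code /= -/code CodeSeq.decodeK addnn.
Qed.

Definition strip m := ifz (odd m) m./2 m.

Lemma iter_strip x m n : x <= n -> iter n strip (2 ^ x * m.*2.+1) = m.*2.+1.
Proof.
elim: x n => [|x IH] n.
  rewrite mul1n => _; elim: n => //= n ->; by rewrite /strip /= odd_double.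
case: n => // n lexn; rewrite iterSr -[RHS](IH n) //; congr iter.
by rewrite /strip expnS -mulnA mul2n odd_double doubleK.
Qed.

Lemma rec_behead k (m : k.-tuple nat -> nat) : recursive m ->
  recursive (fun t => code (behead (decode (m t)))).
Proof.
move=> hm.
apply: rec_ext (_ : recursive (fun t => (loop (m t) (fun _ r => strip r) (m t))./2)) _.
  apply: rec_half; apply: (rec_loop (F := fun _ r _ => strip r)) => //.
  by apply: rec_ifz; [apply: rec_odd | apply: rec_half |]; rsub.
move=> t; have -> n x : loop x (fun _ r => strip r) n = iter n strip x by elim: n => //= n ->.
rewrite -{1 2}[m t]CodeSeq.decodeK; case: (decode (m t)) => // x s /=.
rewrite iter_strip /= ?uphalf_double // ltnW //.
apply: leq_trans (leq_pmulr _ _) => //; exact: ltn_expl.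
Qed.

Lemma rec_head k (m : k.-tuple nat -> nat) : recursive m ->
  recursive (fun t => head 0 (decode (m t))).
Proof.
move=> hm.
pose E n t := code (n :: behead (decode (m t))).
apply: (rec_mu (f := fun n t => ifz (m t) 0 ((m t - E n t) + (E n t - m t)))).
  have hE : recursive (fun u : k.+1.-tuple nat => E (tnth u ord0) (bt u)).
    apply: rec_ext (rec_cons (rec_proj ord0) (rec_behead (rec_bt hm))) _ => u.
    by rewrite CodeSeq.codeK.
  apply: rec_ifz; [rsub|rsub|apply: rec_add; apply: rec_subn => //; rsub].
move=> t; rewrite /E; have [s ->] : exists s, m t = code s.
  by exists (decode (m t)); rewrite CodeSeq.decodeK.
rewrite CodeSeq.codeK; case: s => [|x s]; first by split.
rewrite [head _ _]/= [behead _]/= /ifz; case: eqP => [/(congr1 decode)|_].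
  by rewrite CodeSeq.codeK.
split=> [|n ltnx /eqP]; first by rewrite subnn.
rewrite addn_eq0 !subn_eq0 -eqn_leq => /eqP /(can_inj CodeSeq.codeK)[] e.
by rewrite e ltnn in ltnx.
Qed.

Lemma rec_nth k (m i : k.-tuple nat -> nat) : recursive m -> recursive i ->
  recursive (fun t => nth 0 (decode (m t)) (i t)).
Proof.
move=> hm hi.
apply: rec_ext (rec_head (rec_loop (F := fun _ r _ => code (behead (decode r))) hi hm _)) _.
  by apply: rec_behead; rsub.
move=> t /=; rewrite -nth0.
have -> : decode (loop (m t) (fun _ r => code (behead (decode r))) (i t))
   = drop (i t) (decode (m t)).
  elim: (i t) => [|n /= ->]; first by rewrite drop0.
  by rewrite CodeSeq.codeK -drop1 drop_drop add1n.
by rewrite nth_drop addn0.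
Qed.

Lemma rec_size k (m : k.-tuple nat -> nat) : recursive m ->
  recursive (fun t => size (decode (m t))).
Proof.
move=> hm.
apply: (rec_mu (f := fun n t => loop (m t) (fun _ r => code (behead (decode r))) n)).
  apply: (rec_loop (F := fun _ r _ => code (behead (decode r)))); try by rsub.
  by apply: rec_behead; rsub.
move=> t.
have E n : loop (m t) (fun _ r => code (behead (decode r))) n = code (drop n (decode (m t))).
  elim: n => [|n /= ->]; first by rewrite drop0 CodeSeq.decodeK.
  by rewrite CodeSeq.codeK -drop1 drop_drop add1n.
split=> [|n ltn]; rewrite E; first by rewrite drop_size.
by move/(congr1 decode); rewrite CodeSeq.codeK => /(congr1 size)/eqP; rewrite size_drop subn_eq0 leqNgt ltn.
Qed.

Lemma rec_mkseq k (F : nat -> k.-tuple nat -> nat) (n : k.-tuple nat -> nat) :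
  recursive (fun u : k.+1.-tuple nat => F (tnth u ord0) (bt u)) ->
  recursive n -> recursive (fun t => code (mkseq (F^~ t) (n t))).
Proof.
move=> hF hn.
have hF' (g : k.+2.-tuple nat -> nat) : recursive g -> recursive (fun u : k.+2.-tuple nat => F (g u) (bt (bt u))).
  move=> hg.
  apply: (rec_sub (g := fun i => if unlift ord0 i is Some j then fun u => tnth (bt (bt u)) j else g) hF).
    move=> i; case: unlift => // j; apply: (@rec_bt k.+1 (fun u => tnth (bt u) j)).
    by apply: (@rec_bt k (fun u => tnth u j)); rsub.
  move=> t; rewrite tnth_mktuple unlift_none; congr F.
  apply: eq_from_tnth => i; by rewrite [RHS]tnth_bt tnth_mktuple liftK.
apply: rec_ext (rec_loop (F := fun i r t => code (F (n t - i.+1) t :: decode r)) hn (rec_const k 0) _) _.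
  apply: rec_cons; last by rsub.
  by apply: (hF' (fun u => n (bt (bt u)) - (tnth u ord0).+1)); apply: rec_subn; rsub.
move=> t; suff H j : j <= n t ->
   loop 0 (fun i r => code (F (n t - i.+1) t :: decode r)) j
   = code [seq F i t | i <- iota (n t - j) j].
  by rewrite H // subnn.
elim: j => // j IH ltj; rewrite [LHS]/= IH; last exact: ltnW.
by rewrite CodeSeq.codeK -(subnSK ltj).
Qed.

(* Partial combinatory algebras, with application given by its graph, and with
   the usual laws (k a) b = a, (s a) b is defined, and ((s a) b) c is defined and
   equal to (a c) (b c) as soon as the latter is defined. *)
Record pca := Pca {
  pca_sort :> Type;
  app : pca_sort -> pca_sort -> pca_sort -> Prop;
  kc : pca_sort;
  sc : pca_sort;
  app_fun : forall a b c c', app a b c -> app a b c' -> c = c';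
  kcP : forall a b, exists u, app kc a u /\ app u b a;
  scP : forall a b, exists u v, [/\ app sc a u, app u b v &
    forall c x y d, app a c x -> app b c y -> app x y d -> app v c d] }.

(* For a relative pca both k and s can be chosen in the sub-pca. *)
Record subpca (A : pca) := Subpca {
  subpca_pred :> A -> Prop;
  subpca_app : forall a b c, subpca_pred a -> subpca_pred b -> app a b c -> subpca_pred c;
  subpca_k : subpca_pred (kc A);
  subpca_s : subpca_pred (sc A) }.

(* Kleene's function application: (a b) n is v if a (<n, b 0, .., b (k - 1)>) = v + 1
   for the least k at which this value of a is nonzero, and a b is defined if
   (a b) n is for every n. Finite sequences are coded by CodeSeq. *)
Definition K2_app (a b c : nat -> nat) : Prop :=
  forall n, exists k, a (code (n :: mkseq b k)) = (c n).+1 /\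
    forall j, j < k -> a (code (n :: mkseq b j)) = 0.

Lemma K2_app_fun a b c c' : K2_app a b c -> K2_app a b c' -> c = c'.
Proof.
move=> h h'; apply/funext => n.
have [k [e lk]] := h n; have [k' [e' lk']] := h' n.
have [ltkk'|ltk'k|E] := ltngtP k k'.
- by rewrite lk' in e.
- by rewrite lk in e'.
- by apply: succn_inj; rewrite -e -e' E.
Qed.

Lemma rec_subst k m (a : nat -> k.-tuple nat -> nat) (g : m.-tuple nat -> nat)
    (p : m.-tuple nat -> k.-tuple nat) :
  recursive (fun u : k.+1.-tuple nat => a (tnth u ord0) (bt u)) ->
  recursive g -> (forall i, recursive (fun u => tnth (p u) i)) ->
  recursive (fun u => a (g u) (p u)).
Proof.
move=> ha hg hp.
apply: (rec_sub (g := fun i => if unlift ord0 i is Some j then fun u => tnth (p u) j else g) ha).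
  by move=> i; case: unlift.
move=> t; rewrite tnth_mktuple unlift_none; congr a.
by apply: eq_from_tnth => i; rewrite [RHS]tnth_bt tnth_mktuple liftK.
Qed.

(* To construct s in K2, functions are approximated by partial ones, where the
   value 0 stands for undefined and v + 1 for v: known s is the approximation with
   finite graph s, and sim a c K approximates the application of a to c. *)
Definition known (s : seq nat) (i : nat) : nat := ifz (i.+1 - size s) (nth 0 s i).+1 0.

Definition search (h : nat -> nat) (K : nat) : nat :=
  (loop 1 (fun j r => ifz (r.-1 + (1 - r)) (h j) r) K).-1.

Definition all_known (c : nat -> nat) (j : nat) : nat :=
  loop 1 (fun i r => ifz (c i) 0 r) j.

Definition sim (a c : nat -> nat) (K n : nat) : nat :=
  search (fun j => ifz (all_known c j) 0 (a (code (n :: mkseq (fun i => (c i).-1) j)))) K.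

Lemma rec_known k (m i : k.-tuple nat -> nat) : recursive m -> recursive i ->
  recursive (fun t => known (decode (m t)) (i t)).
Proof.
move=> hm hi; apply: rec_ifz; last by rsub.
  by apply: rec_subn; [rsub | apply: rec_size].
by apply: rec_S; apply: rec_nth.
Qed.

Lemma rec_sim k (a c : nat -> k.-tuple nat -> nat) (K n : k.-tuple nat -> nat) :
  recursive (fun u : k.+1.-tuple nat => a (tnth u ord0) (bt u)) ->
  recursive (fun u : k.+1.-tuple nat => c (tnth u ord0) (bt u)) ->
  recursive K -> recursive n ->
  recursive (fun t => sim (a^~ t) (c^~ t) (K t) (n t)).
Proof.
move=> ha hc hK hn.
have hp (i : 'I_k) : recursive (fun u : k.+2.-tuple nat => tnth (bt (bt u)) i).
  exact: (rec_bt (rec_bt (rec_proj i))).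
have hq (i : 'I_k) : recursive (fun u : k.+4.-tuple nat => tnth (bt (bt (bt (bt u)))) i).
  exact: (rec_bt (rec_bt (rec_bt (rec_bt (rec_proj i))))).
apply: rec_pred; apply: (rec_loop (F := fun j r t =>
  ifz (r.-1 + (1 - r)) (ifz (all_known (c^~ t) j) 0
     (a (code (n t :: mkseq (fun i => (c i t).-1) j)) t)) r)) => //; first by rsub.
apply: rec_ifz; last by rsub.
  by apply: rec_add; [apply: rec_pred | apply: rec_subn]; rsub.
apply: rec_ifz; [|by rsub|].
  apply: (rec_loop (F := fun i r (u : k.+2.-tuple nat) => ifz (c i (bt (bt u))) 0 r)); try by rsub.
  apply: rec_ifz; try by rsub.
  by apply: (@rec_subst k k.+4 c (fun u => tnth u ord0) (fun u => bt (bt (bt (bt u))))) => //; rsub.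
apply: (@rec_subst k k.+2 a (fun u => code (n (bt (bt u)) :: mkseq (fun i => (c i (bt (bt u))).-1) (tnth u ord0))) (fun u => bt (bt u))) => //.
apply: rec_ext (rec_cons (rec_bt (rec_bt hn)) (rec_mkseq
   (F := fun i (u : k.+2.-tuple nat) => (c i (bt (bt u))).-1) (n := fun u => tnth u ord0) _ _)) _.
- apply: rec_pred; apply: (@rec_subst k k.+3 c (fun u => tnth u ord0) (fun u => bt (bt (bt u)))) => //; first by rsub.
  by move=> i; exact: (rec_bt (rec_bt (rec_bt (rec_proj i)))).
- by rsub.
- by move=> u; rewrite CodeSeq.codeK.
Qed.

Definition approx (a al : nat -> nat) := forall m, a m = 0 \/ a m = (al m).+1.
Definition eventually_eq (a : nat -> nat -> nat) (al : nat -> nat) :=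
  forall m, exists K0, forall K, K0 <= K -> a K m = (al m).+1.

Lemma all_knownP c j : all_known c j = 0 \/ forall i, i < j -> c i <> 0.
Proof.
elim: j => [|j [IH|IH]]; first by right.
  by left; rewrite /all_known /= -/(all_known c j) IH /ifz; case: eqP.
rewrite /all_known /= /ifz; case: eqP => [|h]; first by left.
by right => i; rewrite ltnS leq_eqVlt => /orP[/eqP->|/IH].
Qed.

Lemma all_known1 c j : (forall i, i < j -> c i <> 0) -> all_known c j = 1.
Proof.
elim: j => // j IH h; rewrite /all_known /= -/(all_known c j) IH.
  by rewrite /ifz; case: eqP => // /h; case.
by move=> i ij; apply: h; apply: ltnW.
Qed.

Lemma mkseq_eq (f g : nat -> nat) j : (forall i, i < j -> f i = g i) -> mkseq f j = mkseq g j.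
Proof. by move=> h; apply/eq_in_map => i; rewrite mem_iota => /h. Qed.

Lemma sim_approx al ga de a c K :
  K2_app al ga de -> approx a al -> approx c ga -> approx (sim a c K) de.
Proof.
move=> hd ha hc n; have [k [ek lk]] := hd n.
rewrite /sim; set h := (X in search X K); rewrite /search.
have hh j : h j = 0 \/ h j = (al (code (n :: mkseq ga j))).+1.
  rewrite /h; case: (all_knownP c j) => [->|hk]; first by left.
  rewrite /ifz; case: eqP => [_|_]; first by left.
  rewrite (_ : mkseq _ j = mkseq ga j) //.
  by apply: mkseq_eq => i /hk; case: (hc i) => ->.
set F := (X in loop 1 X K).
suff : (loop 1 F K = 0 \/ loop 1 F K = (de n).+2) \/
   loop 1 F K = 1 /\ forall j, j < K -> al (code (n :: mkseq ga j)) = 0.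
  by case=> [[]->|[-> _]]; [left|right|left].
elim: K => [|K IH]; first by right.
rewrite [loop _ _ _]/= {1 3 5}/F; case: IH => [[]->|[-> IH]]; [by left; left|by left;right|].
rewrite /ifz /=; case: (hh K) => ->; first by left; left.
have [ltKk|ltkK|->] := ltngtP K k; last by rewrite ek; left; right.
  rewrite lk //; right; split=> // j; rewrite ltnS leq_eqVlt => /orP[/eqP->|/IH//].
  exact: lk.
by move: ek; rewrite IH.
Qed.

Lemma eventually_all (a : nat -> nat -> nat) al (f : nat -> nat) k : eventually_eq a al ->
  exists K0, forall i, i < k -> forall K, K0 <= K -> a K (f i) = (al (f i)).+1.
Proof.
move=> h; elim: k => [|k [K0 IH]]; first by exists 0.
have [K1 H1] := h (f k); exists (maxn K0 K1) => i.
rewrite ltnS leq_eqVlt => /orP[/eqP->|ik] K; rewrite geq_max => /andP[h1 h2]; first exact: H1.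
exact: IH.
Qed.

Lemma sim_eventually al ga de a c : K2_app al ga de ->
  eventually_eq a al -> eventually_eq c ga ->
  eventually_eq (fun K => sim (a K) (c K) K) de.
Proof.
move=> hd ha hc n; have [k [ek lk]] := hd n.
have [K1 H1] := eventually_all (fun j => code (n :: mkseq ga j)) k.+1 ha.
have [K2 H2] := eventually_all id k hc.
exists (maxn k.+1 (maxn K1 K2)) => K; rewrite !geq_max => /and3P[kK K1K K2K].
rewrite /sim; set h := (X in search X K); rewrite /search.
have hh j : j <= k -> h j = (al (code (n :: mkseq ga j))).+1.
  move=> jk; rewrite /h all_known1 /=; last first.
    by move=> i ij; rewrite H2 //; exact: leq_trans ij jk.
  rewrite (_ : mkseq _ j = mkseq ga j) ?H1 //.
  by apply: mkseq_eq => i ij; rewrite H2 //; exact: leq_trans ij jk.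
set F := (X in loop 1 X K).
have L1 j : j <= k -> loop 1 F j = 1.
  by elim: j => //= j IH jk; rewrite IH ?(ltnW jk) // /F /ifz /= hh ?lk // ltnW.
have L2 : loop 1 F k.+1 = (de n).+2 by rewrite /= L1 // /F /ifz /= hh // ek.
rewrite -(subnKC kK); elim: (K - k.+1) => [|d IH]; first by rewrite addn0 L2.
rewrite addnS; move: (k.+1 + d) IH => q /=; case: (loop _ _ _) => [|[|r]] // <-; by rewrite /F.
Qed.

Lemma knownE (s : seq nat) i : known s i = if i < size s then (nth 0 s i).+1 else 0.
Proof. by rewrite /known /ifz subn_eq0. Qed.

Lemma known_mkseq a K i : known (mkseq a K) i = if i < K then (a i).+1 else 0.
Proof. by rewrite knownE size_mkseq; case: ifP => // h; rewrite nth_mkseq. Qed.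

Lemma known_approx a K : approx (known (mkseq a K)) a.
Proof. by move=> m; rewrite known_mkseq; case: ifP; [right|left]. Qed.

Lemma known_eventually a : eventually_eq (fun K => known (mkseq a K)) a.
Proof. by move=> m; exists m.+1 => K h; rewrite known_mkseq h. Qed.

Definition code_hd m := head 0 (decode m).
Definition code_tl m := behead (decode m).

Definition K2_k (m : nat) : nat :=
  let v := known (code_tl m) (code_hd (code_hd m)) in ifz v 0 v.+1.

Definition s_val (A B C : seq nat) (n : nat) : nat :=
  sim (sim (known A) (known C) (size C)) (sim (known B) (known C) (size C)) (size C) n.

Definition s_arg2 (A : seq nat) (m : nat) : nat :=
  let B := code_tl m in let C := code_tl (code_hd m) in
  ifz (size C - size B) (s_val A B C (code_hd (code_hd m))).+1 0.

Definition K2_s (m : nat) : nat :=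
  ifz (size (code_tl (code_hd (code_hd m))) - size (code_tl m)) (s_arg2 (code_tl m) (code_hd m)).+1 0.

Lemma hd_cons x s : code_hd (code (x :: s)) = x.
Proof. by rewrite /code_hd CodeSeq.codeK. Qed.
Lemma tl_cons x s : code_tl (code (x :: s)) = s.
Proof. by rewrite /code_tl CodeSeq.codeK. Qed.

Lemma K2_kP a b : exists u, K2_app K2_k a u /\ K2_app u b a.
Proof.
exists (fun m => (a (code_hd m)).+1); split=> n.
  exists (code_hd n).+1; rewrite /K2_k hd_cons tl_cons known_mkseq ltnSn; split=> //.
  by move=> j jn; rewrite hd_cons tl_cons known_mkseq ltnNge -ltnS jn.
by exists 0; rewrite hd_cons.
Qed.

Lemma K2_sP a b : exists u v, [/\ K2_app K2_s a u, K2_app u b v &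
  forall c x y d, K2_app a c x -> K2_app b c y -> K2_app x y d -> K2_app v c d].
Proof.
pose sz m := size (code_tl m).
exists (fun m => s_arg2 (mkseq a (sz (code_hd m))) m).
exists (fun m => s_val (mkseq a (sz m)) (mkseq b (sz m)) (code_tl m) (code_hd m)); split.
- move=> m; exists (sz (code_hd m)); rewrite /K2_s hd_cons tl_cons size_mkseq /ifz subn_eq0 leqnn.
  split=> // j jm; by rewrite hd_cons tl_cons size_mkseq subn_eq0 leqNgt jm.
- move=> m; exists (sz m); rewrite /s_arg2 hd_cons tl_cons size_mkseq /ifz subn_eq0 leqnn.
  split=> // j jm; by rewrite hd_cons tl_cons size_mkseq subn_eq0 leqNgt jm.
move=> c x y d hx hy hd n.
pose f K := s_val (mkseq a K) (mkseq b K) (mkseq c K) n.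
have fE K : s_val (mkseq a (sz (code (n :: mkseq c K)))) (mkseq b (sz (code (n :: mkseq c K))))
   (code_tl (code (n :: mkseq c K))) (code_hd (code (n :: mkseq c K))) = f K.
  by rewrite hd_cons /sz tl_cons size_mkseq.
have f1 K : f K = 0 \/ f K = (d n).+1.
  rewrite /f /s_val; apply: sim_approx hd _ _ _.
    by apply: sim_approx hx _ _; exact: known_approx.
  by apply: sim_approx hy _ _; exact: known_approx.
have f2 : exists K, f K != 0.
  have ev e z : K2_app e c z -> eventually_eq (fun K => sim (known (mkseq e K)) (known (mkseq c K)) K) z.
    by move=> h; apply: sim_eventually h _ _; exact: known_eventually.
  have [K HK] := sim_eventually hd (ev _ _ hx) (ev _ _ hy) n.
  by exists K; rewrite /f /s_val size_mkseq HK.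
case: (ex_minnP f2) => K fK leK; exists K; split.
  by rewrite fE; case: (f1 K) fK => ->.
move=> j jK; rewrite fE; apply/eqP; apply: contraTT jK => /leK.
by rewrite leqNgt.
Qed.

Definition K2 : pca := Pca K2_app_fun K2_kP K2_sP.

Lemma rec_tl k (m : k.-tuple nat -> nat) : recursive m -> recursive (fun t => code (code_tl (m t))).
Proof. exact: rec_behead. Qed.
Lemma rec_hd k (m : k.-tuple nat -> nat) : recursive m -> recursive (fun t => code_hd (m t)).
Proof. exact: rec_head. Qed.
Lemma rec_szt k (m : k.-tuple nat -> nat) : recursive m -> recursive (fun t => size (code_tl (m t))).
Proof.
move=> hm; apply: rec_ext (rec_size (rec_tl hm)) _ => t; by rewrite CodeSeq.codeK.
Qed.
Lemma rec_knt k (m i : k.-tuple nat -> nat) : recursive m -> recursive i ->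
  recursive (fun t => known (code_tl (m t)) (i t)).
Proof.
move=> hm hi; apply: rec_ext (rec_known (rec_tl hm) hi) _ => t; by rewrite CodeSeq.codeK.
Qed.

Lemma K2_k_rec : total_recursive K2_k.
Proof.
pose p : 1.-tuple nat -> nat := (@tnth 1 nat)^~ ord0.
have hp : recursive p by exact: rec_proj.
have hv : recursive (fun t => known (code_tl (p t)) (code_hd (code_hd (p t)))).
  by apply: rec_knt => //; do 2!apply: rec_hd.
by apply: rec_ifz; rsub.
Qed.

Lemma K2_s_rec : total_recursive K2_s.
Proof.
pose p : 1.-tuple nat -> nat := (@tnth 1 nat)^~ ord0.
have hp : recursive p by exact: rec_proj.
have hp1 := rec_hd hp; have hp2 := rec_hd hp1; have hp3 := rec_hd hp2.
apply: rec_ifz; last by rsub.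
  by apply: rec_subn; apply: rec_szt.
apply: rec_S; apply: rec_ifz; last by rsub.
  by apply: rec_subn; apply: rec_szt.
apply: rec_S.
have hk (q : 1.-tuple nat -> nat) : recursive q ->
   recursive (fun u : 2.-tuple nat => known (code_tl (q (bt u))) (tnth u ord0)).
  by move=> hq; apply: (@rec_knt 2 (fun u => q (bt u))); rsub.
have hk' (q : 1.-tuple nat -> nat) : recursive q ->
   recursive (fun u : 3.-tuple nat => known (code_tl (q (bt (bt u)))) (tnth u ord0)).
  by move=> hq; apply: (@rec_knt 3 (fun u => q (bt (bt u)))); rsub.
have hs (q : 1.-tuple nat -> nat) : recursive q ->
   recursive (fun u : 2.-tuple nat => sim (known (code_tl (q (bt u)))) (known (code_tl (code_hd (code_hd (p (bt u))))))
     (size (code_tl (code_hd (code_hd (p (bt u)))))) (tnth u ord0)).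
  move=> hq; apply: (@rec_sim 2 (fun i u => known (code_tl (q (bt u))) i)
      (fun i u => known (code_tl (code_hd (code_hd (p (bt u))))) i)).
  - exact: hk'.
  - exact: (hk' _ hp2).
  - exact: (rec_bt (rec_szt hp2)).
  - exact: rec_proj.
apply: (@rec_sim 1
  (fun i t => sim (known (code_tl (p t))) (known (code_tl (code_hd (code_hd (p t))))) (size (code_tl (code_hd (code_hd (p t))))) i)
  (fun i t => sim (known (code_tl (code_hd (p t)))) (known (code_tl (code_hd (code_hd (p t))))) (size (code_tl (code_hd (code_hd (p t))))) i)
  (fun t => size (code_tl (code_hd (code_hd (p t)))))).
- exact: hs.
- exact: (hs _ hp1).
- exact: rec_szt.
- exact: hp3.
Qed.

Lemma K2_app_rec a b c :
  total_recursive a -> total_recursive b -> K2_app a b c -> total_recursive c.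
Proof.
move=> ha hb /choice[kf hk].
have hm (x j : 2.-tuple nat -> nat) : recursive x -> recursive j ->
    recursive (fun t => a (code (x t :: mkseq b (j t)))).
  move=> hx hj; apply: (rec_app1 ha).
  apply: rec_ext (rec_cons hx (rec_mkseq (F := fun i _ => b i) _ hj)) _.
  - by apply: (rec_app1 hb); rsub.
  - by move=> t; rewrite CodeSeq.codeK.
have hkf : total_recursive kf.
  apply: (rec_mu (f := fun j (t : 1.-tuple nat) => ifz (a (code (tnth t ord0 :: mkseq b j))) 1 0)).
    apply: rec_ifz; try by rsub.
    apply: (hm (fun u => tnth (bt u) ord0)); last by rsub.
    exact: (rec_bt (rec_proj ord0)).
  move=> t; have [e l] := hk (tnth t ord0); split; first by rewrite e.
  by move=> n /l ->.
apply: rec_ext (_ : recursive (fun t : 1.-tuple nat => (a (code (tnth t ord0 :: mkseq b (kf (tnth t ord0))))).-1)) _.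
  apply: rec_pred; apply: (rec_app1 ha).
  apply: rec_ext (rec_cons (rec_proj ord0) (rec_mkseq (F := fun i _ => b i) _ hkf)) _.
  - by apply: (rec_app1 hb); rsub.
  - by move=> t; rewrite CodeSeq.codeK.
by move=> t; have [e _] := hk (tnth t ord0); rewrite e.
Qed.

Definition K2rec : subpca K2 := @Subpca K2 total_recursive K2_app_rec K2_k_rec K2_s_rec.

(* The equality of maps is a specified equivalence relation heq, as maps of
   realizability toposes are functional relations up to equivalence. *)

Record category := Category {
  ob :> Type;
  Hom : ob -> ob -> Type;
  heq : forall X Y, Hom X Y -> Hom X Y -> Prop;
  idm : forall X, Hom X X;
  comp : forall X Y Z, Hom Y Z -> Hom X Y -> Hom X Z;
  heq_equiv : forall X Y, Equivalence (@heq X Y);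
  comp_heq : forall X Y Z (g g' : Hom Y Z) (f f' : Hom X Y),
    heq g g' -> heq f f' -> heq (comp g f) (comp g' f');
  compA : forall W X Y Z (h : Hom Y Z) (g : Hom X Y) (f : Hom W X),
    heq (comp h (comp g f)) (comp (comp h g) f);
  comp1m : forall X Y (f : Hom X Y), heq (comp (idm Y) f) f;
  compm1 : forall X Y (f : Hom X Y), heq (comp f (idm X)) f }.

#[global] Existing Instance heq_equiv.

Declare Scope cat_scope.
Notation "f ≈ g" := (heq f g) (at level 70, no associativity) : cat_scope.
Notation "g ∘ f" := (comp g f) (at level 40, left associativity) : cat_scope.
Open Scope cat_scope.

Arguments idm {c} X.

#[global] Instance comp_Proper (C : category) (X Y Z : C) :
  Morphisms.Proper (Morphisms.respectful (@heq C Y Z)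
    (Morphisms.respectful (@heq C X Y) (@heq C X Z))) (@comp C X Y Z).
Proof. by move=> g g' hg f f' hf; exact: comp_heq. Qed.

#[global] Hint Extern 0 (heq _ _) => reflexivity : core.

Section Morphisms.
Variable C : category.

Definition is_pullback (P X Y Z : C) (p : Hom P X) (q : Hom P Y)
    (f : Hom X Z) (g : Hom Y Z) : Prop :=
  f ∘ p ≈ g ∘ q /\
  forall (W : C) (u : Hom W X) (v : Hom W Y), f ∘ u ≈ g ∘ v ->
    exists w : Hom W P, [/\ p ∘ w ≈ u, q ∘ w ≈ v &
      forall w' : Hom W P, p ∘ w' ≈ u -> q ∘ w' ≈ v -> w' ≈ w].

Record terminal := Terminal {
  tobj :> C;
  bang : forall X : C, Hom X tobj;
  bang_uniq : forall (X : C) (f : Hom X tobj), f ≈ bang X }.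

(* A family of maps over I is a vertical map of the codomain fibration over I *)
Record family (I : C) := Family {
  fdom : C;
  fcod : C;
  fdom_over : Hom fdom I;
  fcod_over : Hom fcod I;
  fmor : Hom fdom fcod;
  fmor_over : fcod_over ∘ fmor ≈ fdom_over }.

Definition family1 (one : terminal) (X Y : C) (f : Hom X Y) : family one :=
  Family (bang_uniq (bang one Y ∘ f)).

(* (top, bot) exhibits m' as the reindexing of m along s *)
Definition is_reindexing (K I : C) (s : Hom K I) (m' : family K) (m : family I)
    (top : Hom (fdom m') (fdom m)) (bot : Hom (fcod m') (fcod m)) : Prop :=
  [/\ is_pullback top (fdom_over m') (fdom_over m) s,
      is_pullback bot (fcod_over m') (fcod_over m) s &
      bot ∘ fmor m' ≈ fmor m ∘ top].

(* A family of lifting problems of m against f, indexed by K, is a commutative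
   square from the reindexing of m along some s : K -> I to f, lying over some
   t : K -> J. *)
Definition fibred_rlp (I J : C) (m : family I) (f : family J) : Prop :=
  forall (K : C) (s : Hom K I) (t : Hom K J) (m' : family K)
      (top : Hom (fdom m') (fdom m)) (bot : Hom (fcod m') (fcod m)),
    is_reindexing s top bot ->
  forall (u : Hom (fdom m') (fdom f)) (v : Hom (fcod m') (fcod f)),
    fdom_over f ∘ u ≈ t ∘ fdom_over m' ->
    fcod_over f ∘ v ≈ t ∘ fcod_over m' ->
    fmor f ∘ u ≈ v ∘ fmor m' ->
  exists j : Hom (fcod m') (fdom f),
    [/\ fdom_over f ∘ j ≈ t ∘ fcod_over m', j ∘ fmor m' ≈ u & fmor f ∘ j ≈ v].

End Morphisms.

Record functor (C D : category) := Functor {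
  fobj :> C -> D;
  fmap : forall X Y : C, Hom X Y -> Hom (fobj X) (fobj Y);
  fmap_heq : forall (X Y : C) (f g : Hom X Y), f ≈ g -> fmap f ≈ fmap g;
  fmap1 : forall X : C, fmap (idm X) ≈ idm (fobj X);
  fmapM : forall (X Y Z : C) (g : Hom Y Z) (f : Hom X Y),
    fmap (g ∘ f) ≈ fmap g ∘ fmap f }.

Record is_monad (C : category) (T : functor C C)
    (eta : forall X : C, Hom X (T X)) (mu : forall X : C, Hom (T (T X)) (T X)) : Prop :=
  IsMonad {
  eta_nat : forall (X Y : C) (f : Hom X Y), fmap T f ∘ eta X ≈ eta Y ∘ f;
  mu_nat : forall (X Y : C) (f : Hom X Y), fmap T f ∘ mu X ≈ mu Y ∘ fmap T (fmap T f);
  mu_etal : forall X : C, mu X ∘ eta (T X) ≈ idm (T X);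
  mu_etar : forall X : C, mu X ∘ fmap T (eta X) ≈ idm (T X);
  mu_assoc : forall X : C, mu X ∘ mu (T X) ≈ mu X ∘ fmap T (mu X) }.

Record is_comonad (C : category) (T : functor C C)
    (eps : forall X : C, Hom (T X) X) (delta : forall X : C, Hom (T X) (T (T X))) : Prop :=
  IsComonad {
  eps_nat : forall (X Y : C) (f : Hom X Y), f ∘ eps X ≈ eps Y ∘ fmap T f;
  delta_nat : forall (X Y : C) (f : Hom X Y),
    fmap T (fmap T f) ∘ delta X ≈ delta Y ∘ fmap T f;
  eps_deltal : forall X : C, eps (T X) ∘ delta X ≈ idm (T X);
  eps_deltar : forall X : C, fmap T (eps X) ∘ delta X ≈ idm (T X);
  delta_coassoc : forall X : C, delta (T X) ∘ delta X ≈ fmap T (delta X) ∘ delta X }.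

Definition is_algebra (C : category) (T : functor C C)
    (eta : forall X : C, Hom X (T X)) (mu : forall X : C, Hom (T (T X)) (T X))
    (X : C) (a : Hom (T X) X) : Prop :=
  a ∘ eta X ≈ idm X /\ a ∘ mu X ≈ a ∘ fmap T a.

Record is_distributive_law (C : category) (L R : functor C C)
    (eps : forall X : C, Hom (L X) X) (delta : forall X : C, Hom (L X) (L (L X)))
    (eta : forall X : C, Hom X (R X)) (mu : forall X : C, Hom (R (R X)) (R X))
    (lam : forall X : C, Hom (L (R X)) (R (L X))) : Prop := IsDistributiveLaw {
  lam_nat : forall (X Y : C) (f : Hom X Y),
    fmap R (fmap L f) ∘ lam X ≈ lam Y ∘ fmap L (fmap R f);
  lam_eta : forall X : C, lam X ∘ fmap L (eta X) ≈ eta (L X);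
  lam_eps : forall X : C, fmap R (eps X) ∘ lam X ≈ eps (R X);
  lam_mu : forall X : C,
    lam X ∘ fmap L (mu X) ≈ mu (L X) ∘ fmap R (lam X) ∘ lam (R X);
  lam_delta : forall X : C,
    fmap R (delta X) ∘ lam X ≈ lam (L X) ∘ fmap L (lam X) ∘ delta (R X) }.

Section Arrows.
Variable C : category.

Record arrow := Arrow { dom : C; cod : C; mor :> Hom dom cod }.

Record square (f g : arrow) := Square {
  top : Hom (dom f) (dom g);
  bot : Hom (cod f) (cod g);
  square_comm : mor g ∘ top ≈ bot ∘ mor f }.

Definition square_eq (f g : arrow) (s t : square f g) : Prop :=
  top s ≈ top t /\ bot s ≈ bot t.

Lemma square_id_comm (f : arrow) : mor f ∘ idm (dom f) ≈ idm (cod f) ∘ mor f.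
Proof. by rewrite compm1 comp1m. Qed.

Lemma square_comp_comm (f g h : arrow) (t : square g h) (s : square f g) :
  mor h ∘ (top t ∘ top s) ≈ (bot t ∘ bot s) ∘ mor f.
Proof. by rewrite compA square_comm -compA square_comm compA. Qed.

Lemma square_eq_equiv (f g : arrow) : Equivalence (@square_eq f g).
Proof.
split=> [s|s t [? ?]|s t u [a b] [c d]]; split; try reflexivity; try by symmetry.
- by rewrite a.
- by rewrite b.
Qed.

Definition arrow_category : category.
Proof.
refine (@Category arrow square square_eq
  (fun f => Square (square_id_comm f))
  (fun f g h t s => Square (square_comp_comm t s)) square_eq_equiv _ _ _ _).
- by move=> f g h t t' s s' [a b] [c d]; split; rewrite /= ?a ?b ?c ?d.
- by move=> *; split; exact: compA.
- by move=> *; split; exact: comp1m.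
- by move=> *; split; exact: compm1.
Defined.

(* Functorial factorisations: an arrow f factors as rpart f ∘ lpart f through
   mid f. *)
Record factorisation := Factorisation {
  mid : arrow -> C;
  lpart : forall f : arrow, Hom (dom f) (mid f);
  rpart : forall f : arrow, Hom (mid f) (cod f);
  factE : forall f : arrow, rpart f ∘ lpart f ≈ mor f;
  midmap : forall f g : arrow, square f g -> Hom (mid f) (mid g);
  midmap_heq : forall (f g : arrow) (s t : square f g),
    square_eq s t -> midmap s ≈ midmap t;
  midmap1 : forall f : arrow, midmap (Square (square_id_comm f)) ≈ idm (mid f);
  midmapM : forall (f g h : arrow) (t : square g h) (s : square f g),
    midmap (Square (square_comp_comm t s)) ≈ midmap t ∘ midmap s;
  lpart_nat : forall (f g : arrow) (s : square f g),
    lpart g ∘ top s ≈ midmap s ∘ lpart f;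
  rpart_nat : forall (f g : arrow) (s : square f g),
    rpart g ∘ midmap s ≈ bot s ∘ rpart f }.

Variable E : factorisation.

Definition Larr (f : arrow) : arrow := Arrow (lpart E f).
Definition Rarr (f : arrow) : arrow := Arrow (rpart E f).

Definition Lfun : functor arrow_category arrow_category.
Proof.
refine (@Functor arrow_category arrow_category Larr
  (fun f g s => @Square (Larr f) (Larr g) (top s) (midmap E s) (lpart_nat E s)) _ _ _).
- by move=> f g s t e; split; [case: e | exact: midmap_heq].
- by move=> f; split; [reflexivity | exact: midmap1].
- by move=> f g h t s; split; [reflexivity | exact: midmapM].
Defined.

Definition Rfun : functor arrow_category arrow_category.
Proof.
refine (@Functor arrow_category arrow_category Rarr
  (fun f g s => @Square (Rarr f) (Rarr g) (midmap E s) (bot s) (rpart_nat E s)) _ _ _).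
- by move=> f g s t e; split; [exact: midmap_heq | case: e].
- by move=> f; split; [exact: midmap1 | reflexivity].
- by move=> f g h t s; split; [exact: midmapM | reflexivity].
Defined.

Lemma Lcounit_comm f : mor f ∘ idm (dom f) ≈ rpart E f ∘ lpart E f.
Proof. by rewrite compm1 factE. Qed.

Lemma Runit_comm f : rpart E f ∘ lpart E f ≈ idm (cod f) ∘ mor f.
Proof. by rewrite comp1m factE. Qed.

(* counit (1, R f) : L f -> f and unit (L f, 1) : f -> R f *)
Definition Lcounit (f : arrow_category) : Hom (Lfun f) f :=
  @Square (Larr f) f (idm (dom f)) (rpart E f) (Lcounit_comm f).

Definition Runit (f : arrow_category) : Hom f (Rfun f) :=
  @Square f (Rarr f) (lpart E f) (idm (cod f)) (Runit_comm f).

End Arrows.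

Arguments Lfun {C} E.
Arguments Rfun {C} E.
Arguments Lcounit {C} E f.
Arguments Runit {C} E f.

(* The comultiplication is the identity on domains and the multiplication is
   the identity on codomains, so they are given by maps
   comult_mid f : E f -> E (L f) and mult_mid f : E (R f) -> E f. *)
Record awfs_data (C : category) := AwfsData {
  awfs_fact :> factorisation C;
  comult_mid : forall f : arrow C, Hom (mid awfs_fact f) (mid awfs_fact (Larr awfs_fact f));
  mult_mid : forall f : arrow C, Hom (mid awfs_fact (Rarr awfs_fact f)) (mid awfs_fact f);
  comult_mid_comm : forall f : arrow C,
    lpart awfs_fact (Larr awfs_fact f) ∘ idm (dom f) ≈ comult_mid f ∘ lpart awfs_fact f;
  mult_mid_comm : forall f : arrow C,
    rpart awfs_fact f ∘ mult_mid f ≈ idm (cod f) ∘ rpart awfs_fact (Rarr awfs_fact f) }.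

Section Awfs.
Variables (C : category) (E : awfs_data C).

Definition Lcomult (f : arrow_category C) : Hom (Lfun E f) (Lfun E (Lfun E f)) :=
  @Square C (Larr E f) (Larr E (Larr E f)) (idm (dom f)) (comult_mid E f) (comult_mid_comm E f).

Definition Rmult (f : arrow_category C) : Hom (Rfun E (Rfun E f)) (Rfun E f) :=
  @Square C (Rarr E (Rarr E f)) (Rarr E f) (mult_mid E f) (idm (cod f)) (mult_mid_comm E f).

Hypothesis L_comonad : is_comonad (Lcounit E) Lcomult.
Hypothesis R_monad : is_monad (Runit E) Rmult.

Lemma Ldistr_comm (f : arrow C) :
  rpart E (Larr E f) ∘ comult_mid E f ≈ mult_mid E f ∘ lpart E (Rarr E f).
Proof.
have [_ h1] := eps_deltal L_comonad f; have [h2 _] := mu_etal R_monad f.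
by move: h1 h2 => /= -> ->.
Qed.

Definition LRdistr (f : arrow_category C) : Hom (Lfun E (Rfun E f)) (Rfun E (Lfun E f)) :=
  @Square C (Larr E (Rarr E f)) (Rarr E (Larr E f)) (comult_mid E f) (mult_mid E f) (Ldistr_comm f).

End Awfs.

Record awfs (C : category) := Awfs {
  awfs_base :> awfs_data C;
  awfs_comonad : is_comonad (Lcounit awfs_base) (Lcomult awfs_base);
  awfs_monad : is_monad (Runit awfs_base) (Rmult awfs_base);
  awfs_distr : is_distributive_law (Lcounit awfs_base) (Lcomult awfs_base)
    (Runit awfs_base) (Rmult awfs_base) (LRdistr awfs_comonad awfs_monad) }.

Definition admits_right_map_structure (C : category) (W : awfs C) (X Y : C) (f : Hom X Y) : Prop :=
  exists a : Hom (Rfun W (Arrow f)) (Arrow f : arrow_category C),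
    is_algebra (Runit W) (Rmult W) a.

Section Terms.
Variable A : pca.

Inductive term := Cst of A | App of term & term.

Fixpoint evals (t : term) : A -> Prop :=
  match t with
  | Cst a => fun c => a = c
  | App t u => fun c => exists a b, [/\ evals t a, evals u b & app a b c]
  end.

Definition ti : term := App (App (Cst (sc A)) (Cst (kc A))) (Cst (kc A)).

(* The pairing \z. z a b, with bracket abstraction carried out. *)
Definition tpair (a b : A) : term :=
  App (App (Cst (sc A)) (App (App (Cst (sc A)) ti) (App (Cst (kc A)) (Cst a))))
      (App (Cst (kc A)) (Cst b)).

Lemma evals_fun t c c' : evals t c -> evals t c' -> c = c'.
Proof.
elim: t c c' => [a|t IHt u IHu] c c' /=; first by move=> <- <-.
move=> [a [b [ha hb h]]] [a' [b' [ha' hb' h']]].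
rewrite (IHt _ _ ha ha') (IHu _ _ hb hb') in h; exact: app_fun h h'.
Qed.

Lemma kc_ex (a : A) : exists u, app (kc A) a u /\ forall b, app u b a.
Proof.
have [u [hu _]] := kcP a a; exists u; split=> // b.
by have [u' [hu' h]] := kcP a b; rewrite (app_fun hu hu').
Qed.

Lemma ti_ex : exists i, evals ti i /\ forall a, app i a a.
Proof.
have [u [v [hu hv h]]] := scP (kc A) (kc A); exists v; split.
  by exists u, (kc A); split => //; exists (sc A), (kc A).
by move=> a; have [w [hw ha]] := kc_ex a; exact: (h _ _ _ _ hw hw (ha _)).
Qed.

Lemma tpair_ex (a b : A) : exists c, evals (tpair a b) c /\
  forall z u v, app z a u -> app u b v -> app c z v.
Proof.
have [i [ei hi]] := ti_ex.
have [ka [eka hka]] := kc_ex a; have [kb [ekb hkb]] := kc_ex b.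
have [u [v [hu hv h]]] := scP i ka; have [u' [v' [hu' hv' h']]] := scP v kb.
exists v'; split; last first.
  by move=> z x y zx xy; apply: (h' _ _ _ _ _ (hkb z) xy); exact: (h _ _ _ _ (hi z) (hka z) zx).
exists u', kb; split=> //; last by exists (kc A), b.
exists (sc A), v; split=> //; exists u, ka; split=> //; last by exists (kc A), a.
by exists (sc A), i; split.
Qed.

End Terms.

(* The relative realizability topos RT(A', A), as the topos of the tripos whose
   predicates on I are the functions I -> P(A), ordered by uniform realizability
   by an element of the sub-pca A'. *)
Section RelativeRealizability.
Variables (A : pca) (A' : subpca A).

Definition entails (I : Type) (phi psi : I -> A -> Prop) : Prop :=
  exists2 r, A' r & forall i a, phi i a -> exists2 b, app r a b & psi i b.

Definition pand (p q : A -> Prop) : A -> Prop :=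
  fun c => exists a b, [/\ p a, q b & evals (tpair a b) c].

(* Objects of RT(A', A): sets with a partial equivalence relation in the tripos.
   Maps: functional relations. *)
Record robj := RObj {
  rcarrier :> Type;
  eqv : rcarrier -> rcarrier -> A -> Prop;
  eqv_sym : entails (fun '(x, y) => eqv x y) (fun '(x, y) => eqv y x);
  eqv_trans : entails (fun '(x, y, z) => pand (eqv x y) (eqv y z)) (fun '(x, y, z) => eqv x z) }.

Record funrel (X Y : robj) := FunRel {
  rel :> X -> Y -> A -> Prop;
  rel_strict : entails (fun '(x, y) => rel x y) (fun '(x, y) => pand (eqv x x) (eqv y y));
  rel_ext : entails (fun '(x, x', y, y') => pand (rel x y) (pand (eqv x x') (eqv y y')))
                    (fun '(x, x', y, y') => rel x' y');
  rel_single : entails (fun '(x, y, y') => pand (rel x y) (rel x y'))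
                       (fun '(x, y, y') => eqv y y');
  rel_total : entails (fun x => eqv x x) (fun x a => exists y, rel x y a) }.

Definition funrel_eq (X Y : robj) (F G : funrel X Y) : Prop :=
  entails (fun '(x, y) => F x y) (fun '(x, y) => G x y) /\
  entails (fun '(x, y) => G x y) (fun '(x, y) => F x y).

Lemma K_ex (c : A) : A' c -> exists2 h, A' h & forall x, app h x c.
Proof.
move=> hc; have [u [hu h]] := kc_ex c; exists u => //.
exact: (subpca_app (subpca_k A') hc hu).
Qed.

Lemma S_ex (f g : A) : A' f -> A' g -> exists2 h, A' h &
  forall x u v w, app f x u -> app g x v -> app u v w -> app h x w.
Proof.
move=> hf hg; have [u [v [hu hv h]]] := scP f g; exists v => //.
by apply: (subpca_app _ hg hv); exact: (subpca_app (subpca_s A') hf hu).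
Qed.

Lemma ti_in : exists i, [/\ A' i, evals (ti A) i & forall a, app i a a].
Proof.
have [i [ei hi]] := ti_ex A; exists i; split=> //.
have [u [b [[s [k [/= <- <- hu]]] <- h]]] := ei.
exact: (subpca_app (subpca_app (subpca_s _) (subpca_k _) hu) (subpca_k _) h).
Qed.

Lemma ent_refl I (phi : I -> A -> Prop) : entails phi phi.
Proof. by have [i [hi _ h]] := ti_in; exists i => // j a; exists a. Qed.

Lemma ent_trans I (phi psi chi : I -> A -> Prop) :
  entails phi psi -> entails psi chi -> entails phi chi.
Proof.
move=> [r hr H] [s hs H']; have [k hk Hk] := K_ex hs; have [h hh Hh] := S_ex hk hr.
exists h => // i a /H[b ab /H'[c bc hc]]; exists c => //.
exact: Hh (Hk a) ab bc.
Qed.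

Lemma ent_and I (phi psi chi : I -> A -> Prop) :
  entails phi psi -> entails phi chi -> entails phi (fun i => pand (psi i) (chi i)).
Proof.
move=> [r hr H] [s hs H'].
have [i [hi ei Hi]] := ti_in.
have hsi : exists2 si, A' si & app (sc A) i si.
  have [u [_ [hu _ _]]] := scP i i; exists u => //; exact: subpca_app (subpca_s _) hi hu.
case: hsi => si hsi Hsi.
have [kk hkk Hkk] := K_ex (subpca_k A'); have [ks hks Hks] := K_ex (subpca_s A').
have [ksi hksi Hksi] := K_ex hsi.
have [h1 hh1 H1] := S_ex hkk hr; have [h2 hh2 H2] := S_ex hksi hh1.
have [h3 hh3 H3] := S_ex hks hh2; have [h4 hh4 H4] := S_ex hkk hs.
have [h5 hh5 H5] := S_ex hh3 hh4.
exists h5 => // j x hx; have [u ru pu] := H j x hx; have [v sv pv] := H' j x hx.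
have [c [ec _]] := tpair_ex u v; exists c; last by exists u, v.
have [p [q [[s' [wv [/= <- [siv [ku [[s'' [i' [<- ei' h'']]] [k1 [u1 [<- <- hku]]] hwv]]] hp]]] [k2 [v2 [<- <- hq]]] hc]]] := ec.
rewrite -(evals_fun ei ei') in h''; rewrite -(app_fun Hsi h'') in hwv.
apply: (H5 _ _ _ _ _ _ hc); last exact: H4 (Hkk x) sv hq.
apply: (H3 _ _ _ _ (Hks x) _ hp); apply: (H2 _ _ _ _ (Hksi x) _ hwv).
exact: H1 (Hkk x) ru hku.
Qed.

Lemma ent_proj (z : A) : A' z -> exists2 h, A' h &
  forall a b c u v, evals (tpair a b) c -> app z a u -> app u b v -> app h c v.
Proof.
move=> hz; have [i [hi _ Hi]] := ti_in; have [k hk Hk] := K_ex hz.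
have [h hh H] := S_ex hi hk; exists h => // a b c u v e au uv.
have [c' [e' H']] := tpair_ex a b; rewrite (evals_fun e e').
exact: H (Hi _) (Hk _) (H' _ _ _ au uv).
Qed.

Lemma ent_l I (phi psi chi : I -> A -> Prop) :
  entails phi (fun i => pand (psi i) (chi i)) -> entails phi psi.
Proof.
move=> h; apply: ent_trans h _; have [h hh H] := ent_proj (subpca_k A').
exists h => // i c [a [b [pa _ e]]]; exists a => //.
by have [u [hu hb]] := kc_ex a; exact: H e hu (hb _).
Qed.

Lemma ent_r I (phi psi chi : I -> A -> Prop) :
  entails phi (fun i => pand (psi i) (chi i)) -> entails phi chi.
Proof.
move=> h; apply: ent_trans h _; have [j [hj _ Hj]] := ti_in.
have [kb hkb Hkb] := K_ex hj; have [h hh H] := ent_proj hkb.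
exists h => // i c [a [b [_ pb e]]]; exists b => //; exact: H e (Hkb _) (Hj _).
Qed.

Lemma ent_reindex I J (f : J -> I) (phi psi : I -> A -> Prop) :
  entails phi psi -> entails (fun j => phi (f j)) (fun j => psi (f j)).
Proof. by case=> r hr H; exists r => // j; exact: H. Qed.

Lemma ent_ex I Y (gam : I -> A -> Prop) (phi : I -> Y -> A -> Prop) (psi : I -> A -> Prop) :
  entails gam (fun i a => exists y, phi i y a) ->
  entails (fun p : I * Y => pand (gam p.1) (phi p.1 p.2)) (fun p => psi p.1) ->
  entails gam psi.
Proof.
move=> h1 [r hr H]; apply: ent_trans (ent_and (ent_refl gam) h1) _.
by exists r => // i c [a [b [ga [y fy] e]]]; apply: (H (i, y)); exists a, b.
Qed.

Lemma ent_exI I Y (gam : I -> A -> Prop) (phi : I -> Y -> A -> Prop) (f : I -> Y) :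
  entails gam (fun i => phi i (f i)) -> entails gam (fun i a => exists y, phi i y a).
Proof. by case=> r hr H; exists r => // i a /H[b ab hb]; exists b => //; exists (f i). Qed.

Section Rules.
Variables (I : Type) (gam : I -> A -> Prop).

Lemma sym_rule (X : robj) (x y : I -> X) :
  entails gam (fun i => eqv (x i) (y i)) -> entails gam (fun i => eqv (y i) (x i)).
Proof. by move=> h; apply: ent_trans h (ent_reindex (fun i => (x i, y i)) (eqv_sym X)). Qed.

Lemma trans_rule (X : robj) (x y z : I -> X) :
  entails gam (fun i => eqv (x i) (y i)) -> entails gam (fun i => eqv (y i) (z i)) ->
  entails gam (fun i => eqv (x i) (z i)).
Proof.
move=> h h'; apply: ent_trans (ent_and h h') _.
exact: (ent_reindex (fun i => (x i, y i, z i)) (eqv_trans X)).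
Qed.

Lemma refl_rule (X : robj) (x y : I -> X) :
  entails gam (fun i => eqv (x i) (y i)) -> entails gam (fun i => eqv (x i) (x i)).
Proof. by move=> h; apply: trans_rule h (sym_rule h). Qed.

Variables (X Y : robj) (F : funrel X Y).

Lemma strictl_rule (x : I -> X) (y : I -> Y) :
  entails gam (fun i => F (x i) (y i)) -> entails gam (fun i => eqv (x i) (x i)).
Proof.
move=> h; apply: ent_l (fun i => eqv (y i) (y i)) _; apply: ent_trans h _.
exact: (ent_reindex (fun i => (x i, y i)) (rel_strict F)).
Qed.

Lemma strictr_rule (x : I -> X) (y : I -> Y) :
  entails gam (fun i => F (x i) (y i)) -> entails gam (fun i => eqv (y i) (y i)).
Proof.
move=> h; apply: ent_r (fun i => eqv (x i) (x i)) _ _; apply: ent_trans h _.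
exact: (ent_reindex (fun i => (x i, y i)) (rel_strict F)).
Qed.

Lemma ext_rule (x x' : I -> X) (y y' : I -> Y) :
  entails gam (fun i => F (x i) (y i)) ->
  entails gam (fun i => eqv (x i) (x' i)) -> entails gam (fun i => eqv (y i) (y' i)) ->
  entails gam (fun i => F (x' i) (y' i)).
Proof.
move=> h h1 h2; apply: ent_trans (ent_and h (ent_and h1 h2)) _.
exact: (ent_reindex (fun i => (x i, x' i, y i, y' i)) (rel_ext F)).
Qed.

Lemma single_rule (x : I -> X) (y y' : I -> Y) :
  entails gam (fun i => F (x i) (y i)) -> entails gam (fun i => F (x i) (y' i)) ->
  entails gam (fun i => eqv (y i) (y' i)).
Proof.
move=> h h'; apply: ent_trans (ent_and h h') _.
exact: (ent_reindex (fun i => (x i, y i, y' i)) (rel_single F)).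
Qed.

Lemma total_rule (x : I -> X) :
  entails gam (fun i => eqv (x i) (x i)) ->
  entails gam (fun i a => exists y, F (x i) y a).
Proof. by move=> h; apply: ent_trans h (ent_reindex x (rel_total F)). Qed.

End Rules.

Lemma ent_mono I (phi psi phi' psi' : I -> A -> Prop) :
  entails phi psi -> (forall i a, phi' i a -> phi i a) ->
  (forall i a, psi i a -> psi' i a) -> entails phi' psi'.
Proof.
move=> [r hr H] h h'; exists r => // i a /h/H[b ab hb]; exists b => //; exact: h'.
Qed.

Lemma funrel_eqI (X Y : robj) (F G : funrel X Y) :
  entails (fun i : X * Y => F i.1 i.2) (fun i => G i.1 i.2) -> funrel_eq F G.
Proof.
move=> h; split.
  by apply: ent_mono h _ _ => -[].
suff: entails (fun i : X * Y => G i.1 i.2) (fun i => F i.1 i.2).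
  by move=> H; apply: ent_mono H _ _ => -[].
have g := ent_refl (fun i : X * Y => G i.1 i.2).
apply: ent_ex (total_rule F (strictl_rule g)) _.
set gam := fun _ => _.
have hg : entails gam (fun i => G i.1.1 i.1.2) by exact: ent_l (ent_refl _).
have hf : entails gam (fun i => F i.1.1 i.2) by exact: ent_r (ent_refl _).
have hg' : entails gam (fun i => G i.1.1 i.2).
  apply: ent_trans hf _; exact: (ent_reindex (fun i => (i.1.1, i.2)) h).
exact: ext_rule hf (strictl_rule hf) (single_rule hg' hg).
Qed.

Lemma id_strict (X : robj) : entails (fun '(x, y) => @eqv X x y)
  (fun '(x, y) => pand (@eqv X x x) (@eqv X y y)).
Proof.
have g := ent_refl (fun i : X * X => eqv i.1 i.2).
have h := ent_and (refl_rule g) (refl_rule (sym_rule g)).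
by apply: ent_mono h _ _ => -[].
Qed.

Lemma id_ext (X : robj) :
  entails (fun '(x, x', y, y') => pand (@eqv X x y) (pand (@eqv X x x') (@eqv X y y')))
          (fun '(x, x', y, y') => @eqv X x' y').
Proof.
pose gam (i : X * X * X * X) := pand (eqv i.1.1.1 i.1.2)
   (pand (eqv i.1.1.1 i.1.1.2) (eqv i.1.2 i.2)).
have g := ent_refl gam; have g1 := ent_l g; have g2 := ent_l (ent_r g).
have g3 := ent_r (ent_r g).
have h := trans_rule (sym_rule g2) (trans_rule g1 g3).
by apply: ent_mono h _ _ => -[[[]]].
Qed.

Lemma id_single (X : robj) :
  entails (fun '(x, y, y') => pand (@eqv X x y) (@eqv X x y')) (fun '(x, y, y') => @eqv X y y').
Proof.
pose gam (i : X * X * X) := pand (eqv i.1.1 i.1.2) (eqv i.1.1 i.2).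
have g := ent_refl gam; have g1 := ent_l g; have g2 := ent_r g.
have h := trans_rule (sym_rule g1) g2.
by apply: ent_mono h _ _ => -[[]].
Qed.

Lemma id_total (X : robj) : entails (fun x => @eqv X x x) (fun x a => exists y, eqv x y a).
Proof. exact: (ent_exI (f := id) (ent_refl _)). Qed.

Definition id_rel (X : robj) : funrel X X :=
  FunRel (id_strict X) (id_ext X) (id_single X) (id_total X).

Section Composition.
Variables (X Y Z : robj) (G : funrel Y Z) (F : funrel X Y).

Definition crel (x : X) (z : Z) : A -> Prop := fun a => exists y, pand (F x y) (G y z) a.

Section CRules.
Variables (I : Type) (gam : I -> A -> Prop) (x : I -> X) (z : I -> Z).

Lemma crel_elim (psi : I -> A -> Prop) : entails gam (fun i => crel (x i) (z i)) ->
  (forall del : I * Y -> A -> Prop, entails del (fun p => gam p.1) ->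
     entails del (fun p => F (x p.1) p.2) ->
     entails del (fun p => G p.2 (z p.1)) -> entails del (fun p => psi p.1)) ->
  entails gam psi.
Proof.
move=> h H; apply: ent_ex h _; apply: H.
- exact: ent_l (ent_refl _).
- exact: ent_l (ent_r (ent_refl _)).
- exact: ent_r (ent_r (ent_refl _)).
Qed.

Lemma crel_intro (y : I -> Y) : entails gam (fun i => F (x i) (y i)) ->
  entails gam (fun i => G (y i) (z i)) -> entails gam (fun i => crel (x i) (z i)).
Proof. by move=> h h'; apply: (ent_exI (f := y)); exact: ent_and h h'. Qed.
End CRules.

Lemma crel_strict : entails (fun '(x, z) => crel x z)
  (fun '(x, z) => pand (eqv x x) (eqv z z)).
Proof.
suff h : entails (fun i : X * Z => crel i.1 i.2) (fun i => pand (eqv i.1 i.1) (eqv i.2 i.2)).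
  by apply: ent_mono h _ _ => -[].
apply: crel_elim (ent_refl _) _ => del _ hf hg.
exact: ent_and (strictl_rule hf) (strictr_rule hg).
Qed.

Lemma crel_ext :
  entails (fun '(x, x', y, y') => pand (crel x y) (pand (eqv x x') (eqv y y')))
          (fun '(x, x', y, y') => crel x' y').
Proof.
pose gam (i : X * X * Z * Z) := pand (crel i.1.1.1 i.1.2)
   (pand (eqv i.1.1.1 i.1.1.2) (eqv i.1.2 i.2)).
suff h : entails gam (fun i => crel i.1.1.2 i.2) by apply: ent_mono h _ _ => -[[[]]].
apply: crel_elim (ent_l (ent_refl gam)) _ => del hd hf hg.
have g1 := ent_l (ent_r hd); have g2 := ent_r (ent_r hd).
exact: crel_intro (ext_rule hf g1 (strictr_rule hf)) (ext_rule hg (strictl_rule hg) g2).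
Qed.

Lemma crel_single : entails (fun '(x, y, y') => pand (crel x y) (crel x y'))
   (fun '(x, y, y') => eqv y y').
Proof.
pose gam (i : X * Z * Z) := pand (crel i.1.1 i.1.2) (crel i.1.1 i.2).
suff h : entails gam (fun i => eqv i.1.2 i.2) by apply: ent_mono h _ _ => -[[]].
apply: crel_elim (ent_l (ent_refl gam)) _ => del hd hf hg.
apply: crel_elim (ent_r hd) _ => del' hd' hf' hg'.
have wk (phi psi : X * Z * Z * Y -> A -> Prop) : entails phi psi ->
   entails (fun p : X * Z * Z * Y * Y => phi p.1) (fun p => psi p.1).
  exact: (ent_reindex fst).
have e := single_rule (ent_trans hd' (wk _ _ hf)) hf'.
have hgd := ent_trans hd' (wk _ _ hg).
exact: single_rule (ext_rule hgd e (strictr_rule hgd)) hg'.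
Qed.

Lemma crel_total : entails (fun x => eqv x x) (fun x a => exists z, crel x z a).
Proof.
have g := ent_refl (fun x : X => eqv x x).
apply: ent_ex (total_rule F g) _.
have hf : entails (fun p : X * Y => pand (eqv p.1 p.1) (F p.1 p.2)) (fun p => F p.1 p.2).
  exact: ent_r (ent_refl _).
apply: ent_ex (total_rule G (strictr_rule hf)) _.
apply: (ent_exI (f := snd)); apply: (crel_intro (y := fun p => p.1.2)).
  exact: ent_r (ent_l (ent_refl _)).
exact: ent_r (ent_refl _).
Qed.

Definition comp_rel : funrel X Z := FunRel crel_strict crel_ext crel_single crel_total.

End Composition.

Lemma funrel_eq_rule (X Y : robj) (F G : funrel X Y) : funrel_eq F G ->
  forall I (gam : I -> A -> Prop) (x : I -> X) (y : I -> Y),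
  entails gam (fun i => F (x i) (y i)) -> entails gam (fun i => G (x i) (y i)).
Proof.
move=> [h _] I gam x y hf; apply: ent_trans hf _.
exact: (ent_reindex (fun i => (x i, y i)) h).
Qed.

Lemma funrel_eq_equiv (X Y : robj) : Equivalence (@funrel_eq X Y).
Proof.
split=> [F|F G [h h']|F G H [h1 h2] [h3 h4]]; split=> //; try exact: ent_refl.
- exact: ent_trans h1 h3.
- exact: ent_trans h4 h2.
Qed.

Definition RT : category.
Proof.
refine (@Category robj funrel funrel_eq id_rel comp_rel funrel_eq_equiv _ _ _ _).
- move=> X Y Z G G' F F' hG hF; apply: funrel_eqI.
  apply: crel_elim (ent_refl _) _ => del _ hf hg.
  exact: crel_intro (funrel_eq_rule hF hf) (funrel_eq_rule hG hg).
- move=> W X Y Z H G F; apply: funrel_eqI.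
  apply: crel_elim (ent_refl _) _ => del hd hgf hh.
  apply: (crel_elim (G := G) (F := F) hgf) => del' hd' hf hg.
  apply: crel_intro hf _; apply: crel_intro hg _.
  exact: ent_trans hd' (ent_reindex fst hh).
- move=> X Y F; apply: funrel_eqI.
  apply: crel_elim (ent_refl _) _ => del _ hf hg.
  exact: ext_rule hf (strictl_rule hf) hg.
- move=> X Y F; apply: funrel_eqI.
  apply: crel_elim (ent_refl _) _ => del _ hf hg.
  exact: ext_rule hg (sym_rule hf) (strictr_rule hg).
Defined.

Lemma ent_true I (gam : I -> A -> Prop) : entails gam (fun _ _ => True).
Proof. by have [i [hi _ H]] := ti_in; exists i => // j a _; exists a. Qed.

Lemma one_sym : entails (fun '((x, y) : unit * unit) (_ : A) => True) (fun '(x, y) _ => True).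
Proof. by apply: ent_mono (ent_true (fun _ _ => True)) _ _ => // -[]. Qed.

Lemma one_trans : entails
  (fun '((x, y, z) : unit * unit * unit) => pand (fun _ => True) (fun _ => True))
  (fun '(x, y, z) _ => True).
Proof. by apply: ent_mono (ent_true (fun _ _ => True)) _ _ => // -[[]]. Qed.

Definition one_obj : robj := @RObj unit (fun _ _ _ => True) one_sym one_trans.

Section Bang.
Variable X : robj.

Definition brel (x : X) (_ : one_obj) : A -> Prop := eqv x x.

Lemma brel_strict : entails (fun '(x, y) => brel x y) (fun '(x, y) => pand (eqv x x) (eqv y y)).
Proof.
have h := ent_and (ent_refl (fun i : X * one_obj => eqv i.1 i.1)) (ent_true _).
by apply: ent_mono h _ _ => -[].
Qed.

Lemma brel_ext :
  entails (fun '(x, x', y, y') => pand (brel x y) (pand (eqv x x') (eqv y y')))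
          (fun '(x, x', y, y') => brel x' y').
Proof.
pose gam (i : X * X * one_obj * one_obj) := pand (eqv i.1.1.1 i.1.1.1)
   (pand (eqv i.1.1.1 i.1.1.2) (eqv i.1.2 i.2)).
have h := refl_rule (sym_rule (ent_l (ent_r (ent_refl gam)))).
by apply: ent_mono h _ _ => -[[[]]].
Qed.

Lemma brel_single : entails (fun '(x, y, y') => pand (brel x y) (brel x y'))
  (fun '(x, y, y') => eqv y y').
Proof.
pose gam (i : X * one_obj * one_obj) := pand (brel i.1.1 i.1.2) (brel i.1.1 i.2).
by apply: ent_mono (ent_true gam) _ _ => -[[]].
Qed.

Lemma brel_total : entails (fun x => eqv x x) (fun x a => exists y, brel x y a).
Proof. exact: (ent_exI (phi := brel) (f := fun _ => tt) (ent_refl _)). Qed.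

Definition bang_rel : funrel X one_obj :=
  FunRel brel_strict brel_ext brel_single brel_total.

Lemma bang_rel_uniq (F : funrel X one_obj) : funrel_eq F bang_rel.
Proof. by apply: funrel_eqI; exact: strictl_rule (ent_refl _). Qed.

End Bang.

Definition RT_one : terminal RT := @Terminal RT one_obj bang_rel bang_rel_uniq.

(* Assemblies, as the objects whose equality predicate is concentrated on the
   diagonal. *)
Record assembly := Assembly {
  asm_set :> Type;
  asm_E : asm_set -> A -> Prop;
  asm_inh : forall x, exists a, asm_E x a }.

Section Assemblies.
Variable X : assembly.

Definition asm_eqv (x y : X) : A -> Prop := fun a => x = y /\ asm_E x a.

Lemma asm_sym : entails (fun '(x, y) => asm_eqv x y) (fun '(x, y) => asm_eqv y x).
Proof.
by apply: ent_mono (ent_refl (fun i => asm_eqv i.1 i.2)) _ _ => -[x y] a //= [<- ha].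
Qed.

Lemma asm_trans : entails (fun '(x, y, z) => pand (asm_eqv x y) (asm_eqv y z))
  (fun '(x, y, z) => asm_eqv x z).
Proof.
pose gam (i : X * X * X) := pand (asm_eqv i.1.1 i.2) (fun _ => True).
apply: ent_mono (ent_l (ent_refl gam)) _ _ => -[[x y] z] //= a [b [c [[<- h] [<- _] e]]].
by exists b, c.
Qed.

Definition asm_obj : robj := RObj asm_sym asm_trans.

(* The global element given by a point whose existence is realized in A'. *)
Variables (x : X) (e : A).
Hypotheses (e_in : A' e) (e_x : asm_E x e).

Definition prel (_ : one_obj) (y : asm_obj) : A -> Prop := fun a => x = y /\ asm_E x a.

Lemma prel_strict : entails (fun '(u, y) => prel u y) (fun '(u, y) => pand (eqv u u) (eqv y y)).
Proof.
have h := ent_and (ent_true _) (ent_refl (fun i : one_obj * asm_obj => prel i.1 i.2)).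
apply: ent_mono h _ _ => -[u y] //= a [b [c [_ [<- h] h']]]; by exists b, c; split.
Qed.

Lemma prel_ext :
  entails (fun '(u, u', y, y') => pand (prel u y) (pand (eqv u u') (eqv y y')))
          (fun '(u, u', y, y') => prel u' y').
Proof.
pose gam (i : one_obj * one_obj * asm_obj * asm_obj) :=
  pand (fun _ => True) (pand (fun _ => True) (prel i.1.1.1 i.2)).
apply: ent_mono (ent_r (ent_r (ent_refl gam))) _ _ => -[[[u u'] y] y'] //= a.
case=> b [c [[xy _] [b' [c' [_ [yy' h'] e1]]] e2]].
by exists b, c; split=> //; exists b', c'; split=> //; rewrite -yy' -xy in h' *.
Qed.

Lemma prel_single : entails (fun '(u, y, y') => pand (prel u y) (prel u y'))
  (fun '(u, y, y') => eqv y y').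
Proof.
pose gam (i : one_obj * asm_obj * asm_obj) := pand (eqv i.1.2 i.2) (fun _ => True).
apply: ent_mono (ent_l (ent_refl gam)) _ _ => -[[u y] y'] //= a.
by case=> b [c [[<- h] [<- _] e1]]; exists b, c.
Qed.

Lemma prel_total : entails (fun u => eqv u u) (fun u a => exists y, prel u y a).
Proof. by have [h hh H] := K_ex e_in; exists h => // u a _; exists e => //; exists x. Qed.

Definition asm_point : funrel one_obj asm_obj :=
  FunRel prel_strict prel_ext prel_single prel_total.

End Assemblies.

End RelativeRealizability.

Definition KV : category := RT K2rec.

Section Interval.
Variable R : realType.

Definition even_part (a : nat -> nat) (n : nat) : nat := a n.*2.
Definition odd_part (a : nat -> nat) (n : nat) : nat := a n.*2.+1.

(* Three successive values p, q, d encode the rational (p - q) / (d + 1). *)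
Definition rat_seq (a : nat -> nat) (n : nat) : rat :=
  (((a (3 * n)%N)%:R - (a (3 * n).+1)%:R) / (a (3 * n).+2).+1%:R)%R.

Definition cauchy_with_modulus (q : nat -> rat) (M : nat -> nat) : Prop :=
  forall k m n, M k <= m -> M k <= n -> (`|q m - q n| <= k.+1%:R^-1)%R.

(* The functions encoding Cauchy sequences of rationals that converge to x. As
   usual in realizability, an encoding of a Cauchy sequence (q n) includes a
   witness of the Cauchy property, that is a modulus. *)
Definition cauchy_name (x : R) (a : nat -> nat) : Prop :=
  cauchy_with_modulus (rat_seq (even_part a)) (odd_part a) /\
  ((fun n => ratr (rat_seq (even_part a) n) : R) @ \oo --> x)%classic.

Definition unit_interval : Type := {x : R | (0 <= x <= 1)%R}.

Definition unit_interval_E (x : unit_interval) : K2 -> Prop := cauchy_name (sval x).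

Lemma unit_interval_inh (x : unit_interval) : exists a, unit_interval_E x a.
Proof.
case: x => x xP; rewrite /unit_interval_E /=; have /andP[x0 x1] := xP.
pose t n := Num.truncn (x * n.+1%:R)%R.
pose f n := if n %% 3 == 0 then t (n %/ 3) else if n %% 3 == 1 then 0 else n %/ 3.
pose a n := if odd n then n.+1 else f n./2.
have qE n : rat_seq (even_part a) n = ((t n)%:R / n.+1%:R)%R.
  have e0 : 3 * n = n * 3 by exact: mulnC.
  have e1 : (3 * n).+1 = n * 3 + 1 by rewrite mulnC addn1.
  have e2 : (3 * n).+2 = n * 3 + 2 by rewrite mulnC addn2.
  rewrite /rat_seq /even_part /a !odd_double !doubleK /f e2 e1 e0.
  by rewrite !modnMDl !divnMDl // modnMl mulnK //= addn0 subr0.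
have tP n : (`|(ratr (rat_seq (even_part a) n) : R) - x| <= n.+1%:R^-1)%R.
  have n0 : (0 < n.+1%:R :> R)%R by rewrite ltr0n.
  have /andP[t1 t2] : ((t n)%:R <= x * n.+1%:R < (t n).+1%:R)%R.
    by apply: truncn_itv; rewrite mulr_ge0.
  rewrite qE fmorph_div /= !ratr_nat distrC ger0_norm; last first.
    by rewrite subr_ge0 ler_pdivrMr.
  rewrite -(ler_pM2r n0) mulrBl divfK ?gt_eqF // mulVf ?gt_eqF //.
  by rewrite lerBlDl natr1 ltW.
have inv (F : realFieldType) m n : n <= m -> (m.+1%:R^-1 <= n.+1%:R^-1 :> F)%R.
  by move=> mn; rewrite lef_pV2 ?posrE ?ltr0n // ler_nat ltnS.
exists a; split=> [k m n|].
  have -> : odd_part a k = k.*2.+2 by rewrite /odd_part /a /= odd_double.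
  move=> km kn; rewrite -(ler_rat R) ratr_norm fmorphV rmorph_nat rmorphB /=.
  rewrite -[X in (`|X|)%R](subrKA x); apply: le_trans (ler_normD _ _) _.
  have tP' : (`|x - ratr (rat_seq (even_part a) n)| <= n.+1%:R^-1)%R by rewrite distrC.
  apply: le_trans (lerD (tP m) tP') _.
  have h : (k.*2.+2%:R^-1 + k.*2.+2%:R^-1 = k.+1%:R^-1 :> R)%R.
    have -> : k.*2.+2 = (k.+1 * 2)%N by rewrite muln2.
    have k0 : (k.+1%:R != 0 :> R)%R by rewrite pnatr_eq0.
    rewrite natrM invfM -mulrDr -[RHS]mulr1; congr (_ * _)%R.
    by rewrite [RHS](splitr 1%R) mul1r.
  rewrite -h; apply: lerD; rewrite lef_pV2 ?posrE ?ltr0n // ler_nat ltnW //.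
apply/cvgrPdist_le => _/posnumP[e].
have := near_infty_natSinv_lt e.
apply: filterS => n /= /ltW; apply: le_trans; rewrite distrC; exact: tP.
Qed.

Lemma unit_interval_0 : (0 <= (0 : R) <= 1)%R.
Proof. by rewrite lexx ler01. Qed.

Definition zero_pt : unit_interval := exist _ 0%R unit_interval_0.

Definition zero_name : nat -> nat := fun _ => 0.

Lemma zero_name_rec : total_recursive zero_name.
Proof. exact: rec_const. Qed.

Lemma zero_nameP : unit_interval_E zero_pt zero_name.
Proof.
have q0 n : rat_seq (even_part zero_name) n = 0%R.
  by rewrite /rat_seq /even_part /zero_name GRing.subr0 GRing.mul0r.
split=> [k m n _ _|]; first by rewrite !q0 GRing.subr0 normr0 invr_ge0 ler0n.
rewrite (_ : (fun n => _) = fun _ => 0%R); first exact: cvg_cst.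
by apply/funext => n; rewrite q0 rmorph0.
Qed.

Definition I01 : assembly K2 := Assembly unit_interval_inh.

Definition interval : KV := asm_obj K2rec I01.

Definition delta0 : Hom (RT_one K2rec : KV) interval :=
  @asm_point K2 K2rec I01 zero_pt zero_name zero_name_rec zero_nameP.

Definition computable_hurewicz_fibration (X Y : KV) (f : Hom X Y) : Prop :=
  fibred_rlp (family1 (RT_one K2rec) delta0) (family1 (RT_one K2rec) f).

End Interval.

(* Main.v *)
(** Let P be the object of points of [0,1] with chosen realizers; it is isomorphic
    to [0,1], and X x P is a product of X and [0,1]. Right lifting against all the
    maps X -> X x P is the same as a lift of a single universal problem, which lives
    over the object of pairs (z, c) of a point z and a path c starting below z, so a
    map that has all lifts has lifts that are natural in X. Such natural lift
    structures compose, and if every map f factors through a free map with a lift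
    structure, then the functoriality, the comultiplication and the multiplication
    of an awfs, and all its equations, follow from the universal property.

    As the domain of delta_0 is terminal, the free fibration on f : X -> Y is finitary:
    its points are a point of X followed by a finite list of successive paths c of Y,
    each with a time p, modulo the deletion of the paths with p = 0. It is the set of
    raw lists with the least suitable partial equivalence relation in the tripos,
    which is defined impredicatively. Maps are compared by evaluation at generalized
    elements whose domain is a partitioned assembly, and these are projective. *)

From Corelib Require Import RelationClasses.
From mathcomp Require Import all_boot.
From mathcomp Require Import boolp reals.
Require Import Defs.

Set Implicit Arguments.
Unset Strict Implicit.
Unset Printing Implicit Defensive.

(** * Lift structures and the awfs of free lift structures *)

(** The object P replaces the interval because an element of P determines its realizer. A stage
    extended by an arbitrary element of P is then again a stage, so a total relation out of P
    contains a plain function on carriers, and a path in Y can be a function [P -> rcarrier Y],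
    hence an entry of a list. For the interval itself it would be a functional relation.

    As the domain of delta_0 is terminal, a lifting problem at one instance prescribes a single
    point of the total space, so adjoining its solution needs one predecessor and no branching. That
    the lift has to start at this point forces the deletion of the paths with p = 0.

    The obstacle is that a relation defined by recursion on raw lists behaves well only on lists
    that exist, and existence is the diagonal of the impredicative equality. Each such relation is
    therefore shown, by induction on that equality, to be on two equal lists the equivalence class
    of one common element. Strictness, extensionality, single-valuedness and totality all follow
    from this. *)

Lemma heq_refl (C : category) (X Y : C) (f : Hom X Y) : f ≈ f.
Proof. reflexivity. Qed.

Lemma heq_sym (C : category) (X Y : C) (f g : Hom X Y) : f ≈ g -> g ≈ f.
Proof. by symmetry. Qed.

Record cylinder (C : category) := Cylinder {
  cyl :> C -> C;
  cylm : forall K K' : C, Hom K K' -> Hom (cyl K) (cyl K');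
  inc : forall K : C, Hom K (cyl K);
  cylm_heq : forall (K K' : C) (h h' : Hom K K'), h ≈ h' -> cylm h ≈ cylm h';
  cylm1 : forall K : C, cylm (idm K) ≈ idm (cyl K);
  cylmM : forall (K K' K'' : C) (h : Hom K' K'') (h' : Hom K K'),
    cylm (h ∘ h') ≈ cylm h ∘ cylm h';
  inc_nat : forall (K K' : C) (h : Hom K K'), cylm h ∘ inc K ≈ inc K' ∘ h }.

Section LiftStructures.
Variables (C : category) (cy : cylinder C).

(* A natural choice of solutions j to the lifting problems (u, v) of the maps
   inc K against f, given by its graph. *)
Record lift_structure (X Y : C) (f : Hom X Y) := LiftStructure {
  lifts : forall K : C, Hom K X -> Hom (cy K) Y -> Hom (cy K) X -> Prop;
  lifts_heq : forall (K : C) (u u' : Hom K X) (v v' : Hom (cy K) Y) (j j' : Hom (cy K) X),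
    u ≈ u' -> v ≈ v' -> j ≈ j' -> lifts u v j -> lifts u' v' j';
  lifts_ex : forall (K : C) (u : Hom K X) (v : Hom (cy K) Y),
    f ∘ u ≈ v ∘ inc cy K -> exists j, lifts u v j;
  lifts_uniq : forall (K : C) (u : Hom K X) (v : Hom (cy K) Y) (j j' : Hom (cy K) X),
    lifts u v j -> lifts u v j' -> j ≈ j';
  lifts_sol : forall (K : C) (u : Hom K X) (v : Hom (cy K) Y) (j : Hom (cy K) X),
    lifts u v j -> j ∘ inc cy K ≈ u /\ f ∘ j ≈ v;
  lifts_nat : forall (K K' : C) (h : Hom K' K) (u : Hom K X) (v : Hom (cy K) Y)
      (j : Hom (cy K) X),
    lifts u v j -> lifts (u ∘ h) (v ∘ cylm cy h) (j ∘ cylm cy h) }.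

Definition lift_morphism (X Y Z W : C) (f : Hom X Y) (g : Hom Z W)
    (sf : lift_structure f) (sg : lift_structure g) (a : Hom X Z) (b : Hom Y W) : Prop :=
  g ∘ a ≈ b ∘ f /\ forall (K : C) (u : Hom K X) (v : Hom (cy K) Y) (j : Hom (cy K) X),
    lifts sf u v j -> lifts sg (a ∘ u) (b ∘ v) (a ∘ j).

Lemma lift_morphism_id (X Y : C) (f : Hom X Y) (s : lift_structure f) :
  lift_morphism s s (idm X) (idm Y).
Proof.
split=> [|K u v j]; first by rewrite compm1 comp1m.
by apply: lifts_heq; rewrite comp1m.
Qed.

Lemma lift_morphism_comp (X Y X' Y' X'' Y'' : C) (f : Hom X Y) (f' : Hom X' Y')
    (f'' : Hom X'' Y'') (s : lift_structure f) (s' : lift_structure f')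
    (s'' : lift_structure f'') a b a' b' :
  lift_morphism s' s'' a' b' -> lift_morphism s s' a b ->
  lift_morphism s s'' (a' ∘ a) (b' ∘ b).
Proof.
move=> [e' h'] [e h]; split=> [|K u v j /h /h'].
  by rewrite compA e' -compA e compA.
by apply: lifts_heq; rewrite compA.
Qed.

Lemma lift_morphism_heq (X Y Z W : C) (f : Hom X Y) (g : Hom Z W)
    (sf : lift_structure f) (sg : lift_structure g) a a' b b' :
  a ≈ a' -> b ≈ b' -> lift_morphism sf sg a b -> lift_morphism sf sg a' b'.
Proof.
move=> ea eb [e h]; split=> [|K u v j /h]; first by rewrite -ea -eb.
by apply: lifts_heq; rewrite ?ea ?eb.
Qed.

Section Composition.
Variables (X Y Z : C) (g : Hom Y Z) (f : Hom X Y).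
Variables (sg : lift_structure g) (sf : lift_structure f).

(** The lift is computed through g first and then through f. The intermediate lift is not recorded,
    since j determines it as f ∘ j. *)
Definition lift_comp : lift_structure (g ∘ f).
Proof.
refine (@LiftStructure X Z (g ∘ f)
  (fun K u v j => lifts sg (f ∘ u) v (f ∘ j) /\ lifts sf u (f ∘ j) j) _ _ _ _ _).
- move=> K u u' v v' j j' eu ev ej [h1 h2]; split.
    by apply: lifts_heq h1; rewrite ?eu ?ej.
  by apply: lifts_heq h2; rewrite ?eu ?ej.
- move=> K u v e; rewrite -compA in e; have [w hw] := lifts_ex sg e.
  have [e1 e2] := lifts_sol hw; have [j hj] := lifts_ex sf (symmetry e1).
  exists j; have [_ e3] := lifts_sol hj; split.
    by apply: lifts_heq hw => //; symmetry.
  by apply: lifts_heq hj => //; symmetry.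
- move=> K u v j j' [h1 h2] [h1' h2']; have e := lifts_uniq h1 h1'.
  by apply: lifts_uniq h2 _; apply: lifts_heq h2' => //; symmetry.
- move=> K u v j [h1 h2]; have [e1 e2] := lifts_sol h1; have [e3 _] := lifts_sol h2.
  by split=> //; rewrite -compA.
- move=> K K' h u v j [h1 h2]; split.
    by apply: lifts_heq (lifts_nat h h1); rewrite ?compA.
  by apply: lifts_heq (lifts_nat h h2); rewrite ?compA.
Defined.
End Composition.

Lemma lift_morphism_vcomp (X Y Z X' Y' Z' : C) (g : Hom Y Z) (f : Hom X Y)
    (g' : Hom Y' Z') (f' : Hom X' Y') (sg : lift_structure g) (sf : lift_structure f)
    (sg' : lift_structure g') (sf' : lift_structure f') a b c :
  lift_morphism sg sg' b c -> lift_morphism sf sf' a b ->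
  lift_morphism (lift_comp sg sf) (lift_comp sg' sf') a c.
Proof.
move=> [e1 h1] [e2 h2]; split=> [|K u v j [/h1 k1 /h2 k2]].
  by rewrite -compA e2 compA e1 compA.
split.
  by apply: lifts_heq k1; rewrite ?compA ?e2.
by apply: lifts_heq k2; rewrite ?compA ?e2.
Qed.

(** Both bracketings have the same lifts, but over composites that agree only up to ≈, so
    associativity becomes a morphism with identity components. *)
Lemma lift_comp_assoc (X Y Z W : C) (h : Hom Z W) (g : Hom Y Z) (f : Hom X Y)
    (sh : lift_structure h) (sg : lift_structure g) (sf : lift_structure f) :
  lift_morphism (lift_comp sh (lift_comp sg sf)) (lift_comp (lift_comp sh sg) sf)
    (idm X) (idm W).
Proof.
split=> [|K u v j [h1 [h2 h3]]]; first by rewrite compm1 comp1m compA.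
by split; [split|]; [apply: lifts_heq h1|apply: lifts_heq h2|apply: lifts_heq h3];
   rewrite ?comp1m ?compA.
Qed.

Lemma lift_comp_projl (X Y Z : C) (g : Hom Y Z) (f : Hom X Y)
    (sg : lift_structure g) (sf : lift_structure f) :
  lift_morphism (lift_comp sg sf) sg f (idm Z).
Proof.
split=> [|K u v j [h _]]; first by rewrite comp1m.
by apply: lifts_heq h; rewrite ?comp1m.
Qed.

(** A lift j of v through the composite is also the lift of f ∘ j for sf, and g ∘ (f ∘ j) ≈ v. This
    serves the right counit law, as [lift_comp_projl] serves the left one. *)
Lemma lift_comp_forget (X Y Z X' : C) (g : Hom Y Z) (f : Hom X Y) (f' : Hom X' Z)
    (sg : lift_structure g) (sf : lift_structure f) (sf' : lift_structure f') a :
  lift_morphism sf sf' a g -> lift_morphism (lift_comp sg sf) sf' a (idm Z).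
Proof.
move=> [e H]; split=> [|K u v j [h1 /H h2]]; first by rewrite comp1m.
have [_ e1] := lifts_sol h1.
by apply: lifts_heq h2; rewrite ?comp1m.
Qed.

(** An object representing the presheaf of lifting problems against f. By Yoneda, one solution of
    the generic problem is the same as a natural choice of solutions. *)
Record universal_problem (X Y : C) (f : Hom X Y) := UniversalProblem {
  upo : C;
  upu : Hom upo X;
  upv : Hom (cy upo) Y;
  upE : f ∘ upu ≈ upv ∘ inc cy upo;
  up_ex : forall (K : C) (u : Hom K X) (v : Hom (cy K) Y),
    f ∘ u ≈ v ∘ inc cy K -> exists n : Hom K upo, upu ∘ n ≈ u /\ upv ∘ cylm cy n ≈ v;
  up_uniq : forall (K : C) (n n' : Hom K upo),
    upu ∘ n ≈ upu ∘ n' -> upv ∘ cylm cy n ≈ upv ∘ cylm cy n' -> n ≈ n' }.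

Section Universal.
Variables (X Y : C) (f : Hom X Y) (U : universal_problem f) (l : Hom (cy (upo U)) X).
Hypotheses (l_inc : l ∘ inc cy (upo U) ≈ upu U) (l_over : f ∘ l ≈ upv U).

Definition lift_of_universal : lift_structure f.
Proof.
refine (@LiftStructure X Y f (fun K u v j => exists n : Hom K (upo U),
  [/\ upu U ∘ n ≈ u, upv U ∘ cylm cy n ≈ v & j ≈ l ∘ cylm cy n]) _ _ _ _ _).
- move=> K u u' v v' j j' eu ev ej [n [e1 e2 e3]].
  by exists n; split; rewrite -?eu -?ev -?ej.
- move=> K u v /(up_ex U)[n [e1 e2]].
  by exists (l ∘ cylm cy n), n.
- move=> K u v j j' [n [e1 e2 e3]] [n' [e1' e2' e3']].
  rewrite e3 e3'; apply: comp_heq => //; apply: cylm_heq.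
  by apply: up_uniq; rewrite ?e1 ?e2; symmetry.
- move=> K u v j [n [e1 e2 e3]]; rewrite e3; split.
    by rewrite -compA inc_nat compA l_inc.
  by rewrite compA l_over.
- move=> K K' h u v j [n [e1 e2 e3]]; exists (n ∘ h).
  by split; rewrite ?cylmM ?compA ?e1 ?e2 ?e3.
Defined.

Lemma lift_of_universal_self : lifts lift_of_universal (upu U) (upv U) l.
Proof.
by exists (idm (upo U)); split; rewrite ?(cylm1 cy) ?compm1.
Qed.

(** Every lift is the reindexing of l along a classifying map, and sg is natural, so only the
    generic lift has to be checked. *)
Lemma lift_morphism_universal (Z W : C) (g : Hom Z W) (sg : lift_structure g)
    (a : Hom X Z) (b : Hom Y W) :
  g ∘ a ≈ b ∘ f ->
  lift_morphism lift_of_universal sg a b <->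
  lifts sg (a ∘ upu U) (b ∘ upv U) (a ∘ l).
Proof.
move=> e; split=> [[_ h]|h]; first exact: h lift_of_universal_self.
split=> // K u v j [n [e1 e2 e3]].
by apply: lifts_heq (lifts_nat n h); rewrite -compA ?e1 ?e2 ?e3.
Qed.
End Universal.

(* f = fl_r \o fl_l where fl_r is free among the maps with a lift structure *)
Record free_lift (X Y : C) (f : Hom X Y) := FreeLift {
  fl_mid : C;
  fl_l : Hom X fl_mid;
  fl_r : Hom fl_mid Y;
  fl_E : fl_r ∘ fl_l ≈ f;
  fl_str : lift_structure fl_r;
  fl_ex : forall (Z W : C) (g : Hom Z W) (sg : lift_structure g) (h : Hom X Z) (k : Hom Y W),
    g ∘ h ≈ k ∘ f -> exists a, lift_morphism fl_str sg a k /\ a ∘ fl_l ≈ h;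
  fl_uniq : forall (Z W : C) (g : Hom Z W) (sg : lift_structure g) (k : Hom Y W) a a',
    lift_morphism fl_str sg a k -> lift_morphism fl_str sg a' k ->
    a ∘ fl_l ≈ a' ∘ fl_l -> a ≈ a' }.

(** * The laws of an awfs from freeness *)

Section FreeAwfs.
Variable free : forall (X Y : C) (f : Hom X Y), free_lift f.

Let E (f : arrow C) : C := fl_mid (free f).
Let L (f : arrow C) : Hom (dom f) (E f) := fl_l (free f).
Let Rr (f : arrow C) : Hom (E f) (cod f) := fl_r (free f).
Let st (f : arrow C) : lift_structure (Rr f) := fl_str (free f).

Lemma free_midmap_comm (f g : arrow C) (s : square f g) :
  Rr g ∘ (L g ∘ top s) ≈ bot s ∘ f.
Proof. by rewrite compA fl_E square_comm. Qed.

Definition free_midmap (f g : arrow C) (s : square f g) : Hom (E f) (E g) :=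
  sval (cid (fl_ex (free f) (st g) (free_midmap_comm s))).

Lemma free_midmapP (f g : arrow C) (s : square f g) :
  lift_morphism (st f) (st g) (free_midmap s) (bot s) /\
  free_midmap s ∘ L f ≈ L g ∘ top s.
Proof. exact: svalP (cid (fl_ex (free f) (st g) (free_midmap_comm s))). Qed.

(** The form of uniqueness behind all the laws below: both sides are morphisms out of a free
    structure, so they are compared along [L f]. The bottom maps need only agree up to ≈. *)
Lemma free_eq (f : arrow C) (Z W : C) (g : Hom Z W) (sg : lift_structure g)
    (k k' : Hom (cod f) W) a a' : k' ≈ k ->
    lift_morphism (st f) sg a k -> lift_morphism (st f) sg a' k' ->
    a ∘ L f ≈ a' ∘ L f -> a ≈ a'.
Proof.
move=> ek h h'; apply: fl_uniq h _.
exact: lift_morphism_heq (heq_refl _) ek h'.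
Qed.

Definition free_factorisation : factorisation C.
Proof.
refine (@Factorisation C E L Rr (fun f => fl_E (free f)) free_midmap _ _ _ _ _).
- move=> f g s t [e1 e2].
  have [h1 h2] := free_midmapP s; have [h1' h2'] := free_midmapP t.
  by apply: free_eq h1 h1' _; rewrite ?h2 ?h2' ?e1 // -e2.
- move=> f; have [h1 h2] := free_midmapP (Square (square_id_comm f)).
  apply: free_eq h1 (lift_morphism_id _) _ => //.
  by rewrite h2 /= compm1 comp1m.
- move=> f g h t s; have [h1 h2] := free_midmapP (Square (square_comp_comm t s)).
  have [h1' h2'] := free_midmapP t; have [h1'' h2''] := free_midmapP s.
  apply: free_eq h1 (lift_morphism_comp h1' h1'') _ => //.
  by rewrite h2 /= compA -h2' -!compA h2''.
- by move=> f g s; have [_ ->] := free_midmapP s.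
- by move=> f g s; have [[e _] _] := free_midmapP s.
Defined.

Let F := free_factorisation.

Lemma free_mult_comm (f : arrow C) : Rr f ∘ idm (E f) ≈ idm (cod f) ∘ Rr f.
Proof. by rewrite compm1 comp1m. Qed.

Definition free_mult (f : arrow C) : Hom (E (Rarr F f)) (E f) :=
  sval (cid (fl_ex (free (Rarr F f)) (st f) (free_mult_comm f))).

Lemma free_multP (f : arrow C) :
  lift_morphism (st (Rarr F f)) (st f) (free_mult f) (idm (cod f)) /\
  free_mult f ∘ L (Rarr F f) ≈ idm (E f).
Proof. exact: svalP (cid (fl_ex (free (Rarr F f)) (st f) (free_mult_comm f))). Qed.

Let st2 (f : arrow C) := lift_comp (st f) (st (Larr F f)).

Lemma free_comult_comm (f : arrow C) :
  (Rr f ∘ Rr (Larr F f)) ∘ L (Larr F f) ≈ idm (cod f) ∘ f.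
Proof. by rewrite -compA fl_E fl_E comp1m. Qed.

(** The map f also factors as [L (Larr F f)] followed by two right maps, whose composite carries the
    composite lift structure; freeness of [Rr f] compares the two factorisations. *)
Definition free_comult (f : arrow C) : Hom (E f) (E (Larr F f)) :=
  sval (cid (fl_ex (free f) (st2 f) (free_comult_comm f))).

Lemma free_comultP (f : arrow C) :
  lift_morphism (st f) (st2 f) (free_comult f) (idm (cod f)) /\
  free_comult f ∘ L f ≈ L (Larr F f).
Proof. exact: svalP (cid (fl_ex (free f) (st2 f) (free_comult_comm f))). Qed.

Definition free_awfs_data : awfs_data C.
Proof.
refine (@AwfsData C F free_comult free_mult _ _).
- by move=> f; rewrite compm1; have [_ ->] := free_comultP f.
- by move=> f; have [[e _] _] := free_multP f.
Defined.

Let W0 := free_awfs_data.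

Lemma free_mult_nat (f g : arrow C) (s : square f g) :
  free_midmap s ∘ free_mult f ≈ free_mult g ∘ free_midmap (fmap (Rfun F) s).
Proof.
have [h1 e1] := free_midmapP s; have [h2 e2] := free_multP f.
have [h3 e3] := free_multP g; have [h4 e4] := free_midmapP (fmap (Rfun F) s).
apply: free_eq (lift_morphism_comp h1 h2) (lift_morphism_comp h3 h4) _.
  by rewrite /= compm1 comp1m.
by rewrite -!compA e2 e4 compA e3 compm1 comp1m.
Qed.

Lemma free_mult_assoc (f : arrow C) :
  free_mult f ∘ free_mult (Rarr F f) ≈ free_mult f ∘ free_midmap (Rmult W0 f).
Proof.
have [h1 e1] := free_multP f; have [h2 e2] := free_multP (Rarr F f).
have [h3 e3] := free_midmapP (Rmult W0 f).
apply: free_eq (lift_morphism_comp h1 h2) (lift_morphism_comp h1 h3) _ => //.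
by rewrite -!compA e2 e3 compm1 compA e1 comp1m.
Qed.

Lemma free_mult_unit (f : arrow C) : free_mult f ∘ free_midmap (Runit F f) ≈ idm (E f).
Proof.
have [h1 e1] := free_multP f; have [h2 e2] := free_midmapP (Runit F f).
apply: free_eq (lift_morphism_comp h1 h2) (lift_morphism_id _) _.
  by rewrite comp1m.
by rewrite -compA e2 compA e1.
Qed.

Lemma free_comult_nat (f g : arrow C) (s : square f g) :
  free_midmap (fmap (Lfun F) s) ∘ free_comult f ≈ free_comult g ∘ free_midmap s.
Proof.
have [h1 e1] := free_midmapP (fmap (Lfun F) s); have [h2 e2] := free_comultP f.
have [h3 e3] := free_comultP g; have [h4 e4] := free_midmapP s.
apply: free_eq (lift_morphism_comp (lift_morphism_vcomp h4 h1) h2)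
   (lift_morphism_comp h3 h4) _.
  by rewrite compm1 comp1m.
by rewrite -!compA e2 e4 e1 compA e3.
Qed.

Lemma free_comult_counitl (f : arrow C) : Rr (Larr F f) ∘ free_comult f ≈ idm (E f).
Proof.
have [h1 e1] := free_comultP f.
apply: free_eq (lift_morphism_comp (lift_comp_projl _ _) h1) (lift_morphism_id _) _.
  by rewrite comp1m.
by rewrite -compA e1 fl_E comp1m.
Qed.

Lemma free_comult_counitr (f : arrow C) :
  free_midmap (Lcounit F f) ∘ free_comult f ≈ idm (E f).
Proof.
have [h1 e1] := free_comultP f; have [h2 e2] := free_midmapP (Lcounit F f).
apply: free_eq (lift_morphism_comp (lift_comp_forget _ h2) h1) (lift_morphism_id _) _.
  by rewrite comp1m.
by rewrite -compA e1 e2 compm1 comp1m.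
Qed.

Lemma free_comult_coassoc (f : arrow C) :
  free_comult (Larr F f) ∘ free_comult f ≈ free_midmap (Lcomult W0 f) ∘ free_comult f.
Proof.
have [h1 e1] := free_comultP f; have [h2 e2] := free_comultP (Larr F f).
have [h3 e3] := free_midmapP (Lcomult W0 f).
have h4 := lift_morphism_comp (lift_morphism_vcomp (lift_morphism_id (st f)) h2) h1.
have h5 := lift_morphism_comp (lift_morphism_vcomp h1 h3) h1.
have h6 := lift_morphism_comp (lift_comp_assoc _ _ _) h4.
(* The associativity morphism in [h6] contributes an identity on top. *)
have -> : free_comult (Larr F f) ∘ free_comult f ≈
    idm _ ∘ (free_comult (Larr F f) ∘ free_comult f) by rewrite comp1m.
apply: free_eq h6 h5 _; first by rewrite !comp1m.
by rewrite comp1m -!compA e1 e2 e3 compm1.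
Qed.

(** This equation is one component of each of the compatibilities of the distributive law with the
    multiplication and the comultiplication. The square s stands for the distributive law, which can
    be formed only once the comonad and monad laws are available. *)
Lemma free_comult_mult (f : arrow C) (s : square (Larr F (Rarr F f)) (Rarr F (Larr F f))) :
  top s ≈ free_comult f -> bot s ≈ free_mult f ->
  free_comult f ∘ free_mult f ≈
  free_mult (Larr F f) ∘ free_midmap s ∘ free_comult (Rarr F f).
Proof.
move=> et eb; have [h1 e1] := free_comultP f; have [h2 e2] := free_multP f.
have [h3 e3] := free_comultP (Rarr F f); have [h4 e4] := free_multP (Larr F f).
have [h5 e5] := free_midmapP s.
have h6 := lift_morphism_heq (heq_refl _) eb h5.
(* The map [free_mult (Larr F f) ∘ free_midmap s] lies over [free_mult f], which lies over the
   identity; the two morphisms are stacked. *)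
have h7 := lift_morphism_vcomp h2 (lift_morphism_heq (heq_refl _) (comp1m _)
  (lift_morphism_comp h4 h6)).
apply: free_eq (lift_morphism_comp h1 h2) (lift_morphism_comp h7 h3) _ => //.
rewrite -!compA e2 e3 compm1 e5 et compA e4 comp1m; reflexivity.
Qed.

Lemma free_comonad : is_comonad (Lcounit W0) (Lcomult W0).
Proof.
split.
- move=> f g s; split=> /=; first by rewrite compm1 comp1m.
  by have [[-> _] _] := free_midmapP s.
- move=> f g s; split=> /=; [by rewrite compm1 comp1m | exact: free_comult_nat].
- by move=> f; split=> /=; [rewrite compm1 | exact: free_comult_counitl].
- by move=> f; split=> /=; [rewrite compm1 | exact: free_comult_counitr].
- move=> f; split=> /=; [reflexivity | exact: free_comult_coassoc].
Qed.

Lemma free_monad : is_monad (Runit W0) (Rmult W0).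
Proof.
split.
- move=> f g s; split=> /=; last by rewrite compm1 comp1m.
  by have [_ ->] := free_midmapP s.
- move=> f g s; split=> /=; [exact: free_mult_nat | by rewrite compm1 comp1m].
- by move=> f; split=> /=; [have [_ ->] := free_multP f | rewrite compm1].
- by move=> f; split=> /=; [exact: free_mult_unit | rewrite compm1].
- move=> f; split=> /=; [exact: free_mult_assoc | reflexivity].
Qed.

Lemma free_distributive : is_distributive_law (Lcounit W0) (Lcomult W0)
    (Runit W0) (Rmult W0) (LRdistr free_comonad free_monad).
Proof.
split.
- move=> f g s; split=> /=; [exact: free_comult_nat | exact: free_mult_nat].
- by move=> f; split=> /=; [have [_ ->] := free_comultP f | exact: free_mult_unit].
- move=> f; split=> /=; first exact: free_comult_counitr.
  by have [[-> _] _] := free_multP f; rewrite comp1m.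
- move=> f; split=> /=; last by rewrite comp1m -free_mult_assoc.
  exact: free_comult_mult.
- move=> f; split=> /=; first by rewrite compm1 free_comult_coassoc.
  exact: free_comult_mult.
Qed.

Definition free_awfs : awfs C := Awfs free_distributive.

Definition has_lifts (X Y : C) (f : Hom X Y) : Prop :=
  forall (K : C) (u : Hom K X) (v : Hom (cy K) Y), f ∘ u ≈ v ∘ inc cy K ->
  exists j : Hom (cy K) X, j ∘ inc cy K ≈ u /\ f ∘ j ≈ v.

(** Freeness extends the identity square of f to the algebra map a. As a is a morphism of lift
    structures, the associativity law compares two extensions of the same map. *)
Lemma lift_structure_right_map (X Y : C) (f : Hom X Y) :
  lift_structure f -> admits_right_map_structure free_awfs f.
Proof.
move=> s; pose ff := Arrow f.
have e : f ∘ idm X ≈ idm Y ∘ f by rewrite compm1 comp1m.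
have [a [h1 e1]] := fl_ex (free f) s e.
have ea : mor ff ∘ a ≈ idm Y ∘ Rr ff by case: h1.
pose sq : square (Rarr F ff) ff := @Square C (Rarr F ff) ff a (idm Y) ea; exists sq; split.
  by split=> /=; rewrite ?comp1m.
split=> /=; last by rewrite comp1m.
have [h2 e2] := free_multP ff; have [h3 e3] := free_midmapP sq.
apply: free_eq (lift_morphism_comp h1 h2) (lift_morphism_comp h1 h3) _ => //.
by rewrite -!compA e2 e3 compm1 /= compA e1 comp1m.
Qed.

(** The unit law makes f a retract of its right part over Y, and lifts are pushed forward along the
    algebra map. *)
Lemma right_map_has_lifts (X Y : C) (f : Hom X Y) :
  admits_right_map_structure free_awfs f -> has_lifts f.
Proof.
move=> [a [[/= e1 e1'] _]] K u v e.
have /= ea := square_comm a; rewrite compm1 in e1'.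
have e' : Rr (Arrow f) ∘ (L (Arrow f) ∘ u) ≈ v ∘ inc cy K by rewrite compA fl_E.
have [j hj] := lifts_ex (st (Arrow f)) e'; have [ej1 ej2] := lifts_sol hj.
exists (top a ∘ j); split; first by rewrite -compA ej1 compA e1 comp1m.
by rewrite compA ea e1' comp1m.
Qed.

Lemma free_right_map (X Y : C) (f : Hom X Y) : universal_problem f ->
  admits_right_map_structure free_awfs f <-> has_lifts f.
Proof.
move=> U; split=> [|h]; first exact: right_map_has_lifts.
have [j [e1 e2]] := h _ _ _ (upE U).
exact: lift_structure_right_map (lift_of_universal e1 e2).
Qed.

End FreeAwfs.
End LiftStructures.

(** * Lifting against a family of maps over the terminal object *)

Section FibredLifting.
Variables (C : category) (one : terminal C) (I : C) (d : Hom (one : C) I) (cy : cylinder C).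
Variables (fst_cy : forall K : C, Hom (cy K) K) (snd_cy : forall K : C, Hom (cy K) I).
Hypothesis fst_inc : forall K : C, fst_cy K ∘ inc cy K ≈ idm K.
Hypothesis snd_inc : forall K : C, snd_cy K ∘ inc cy K ≈ d ∘ bang one K.
Hypothesis pair_cy_ex : forall (K W : C) (a : Hom W K) (b : Hom W I),
  exists w : Hom W (cy K), fst_cy K ∘ w ≈ a /\ snd_cy K ∘ w ≈ b.
Hypothesis pair_cy_uniq : forall (K W : C) (w w' : Hom W (cy K)),
  fst_cy K ∘ w ≈ fst_cy K ∘ w' -> snd_cy K ∘ w ≈ snd_cy K ∘ w' -> w ≈ w'.

Lemma to_one (X : C) (f g : Hom X one) : f ≈ g.
Proof. by rewrite (bang_uniq f) (bang_uniq g). Qed.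

(** The hypotheses make [cy K] a product of K and I, so every reindexing of d over K is isomorphic
    to [inc cy K]. The conditions over the index of f are equalities of maps into the terminal
    object. *)
Lemma fibred_rlpP (X Y : C) (f : Hom X Y) :
  fibred_rlp (family1 one d) (family1 one f) <-> has_lifts cy f.
Proof.
split=> [h K u v e|h K s t m' top bot].
  have em : fst_cy K ∘ inc cy K ≈ idm K by [].
  have ri : @is_reindexing C K one (bang one K) (Family em) (family1 one d)
     (bang one K) (snd_cy K).
    split=> /=.
    - split=> [|W a b _]; first exact: to_one.
      by exists b; split=> [||w' _ <-]; rewrite ?comp1m //; exact: to_one.
    - split=> [|W a b _]; first exact: to_one.
      have [w [e1 e2]] := pair_cy_ex b a; exists w; split=> // w' e1' e2'.
      by apply: pair_cy_uniq; rewrite ?e1 ?e2.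
    - exact: snd_inc.
  have [j [_ e1 e2]] := h _ _ (bang one K) _ _ _ ri u v (to_one _ _) (to_one _ _) e.
  by exists j.
case: m' top bot => D' C' dov cov m em top bot /=.
move=> [[_ /= hD] [_ /= hC] /= hm] u v _ _ e.
(* D' is the pullback of a terminal object, so [dov] is invertible, with inverse w. *)
have [w [_ ew _]] := hD K (bang one K) (idm K) (to_one _ _).
have wK : w ∘ dov ≈ idm D'.
  have [w0 [_ _ uq]] := hD D' top dov (to_one _ _).
  rewrite (uq (idm D')) ?compm1 //; apply: uq; first exact: to_one.
  by rewrite compA ew comp1m.
(* C' and [cy K] are both products of K and I; p and i transport the problem and its solution
   between them. *)
have [p [p1 p2]] := pair_cy_ex cov bot.
have [i [i1 i2 _]] := hC (cy K) (snd_cy K) (fst_cy K) (to_one _ _).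
have iK : i ∘ p ≈ idm C'.
  have [w0 [_ _ uq]] := hC C' bot cov (to_one _ _).
  by rewrite (uq (idm C')) ?compm1 //; apply: uq; rewrite compA ?i1 ?i2.
have pinc : p ∘ m ≈ inc cy K ∘ dov.
  apply: pair_cy_uniq; rewrite !compA ?p1 ?p2 ?em ?fst_inc ?comp1m //.
  by rewrite hm snd_inc -!compA; apply: comp_heq => //; exact: to_one.
have [|j [j1 j2]] := h K (u ∘ w) (v ∘ i).
  have -> : inc cy K ≈ p ∘ m ∘ w by rewrite pinc -compA ew compm1.
  by rewrite compA e -!compA [X in _ ≈ _ ∘ X]compA iK comp1m.
exists (j ∘ p); split; first exact: to_one.
  by rewrite -compA pinc compA j1 -compA wK compm1.
by rewrite compA j2 -compA iK compm1.
Qed.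

End FibredLifting.

(** * Kripke-Joyal semantics of the realizability tripos *)

Section Combinators.
Variable A : pca.

Let k1 (a : A) : A := sval (cid (kc_ex a)).
Let k1P a : app (kc A) a (k1 a) /\ forall b, app (k1 a) b a.
Proof. exact: svalP (cid (kc_ex a)). Qed.

Let s1_ex (a : A) : exists u, app (sc A) a u.
Proof. by have [u [v [h _ _]]] := scP a a; exists u. Qed.
Let s1 (a : A) : A := sval (cid (s1_ex a)).
Let s1P a : app (sc A) a (s1 a). Proof. exact: svalP (cid (s1_ex a)). Qed.

Let s2_ex (a b : A) : exists v, app (s1 a) b v /\
  forall c x y d, app a c x -> app b c y -> app x y d -> app v c d.
Proof.
have [u [v [h h1 h2]]] := scP a b; exists v; split=> //.
by rewrite (app_fun (s1P a) h).
Qed.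
Let s2 (a b : A) : A := sval (cid (s2_ex a b)).
Let s2P a b : app (s1 a) b (s2 a b) /\
  forall c x y d, app a c x -> app b c y -> app x y d -> app (s2 a b) c d.
Proof. exact: svalP (cid (s2_ex a b)). Qed.

Let evals_pair a b : exists i, evals (ti A) i /\ evals (tpair a b) (s2 (s2 i (k1 a)) (k1 b)).
Proof.
have [i [ei _]] := ti_ex A; exists i; split=> //.
exists (s1 (s2 i (k1 a))), (k1 b); split.
- exists (sc A), (s2 i (k1 a)); split=> //.
  exists (s1 i), (k1 a); split; last by case: (s2P i (k1 a)).
    by exists (sc A), i; split; [|exact: ei|exact: s1P].
  by exists (kc A), a; split=> //; case: (k1P a).
- by exists (kc A), b; split=> //; case: (k1P b).
- by case: (s2P (s2 i (k1 a)) (k1 b)).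
Qed.

Let pair_ex (a b : A) : exists c, evals (tpair a b) c.
Proof. by have [c [h _]] := tpair_ex a b; exists c. Qed.

Definition rpair (a b : A) : A := sval (cid (pair_ex a b)).

Lemma rpairP a b : evals (tpair a b) (rpair a b).
Proof. exact: svalP (cid (pair_ex a b)). Qed.

(** The value u exists for every a, even if r is undefined at all pairs with first component a; the
    realizer of an implication must exist also when its premise has none. *)
Lemma curry_ex (A' : subpca A) r : A' r -> exists2 r', A' r' & forall a,
  exists u, app r' a u /\ forall b c, app r (rpair a b) c -> app u b c.
Proof.
move=> hr; have [i [hi ei _]] := ti_in A'.
pose tr (F : A -> A) := exists2 h, A' h & forall a, app h a (F a).
have tr_cst c : A' c -> tr (fun _ => c) by exact: K_ex.
have tr_app F G H : tr F -> tr G -> (forall a, app (F a) (G a) (H a)) -> tr H.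
  move=> [f hf Hf] [g hg Hg] fgh; have [h hh H'] := S_ex hf hg.
  by exists h => // a; exact: H' (Hf a) (Hg a) (fgh a).
have tr_k F : tr F -> tr (fun a => k1 (F a)).
  by move=> hF; apply: tr_app (tr_cst _ (subpca_k A')) hF _ => a; case: (k1P (F a)).
have tr_s1 F : tr F -> tr (fun a => s1 (F a)).
  by move=> hF; apply: tr_app (tr_cst _ (subpca_s A')) hF _ => a; exact: s1P.
have tr_s2 F G : tr F -> tr G -> tr (fun a => s2 (F a) (G a)).
  move=> hF hG; apply: (tr_app (fun a => s1 (F a)) G) => //; first exact: tr_s1.
  by move=> a; case: (s2P (F a) (G a)).
have tr_id : tr id by have [j [hj _ Hj]] := ti_in A'; exists j.
(* Bracket abstraction of b from r applied to [rpair a b]. That pair is s (s i (k a)) (k b), so the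
   function sending b to it is s (k (s (s i (k a)))) k. *)
have [h hh H] : tr (fun a => s2 (k1 r) (s2 (k1 (s1 (s2 i (k1 a)))) (kc A))).
  have t1 := tr_k _ (tr_s1 _ (tr_s2 _ _ (tr_cst i hi) (tr_k _ tr_id))).
  exact (tr_s2 _ _ (tr_k _ (tr_cst r hr)) (tr_s2 _ _ t1 (tr_cst _ (subpca_k A')))).
exists h => // a; exists (s2 (k1 r) (s2 (k1 (s1 (s2 i (k1 a)))) (kc A))); split=> // b c hc.
have [_ h1] := s2P (k1 r) (s2 (k1 (s1 (s2 i (k1 a)))) (kc A)).
apply: h1 hc; first by case: (k1P r).
have [_ h2] := s2P (k1 (s1 (s2 i (k1 a)))) (kc A).
have [i' [ei' e]] := evals_pair a b; have ii' := evals_fun ei ei'; subst i'.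
rewrite (evals_fun (rpairP a b) e).
apply: (h2 _ (s1 (s2 i (k1 a))) (k1 b)).
- by case: (k1P (s1 (s2 i (k1 a)))).
- by case: (k1P b).
- by case: (s2P (s2 i (k1 a)) (k1 b)).
Qed.

End Combinators.

Section Forcing.
Variables (A : pca) (A' : subpca A).

(* Stages of a Kripke-Joyal semantics for the tripos: sets with a chosen realizer
   for every element, that is, the partitioned assemblies. They are projective,
   so existence at a stage is witnessed at the same stage. *)
Record stage := Stage { points :> Type; rz : points -> A }.

Notation "s ⊩ P" := (entails A' (fun j : points s => eq (rz j)) P) (at level 68).

Definition refinement (s' s : stage) (g : s' -> s) : Prop := s' ⊩ (fun j => eq (rz (g j))).

Lemma refines_id (s : stage) : refinement (@id s).
Proof. exact: ent_refl. Qed.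

Lemma forces_res (s s' : stage) (g : s' -> s) (P : s -> A -> Prop) :
  refinement g -> s ⊩ P -> s' ⊩ (fun j => P (g j)).
Proof. by move=> hg hP; apply: ent_trans hg (ent_reindex g hP). Qed.

(** The pairs of an index i and a realizer of P i form the generic stage at which P holds; forcing Q
    there is the entailment itself. *)
Lemma entails_stage (I : Type) (P Q : I -> A -> Prop) :
  (forall (s : stage) (i : s -> I), s ⊩ (fun j => P (i j)) -> s ⊩ (fun j => Q (i j))) ->
  entails A' P Q.
Proof.
move=> h; pose s := @Stage {p : I * A | P p.1 p.2} (fun p => (sval p).2).
have [|r hr H] := h s (fun p => (sval p).1).
  by refine (ent_mono (ent_refl A' (fun j : s => eq (rz j))) _ _) => // -[p hp] a /= <-.
by exists r => // i a ha; exact: (H (exist _ (i, a) ha) a erefl).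
Qed.

(** Existence in the tripos is a union of sets of realizers, so choosing y at each point of the
    stage leaves the realizer unchanged. *)
Lemma forces_ex (s : stage) (Y : Type) (P : s -> Y -> A -> Prop) :
  s ⊩ (fun j a => exists y, P j y a) -> exists y : s -> Y, s ⊩ (fun j => P j (y j)).
Proof.
move=> [r hr H].
have /choice[y hy] j : exists y, exists2 b, app r (rz j) b & P j y b.
  by have [b hb [y hy]] := H j _ erefl; exists y, b.
by exists y, r => // j a <-.
Qed.

Lemma forces_exI (s : stage) (Y : Type) (P : s -> Y -> A -> Prop) (y : s -> Y) :
  s ⊩ (fun j => P j (y j)) -> s ⊩ (fun j a => exists y, P j y a).
Proof. exact: ent_exI. Qed.

Lemma forces_and (s : stage) (P Q : s -> A -> Prop) :
  s ⊩ (fun j => pand (P j) (Q j)) <-> s ⊩ P /\ s ⊩ Q.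
Proof.
split=> [h|[h h']]; last exact: ent_and.
by split; [exact: ent_l h | exact: ent_r h].
Qed.

(* Quantification and implication are combined because forces_allI would fail for
   an unbounded quantifier over an empty Z: entailment requires the realizer to be
   defined at its argument. *)
Definition allimp (Z : Type) (P Q : Z -> A -> Prop) : A -> Prop :=
  fun a => forall z b, P z b -> exists2 c, app a b c & Q z c.

Definition ext_stage (s : stage) (Z : Type) (P : s -> Z -> A -> Prop) : stage :=
  @Stage {p : s * Z * A | P p.1.1 p.1.2 p.2} (fun p => rpair (rz (sval p).1.1) (sval p).2).

Lemma ext_stageP (s : stage) (Z : Type) (P : s -> Z -> A -> Prop) :
  refinement (fun p : ext_stage P => (sval p).1.1) /\
  ext_stage P ⊩ (fun p => eq (sval p).2).
Proof.
suff h : ext_stage P ⊩ (fun p => pand (eq (rz (sval p).1.1)) (eq (sval p).2)).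
  by split; [exact: ent_l h | exact: ent_r h].
apply: ent_mono (ent_refl A' (fun p : ext_stage P => eq (rz p))) _ _ => // p a <-.
by exists (rz (sval p).1.1), (sval p).2; split=> //; exact: rpairP.
Qed.

Lemma ext_stage_forces (s : stage) (Z : Type) (P : s -> Z -> A -> Prop) :
  ext_stage P ⊩ (fun p => P (sval p).1.1 (sval p).1.2).
Proof.
by have [_ h] := ext_stageP P; apply: ent_mono h _ _ => // -[p hp] a /= <-.
Qed.

(** Only the generic refinement [ext_stage P] matters: the realizer found there, curried, realizes
    the implication. *)
Lemma forces_allI (s : stage) (Z : Type) (P Q : s -> Z -> A -> Prop) :
  (forall (s' : stage) (g : s' -> s) (z : s' -> Z), refinement g ->
     s' ⊩ (fun j => P (g j) (z j)) -> s' ⊩ (fun j => Q (g j) (z j))) ->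
  s ⊩ (fun j => allimp (P j) (Q j)).
Proof.
move=> h; have [hg _] := ext_stageP P.
have [r hr H] := h _ _ (fun p : ext_stage P => (sval p).1.2) hg (ext_stage_forces P).
have [r' hr' H'] := curry_ex hr; exists r' => // j a <-.
have [u [ju hu]] := H' (rz j); exists u => // z b hb.
have [c hc qc] := H (exist _ (j, z, b) hb) _ erefl; exists c => //; exact: hu.
Qed.

Lemma forces_allE (s s' : stage) (g : s' -> s) (Z : Type) (P Q : s -> Z -> A -> Prop)
    (z : s' -> Z) :
  s ⊩ (fun j => allimp (P j) (Q j)) -> refinement g ->
  s' ⊩ (fun j => P (g j) (z j)) -> s' ⊩ (fun j => Q (g j) (z j)).
Proof.
move=> h hg [r hr H]; have [t ht H'] := forces_res hg h.
have [u hu Hu] := S_ex ht hr; exists u => // j a <-.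
have [b rb pb] := H j _ erefl; have [c tc ac] := H' j _ erefl.
by have [d cd qd] := ac _ _ pb; exists d => //; exact: Hu tc rb cd.
Qed.

Lemma forces_cst (s : stage) (e : A) : A' e -> s ⊩ (fun _ => eq e).
Proof. by move=> /K_ex[h hh H]; exists h => // j a _; exists e. Qed.

Section MkObj.
Variables (T : Type) (E : T -> T -> A -> Prop).
Hypothesis E_sym : forall (s : stage) (x y : s -> T),
  s ⊩ (fun j => E (x j) (y j)) -> s ⊩ (fun j => E (y j) (x j)).
Hypothesis E_trans : forall (s : stage) (x y z : s -> T),
  s ⊩ (fun j => E (x j) (y j)) -> s ⊩ (fun j => E (y j) (z j)) ->
  s ⊩ (fun j => E (x j) (z j)).

Definition mk_robj : robj A'.
Proof.
refine (@RObj A A' T E _ _).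
- have h : entails A' (fun i : T * T => E i.1 i.2) (fun i => E i.2 i.1).
    by apply: entails_stage => s i; exact: E_sym.
  by apply: ent_mono h _ _ => -[].
- have h : entails A' (fun i : T * T * T => pand (E i.1.1 i.1.2) (E i.1.2 i.2))
     (fun i => E i.1.1 i.2).
    by apply: entails_stage => s i /forces_and[]; exact: E_trans.
  by apply: ent_mono h _ _ => -[[]].
Defined.
End MkObj.

Section MkFunrel.
Variables (X Y : robj A') (F : X -> Y -> A -> Prop).
Hypothesis F_strict : forall (s : stage) (x : s -> X) (y : s -> Y),
  s ⊩ (fun j => F (x j) (y j)) ->
  s ⊩ (fun j => eqv (x j) (x j)) /\ s ⊩ (fun j => eqv (y j) (y j)).
Hypothesis F_ext : forall (s : stage) (x x' : s -> X) (y y' : s -> Y),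
  s ⊩ (fun j => F (x j) (y j)) -> s ⊩ (fun j => eqv (x j) (x' j)) ->
  s ⊩ (fun j => eqv (y j) (y' j)) -> s ⊩ (fun j => F (x' j) (y' j)).
Hypothesis F_single : forall (s : stage) (x : s -> X) (y y' : s -> Y),
  s ⊩ (fun j => F (x j) (y j)) -> s ⊩ (fun j => F (x j) (y' j)) ->
  s ⊩ (fun j => eqv (y j) (y' j)).
Hypothesis F_total : forall (s : stage) (x : s -> X),
  s ⊩ (fun j => eqv (x j) (x j)) -> exists y : s -> Y, s ⊩ (fun j => F (x j) (y j)).

Definition mk_funrel : funrel X Y.
Proof.
refine (@FunRel A A' X Y F _ _ _ _).
- have h : entails A' (fun i : X * Y => F i.1 i.2)
      (fun i => pand (eqv i.1 i.1) (eqv i.2 i.2)).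
    by apply: entails_stage => s i h; apply/forces_and; exact: F_strict.
  by apply: ent_mono h _ _ => -[].
- have h : entails A' (fun i : X * X * Y * Y =>
       pand (F i.1.1.1 i.1.2) (pand (eqv i.1.1.1 i.1.1.2) (eqv i.1.2 i.2)))
      (fun i => F i.1.1.2 i.2).
    apply: entails_stage => s i /forces_and[h /forces_and[]]; exact: F_ext h.
  by apply: ent_mono h _ _ => -[[[]]].
- have h : entails A' (fun i : X * Y * Y => pand (F i.1.1 i.1.2) (F i.1.1 i.2))
      (fun i => eqv i.1.2 i.2).
    by apply: entails_stage => s i /forces_and[]; exact: F_single.
  by apply: ent_mono h _ _ => -[[]].
- by apply: entails_stage => s i /F_total[y hy]; exact: forces_exI hy.
Defined.
End MkFunrel.

Lemma forces_total (X Y : robj A') (F : funrel X Y) (s : stage) (x : s -> X) :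
  s ⊩ (fun j => eqv (x j) (x j)) -> exists y : s -> Y, s ⊩ (fun j => F (x j) (y j)).
Proof. by move=> h; exact: forces_ex (total_rule F h). Qed.

Lemma forces_crel (X Y Z : robj A') (G : funrel Y Z) (F : funrel X Y) (s : stage)
    (x : s -> X) (z : s -> Z) :
  s ⊩ (fun j => crel G F (x j) (z j)) <->
  exists y : s -> Y, s ⊩ (fun j => F (x j) (y j)) /\ s ⊩ (fun j => G (y j) (z j)).
Proof.
split=> [/forces_ex[y /forces_and h]|[y h]]; first by exists y.
by apply: (forces_exI (y := y)); exact/forces_and.
Qed.

(** One inclusion of graphs is enough, as both are total and single-valued. *)
Lemma heq_stage (X Y : RT A') (F G : Hom X Y) :
  (forall (s : stage) (x : s -> rcarrier X) (y : s -> rcarrier Y),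
    s ⊩ (fun j => rel F (x j) (y j)) -> s ⊩ (fun j => rel G (x j) (y j))) -> F ≈ G.
Proof. by move=> h; apply: funrel_eqI; apply: entails_stage => s i; exact: h. Qed.

Lemma heq_forces (X Y : RT A') (F G : Hom X Y) (s : stage) (x : s -> rcarrier X)
    (y : s -> rcarrier Y) :
  F ≈ G -> s ⊩ (fun j => rel F (x j) (y j)) -> s ⊩ (fun j => rel G (x j) (y j)).
Proof. by move=> e; exact: (@funrel_eq_rule A A' X Y F G e). Qed.

End Forcing.

(** * The universal lifting problem *)

Section Paths.
Variables (A : pca) (A' : subpca A).
Notation "s ⊩ P" := (entails A' (fun j : points s => eq (rz j)) P) (at level 68).
Notation feq s x y := (s ⊩ (fun j => eqv (x j) (y j))).
Notation frel s F x y := (s ⊩ (fun j => rel F (x j) (y j))).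
Notation stage := (stage A).
Notation refines := (refinement A').

Lemma forces_comp (X Y Z : RT A') (G : Hom Y Z) (F : Hom X Y) (s : stage)
    (x : s -> rcarrier X) (z : s -> rcarrier Z) :
  frel s (G ∘ F) x z <-> exists y : s -> rcarrier Y, frel s F x y /\ frel s G y z.
Proof. exact: forces_crel. Qed.

(* An object whose elements have a canonical realizer, with a point *)
Variables (P : robj A') (p0 : P) (norm : P -> A).
Hypothesis normP : forall (s : stage) (p : s -> P),
  feq s p p <-> s ⊩ (fun j => eq (norm (p j))).
Hypothesis p0P : forall s : stage, feq s (fun=> p0) (fun=> p0).

(** Choice over P. With the canonical realizer of p as second component, all pairs (j, p) form a
    stage; a witness at that stage is a function of j and p, and any other point of P is reached by
    restriction along (h, p). *)
Lemma path_ex (s : stage) (Y : Type) (Q : s -> P -> Y -> A -> Prop) :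
  (forall (s' : stage) (h : s' -> s) (p : s' -> P), refines h -> feq s' p p ->
     exists y : s' -> Y, s' ⊩ (fun j => Q (h j) (p j) (y j))) ->
  exists y : s -> P -> Y, forall (s' : stage) (h : s' -> s) (p : s' -> P),
    refines h -> feq s' p p -> s' ⊩ (fun j => Q (h j) (p j) (y (h j) (p j))).
Proof.
move=> H; pose s1 := @Stage A (s * P) (fun q => rpair (rz q.1) (norm q.2)).
have [h1 h2] : refines (fun q : s1 => q.1) /\ s1 ⊩ (fun q => eq (norm q.2)).
  apply/forces_and.
  refine (ent_mono (ent_refl A' (fun q : s1 => eq (rz q))) _ _) => // q a <-.
  by exists (rz q.1), (norm q.2); split=> //; exact: rpairP.
have [y hy] := H s1 (fun q => q.1) (fun q => q.2) h1 (proj2 (normP _) h2).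
exists (fun j p => y (j, p)) => s' h p hh hp.
have hg : @refinement A A' s' s1 (fun j => (h j, p j)).
  refine (ent_mono (ent_and hh (proj1 (normP _) hp)) _ _) => //= j a [b [c [<- <- e]]].
  exact: evals_fun (rpairP _ _) e.
exact: (forces_res hg hy).
Qed.

(** * The product with the object P *)

Section Cyl.
Variable K : RT A'.

Definition cyl_eqv (x y : rcarrier K * P) : A -> Prop :=
  pand (eqv x.1 y.1) (eqv x.2 y.2).

Lemma cyl_sym (s : stage) (x y : s -> rcarrier K * P) :
  s ⊩ (fun j => cyl_eqv (x j) (y j)) ->
  s ⊩ (fun j => cyl_eqv (y j) (x j)).
Proof. by move=> /forces_and[h h']; apply/forces_and; split; exact: sym_rule. Qed.

Lemma cyl_trans (s : stage) (x y z : s -> rcarrier K * P) :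
  s ⊩ (fun j => cyl_eqv (x j) (y j)) ->
  s ⊩ (fun j => cyl_eqv (y j) (z j)) ->
  s ⊩ (fun j => cyl_eqv (x j) (z j)).
Proof.
move=> /forces_and[h1 h2] /forces_and[h3 h4]; apply/forces_and.
by split; [exact: trans_rule h1 h3 | exact: trans_rule h2 h4].
Qed.

Definition cyl_obj : RT A' := @mk_robj _ _ _ cyl_eqv cyl_sym cyl_trans.

Lemma forces_cyl (s : stage) (x y : s -> rcarrier cyl_obj) :
  feq s x y <-> s ⊩ (fun j => eqv (x j).1 (y j).1) /\ s ⊩ (fun j => eqv (x j).2 (y j).2).
Proof. exact: forces_and. Qed.

Definition cyl_inc : Hom K cyl_obj.
Proof.
refine (@mk_funrel A A' K cyl_obj
  (fun k x => pand (eqv k x.1) (eqv p0 x.2)) _ _ _ _).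
- move=> s k x /forces_and[h1 h2]; split; first exact: refl_rule h1.
  by apply/forces_cyl; split; [exact: refl_rule (sym_rule h1) | exact: refl_rule (sym_rule h2)].
- move=> s k k' x x' /forces_and[h1 h2] h3 /forces_cyl[h4 h5]; apply/forces_and.
  by split; [exact: trans_rule (sym_rule h3) (trans_rule h1 h4) | exact: trans_rule h2 h5].
- move=> s k x x' /forces_and[h1 h2] /forces_and[h3 h4]; apply/forces_cyl; split.
    exact: trans_rule (sym_rule h1) h3.
  exact: trans_rule (sym_rule h2) h4.
- by move=> s k hk; exists (fun j => (k j, p0)); apply/forces_and.
Defined.

Lemma forces_inc (s : stage) (k : s -> rcarrier K) (x : s -> rcarrier cyl_obj) :
  frel s cyl_inc k x <-> s ⊩ (fun j => eqv (k j) (x j).1) /\ s ⊩ (fun j => eqv p0 (x j).2).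
Proof. exact: forces_and. Qed.

Definition cyl_fst : Hom cyl_obj K.
Proof.
refine (@mk_funrel A A' cyl_obj K
  (fun x k => pand (eqv x.1 k) (eqv x.2 x.2)) _ _ _ _).
- move=> s x k /forces_and[h1 h2]; split; last exact: refl_rule (sym_rule h1).
  by apply/forces_cyl; split=> //; exact: refl_rule h1.
- move=> s x x' k k' /forces_and[h1 h2] /forces_cyl[h3 h4] h5; apply/forces_and; split.
    exact: trans_rule (sym_rule h3) (trans_rule h1 h5).
  exact: refl_rule (sym_rule h4).
- move=> s x k k' /forces_and[h1 _] /forces_and[h2 _].
  exact: trans_rule (sym_rule h1) h2.
- by move=> s x /forces_cyl[h1 h2]; exists (fun j => (x j).1); apply/forces_and.
Defined.

Definition cyl_snd : Hom cyl_obj (P : RT A').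
Proof.
refine (@mk_funrel A A' cyl_obj P
  (fun x p => pand (eqv x.2 p) (eqv x.1 x.1)) _ _ _ _).
- move=> s x k /forces_and[h1 h2]; split; last exact: refl_rule (sym_rule h1).
  by apply/forces_cyl; split=> //; exact: refl_rule h1.
- move=> s x x' k k' /forces_and[h1 h2] /forces_cyl[h3 h4] h5; apply/forces_and; split.
    exact: trans_rule (sym_rule h4) (trans_rule h1 h5).
  exact: refl_rule (sym_rule h3).
- move=> s x k k' /forces_and[h1 _] /forces_and[h2 _].
  exact: trans_rule (sym_rule h1) h2.
- by move=> s x /forces_cyl[h1 h2]; exists (fun j => (x j).2); apply/forces_and.
Defined.

Lemma forces_fst (s : stage) (x : s -> rcarrier cyl_obj) (k : s -> rcarrier K) :
  frel s cyl_fst x k <-> s ⊩ (fun j => eqv (x j).1 (k j)) /\ s ⊩ (fun j => eqv (x j).2 (x j).2).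
Proof. exact: forces_and. Qed.

Lemma forces_snd (s : stage) (x : s -> rcarrier cyl_obj) (p : s -> P) :
  frel s cyl_snd x p <-> s ⊩ (fun j => eqv (x j).2 (p j)) /\ s ⊩ (fun j => eqv (x j).1 (x j).1).
Proof. exact: forces_and. Qed.

End Cyl.

Definition cyl_map (K K' : RT A') (h : Hom K K') : Hom (cyl_obj K) (cyl_obj K').
Proof.
refine (@mk_funrel A A' (cyl_obj K) (cyl_obj K')
  (fun x y => pand (rel h x.1 y.1) (eqv x.2 y.2)) _ _ _ _).
- move=> s x y /forces_and[h1 h2]; split; apply/forces_cyl; split.
  + exact: strictl_rule h1.
  + exact: refl_rule h2.
  + exact: strictr_rule h1.
  + exact: refl_rule (sym_rule h2).
- move=> s x x' y y' /forces_and[h1 h2] /forces_cyl[h3 h4] /forces_cyl[h5 h6].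
  apply/forces_and; split; first exact: ext_rule h1 h3 h5.
  exact: trans_rule (sym_rule h4) (trans_rule h2 h6).
- move=> s x y y' /forces_and[h1 h2] /forces_and[h3 h4]; apply/forces_cyl; split.
    exact: single_rule h1 h3.
  exact: trans_rule (sym_rule h2) h4.
- move=> s x /forces_cyl[h1 h2]; have [k hk] := forces_total h h1.
  by exists (fun j => (k j, (x j).2)); apply/forces_and.
Defined.

Lemma forces_cyl_map (K K' : RT A') (h : Hom K K') (s : stage)
    (x : s -> rcarrier (cyl_obj K)) (y : s -> rcarrier (cyl_obj K')) :
  frel s (cyl_map h) x y <->
  s ⊩ (fun j => rel h (x j).1 (y j).1) /\ s ⊩ (fun j => eqv (x j).2 (y j).2).
Proof. exact: forces_and. Qed.

Definition path_cylinder : cylinder (RT A').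
Proof.
refine (@Cylinder (RT A') cyl_obj cyl_map cyl_inc _ _ _ _).
- move=> K K' h h' e; apply: heq_stage => s x y /forces_cyl_map[h1 h2].
  by apply/forces_cyl_map; split=> //; exact: heq_forces e h1.
- by move=> K; apply: heq_stage => s x y /forces_cyl_map h; apply/forces_cyl.
- move=> K K' K'' h h'; apply: heq_stage => s x y /forces_cyl_map[/forces_comp[k [h1 h2]] h3].
  apply/forces_comp; exists (fun j => (k j, (y j).2)).
  by split; apply/forces_cyl_map; split=> //; exact: refl_rule (sym_rule h3).
- move=> K K' h; apply: heq_stage => s x y /forces_comp[z [/forces_inc[h1 h2] /forces_cyl_map[h3 h4]]].
  apply/forces_comp; exists (fun j => (y j).1); split.
    exact: ext_rule h3 (sym_rule h1) (strictr_rule h3).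
  apply/forces_inc; split; first exact: strictr_rule h3.
  exact: trans_rule h2 h4.
Defined.

Definition pathof (W : Type) (Q : P -> W -> A -> Prop) (y : P -> W) : A -> Prop :=
  allimp (fun p => eqv p p) (fun p => Q p (y p)).

Lemma forces_pathof (W : Type) (s : stage) (Q : s -> P -> W -> A -> Prop) (y : s -> P -> W) :
  s ⊩ (fun j => pathof (Q j) (y j)) <->
  forall (s' : stage) (h : s' -> s) (p : s' -> P), refines h -> feq s' p p ->
     s' ⊩ (fun j => Q (h j) (p j) (y (h j) (p j))).
Proof.
split=> [H s' h p hh hp|H]; last exact: forces_allI.
exact: (forces_allE (P := fun j p => eqv p p) (Q := fun j p => Q j p (y j p)) H hh hp).
Qed.

Lemma forces_pathof_ex (W : Type) (s : stage) (Q : s -> P -> W -> A -> Prop) :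
  (forall (s' : stage) (h : s' -> s) (p : s' -> P), refines h -> feq s' p p ->
     exists y : s' -> W, s' ⊩ (fun j => Q (h j) (p j) (y j))) ->
  exists y : s -> P -> W, s ⊩ (fun j => pathof (Q j) (y j)).
Proof. by move=> /path_ex[y hy]; exists y; exact/forces_pathof. Qed.

(** Equality of the exponential of W by P. Because it ranges over pairs of equal times,
    [path_eq y y] says that y respects the equality of P. *)
Definition path_eq (W : RT A') (y y' : P -> rcarrier W) : A -> Prop :=
  allimp (fun q : P * P => eqv q.1 q.2) (fun q => eqv (y q.1) (y' q.2)).

Lemma forces_path_eq (W : RT A') (s : stage) (y y' : s -> P -> rcarrier W) :
  s ⊩ (fun j => path_eq (y j) (y' j)) <->
  forall (s' : stage) (h : s' -> s) (p p' : s' -> P), refines h -> feq s' p p' ->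
    s' ⊩ (fun j => eqv (y (h j) (p j)) (y' (h j) (p' j))).
Proof.
split=> [H s' h p p' hh hp|H].
  exact: (forces_allE (P := fun j (q : P * P) => eqv q.1 q.2)
    (Q := fun j q => eqv (y j q.1) (y' j q.2)) (z := fun j => (p j, p' j)) H hh hp).
by apply: forces_allI => s' h z hh hz; exact: (H s' h (fun j => (z j).1) (fun j => (z j).2)).
Qed.

Lemma path_eq_sym (W : RT A') (s : stage) (y y' : s -> P -> rcarrier W) :
  s ⊩ (fun j => path_eq (y j) (y' j)) -> s ⊩ (fun j => path_eq (y' j) (y j)).
Proof.
move/forces_path_eq=> H; apply/forces_path_eq => s' h p p' hh hp.
exact: sym_rule (H _ _ _ _ hh (sym_rule hp)).
Qed.

Lemma path_eq_trans (W : RT A') (s : stage) (y y' y'' : s -> P -> rcarrier W) :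
  s ⊩ (fun j => path_eq (y j) (y' j)) -> s ⊩ (fun j => path_eq (y' j) (y'' j)) ->
  s ⊩ (fun j => path_eq (y j) (y'' j)).
Proof.
move=> /forces_path_eq H /forces_path_eq H'; apply/forces_path_eq => s' h p p' hh hp.
exact: trans_rule (H _ _ _ _ hh hp) (H' _ _ _ _ hh (refl_rule (sym_rule hp))).
Qed.

Lemma path_eq_at (W : RT A') (s : stage) (y y' : s -> P -> rcarrier W) (p p' : s -> P) :
  s ⊩ (fun j => path_eq (y j) (y' j)) -> feq s p p' ->
  s ⊩ (fun j => eqv (y j (p j)) (y' j (p' j))).
Proof. move/forces_path_eq => H hp; exact: (H s id p p' (refines_id _ _) hp). Qed.

Lemma pathof_at (W : Type) (s : stage) (Q : s -> P -> W -> A -> Prop) (y : s -> P -> W)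
    (p : s -> P) :
  s ⊩ (fun j => pathof (Q j) (y j)) -> feq s p p -> s ⊩ (fun j => Q j (p j) (y j (p j))).
Proof. move/forces_pathof => H hp; exact: (H s id p (refines_id _ _) hp). Qed.

Section Problems.
Variables (Z W : RT A') (g : Hom Z W).

(** The pullback of g along evaluation at p0 from the exponential of W by P; the last conjunct
    builds the compatibility at p0 into existence. *)
Definition prob_eqv (x x' : rcarrier Z * (P -> rcarrier W)) : A -> Prop :=
  pand (eqv x.1 x'.1) (pand (path_eq x.2 x'.2) (rel g x.1 (x.2 p0))).

Lemma forces_prob_eqv (s : stage) (x x' : s -> rcarrier Z * (P -> rcarrier W)) :
  s ⊩ (fun j => prob_eqv (x j) (x' j)) <->
  [/\ s ⊩ (fun j => eqv (x j).1 (x' j).1), s ⊩ (fun j => path_eq (x j).2 (x' j).2) &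
      s ⊩ (fun j => rel g (x j).1 ((x j).2 p0))].
Proof.
split=> [/forces_and[h1 /forces_and[h2 h3]]|[h1 h2 h3]] //.
by apply/forces_and; split=> //; exact/forces_and.
Qed.

Lemma prob_sym (s : stage) (x x' : s -> rcarrier Z * (P -> rcarrier W)) :
  s ⊩ (fun j => prob_eqv (x j) (x' j)) -> s ⊩ (fun j => prob_eqv (x' j) (x j)).
Proof.
move=> /forces_prob_eqv[h1 h2 h3]; apply/forces_prob_eqv; split.
- exact: sym_rule.
- exact: path_eq_sym.
- exact: ext_rule h3 h1 (path_eq_at h2 (p0P s)).
Qed.

Lemma prob_trans (s : stage) (x x' x'' : s -> rcarrier Z * (P -> rcarrier W)) :
  s ⊩ (fun j => prob_eqv (x j) (x' j)) -> s ⊩ (fun j => prob_eqv (x' j) (x'' j)) ->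
  s ⊩ (fun j => prob_eqv (x j) (x'' j)).
Proof.
move=> /forces_prob_eqv[h1 h2 h3] /forces_prob_eqv[h4 h5 h6]; apply/forces_prob_eqv; split=> //.
- exact: trans_rule h1 h4.
- exact: path_eq_trans h2 h5.
Qed.

Definition prob_obj : RT A' := @mk_robj _ _ _ prob_eqv prob_sym prob_trans.

Lemma forces_prob (s : stage) (x x' : s -> rcarrier prob_obj) :
  feq s x x' <->
  [/\ s ⊩ (fun j => eqv (x j).1 (x' j).1), s ⊩ (fun j => path_eq (x j).2 (x' j).2) &
      s ⊩ (fun j => rel g (x j).1 ((x j).2 p0))].
Proof. exact: forces_prob_eqv. Qed.

Definition prob_start : Hom prob_obj Z.
Proof.
refine (@mk_funrel A A' prob_obj Z
  (fun x z => pand (prob_eqv x x) (eqv x.1 z)) _ _ _ _).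
- by move=> s x z /forces_and[h1 h2]; split=> //; exact: refl_rule (sym_rule h2).
- move=> s x x' z z' /forces_and[h1 h2] h3 h4; apply/forces_and; split.
    exact: prob_trans (prob_sym h3) h3.
  by have /forces_prob[h5 _ _] := h3; exact: trans_rule (sym_rule h5) (trans_rule h2 h4).
- move=> s x z z' /forces_and[_ h1] /forces_and[_ h2]; exact: trans_rule (sym_rule h1) h2.
- move=> s x hx; exists (fun j => (x j).1); apply/forces_and; split=> //.
  by have /forces_prob[] := hx.
Defined.

Lemma forces_start (s : stage) (x : s -> rcarrier prob_obj) (z : s -> rcarrier Z) :
  frel s prob_start x z <-> feq s x x /\ s ⊩ (fun j => eqv (x j).1 (z j)).
Proof. exact: forces_and. Qed.

Definition prob_path : Hom (path_cylinder prob_obj) W.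
Proof.
refine (@mk_funrel A A' (path_cylinder prob_obj) W
  (fun x w => pand (eqv x x) (eqv (x.1.2 x.2) w)) _ _ _ _).
- by move=> s x w /forces_and[h1 h2]; split=> //; exact: refl_rule (sym_rule h2).
- move=> s x x' w w' /forces_and[h1 h2] h3 h4; apply/forces_and; split.
    exact: refl_rule (sym_rule h3).
  have /forces_cyl[/forces_prob[_ h5 _] h6] := h3.
  exact: trans_rule (sym_rule (path_eq_at h5 h6)) (trans_rule h2 h4).
- move=> s x z z' /forces_and[_ h1] /forces_and[_ h2]; exact: trans_rule (sym_rule h1) h2.
- move=> s x hx; exists (fun j => (x j).1.2 (x j).2); apply/forces_and; split=> //.
  have /forces_cyl[/forces_prob[_ h5 _] h6] := hx; exact: path_eq_at h5 h6.
Defined.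

Lemma forces_path (s : stage) (x : s -> rcarrier (path_cylinder prob_obj)) (w : s -> rcarrier W) :
  frel s prob_path x w <->
  feq s x x /\ s ⊩ (fun j => eqv ((x j).1.2 (x j).2) (w j)).
Proof. exact: forces_and. Qed.

Lemma probE : g ∘ prob_start ≈ prob_path ∘ inc path_cylinder prob_obj.
Proof.
apply: heq_stage => s x w /forces_comp[z [/forces_start[h1 h2] h3]].
apply/forces_comp; exists (fun j => (x j, p0)).
have h4 : feq s (fun j => (x j, p0) : rcarrier (path_cylinder prob_obj)) (fun j => (x j, p0)).
  by apply/forces_cyl; split=> //; exact: p0P.
split; first by apply/forces_inc; split=> //; exact: p0P.
apply/forces_path; split=> //=.
have /forces_prob[_ _ h5] := h1.
exact: single_rule h5 (ext_rule h3 (sym_rule h2) (strictr_rule h3)).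
Qed.

Section Classify.
Variables (K : RT A') (u : Hom K Z) (v : Hom (path_cylinder K) W).
Hypothesis uv : g ∘ u ≈ v ∘ inc path_cylinder K.

Definition classify_rel (k : rcarrier K) (x : rcarrier prob_obj) : A -> Prop :=
  pand (rel u k x.1) (pathof (fun p => rel v (k, p)) x.2).

Lemma forces_classify (s : stage) (k : s -> rcarrier K) (x : s -> rcarrier prob_obj) :
  s ⊩ (fun j => classify_rel (k j) (x j)) <->
  s ⊩ (fun j => rel u (k j) (x j).1) /\
  forall (s' : stage) (h : s' -> s) (p : s' -> P), refines h -> feq s' p p ->
    s' ⊩ (fun j => rel v (k (h j), p j) ((x (h j)).2 (p j))).
Proof.
split=> [/forces_and[h1 /forces_pathof h2]|[h1 h2]] //.
by apply/forces_and; split=> //; exact/forces_pathof.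
Qed.

Lemma classify_single (s : stage) (k : s -> rcarrier K) (x x' : s -> rcarrier prob_obj) :
  s ⊩ (fun j => classify_rel (k j) (x j)) -> s ⊩ (fun j => classify_rel (k j) (x' j)) ->
  feq s x x'.
Proof.
move=> /forces_classify[h1 h2] /forces_classify[h3 h4]; apply/forces_prob; split.
- exact: single_rule h1 h3.
- apply/forces_path_eq => s' h p p' hh hp.
  have h5 := h2 _ _ _ hh (refl_rule hp).
  have h6 := h4 _ _ _ hh (refl_rule (sym_rule hp)).
  apply: single_rule _ h6; apply: ext_rule h5 _ (strictr_rule h5).
  apply/forces_cyl; split=> //=; exact: forces_res hh (strictl_rule h1).
(* The square [uv], read at (k, p0), ties the start of the path to the image under g of the
   point. *)
- have h5 := h2 _ _ _ (refines_id _ _) (p0P s).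
  have h6 : frel s (v ∘ inc path_cylinder K) k (fun j => (x j).2 p0).
    apply/forces_comp; exists (fun j => (k j, p0)); split=> //.
    by apply/forces_inc; split; [exact: strictl_rule h1 | exact: p0P].
  have /forces_comp[z [h7 h8]] := heq_forces (heq_sym uv) h6.
  exact: ext_rule h8 (single_rule h7 h1) (strictr_rule h8).
Qed.

Definition classify : Hom K prob_obj.
Proof.
refine (@mk_funrel A A' K prob_obj classify_rel _ _ classify_single _).
- move=> s k x h; split; last exact: (classify_single h h).
  by have /forces_classify[h1 _] := h; exact: strictl_rule h1.
- move=> s k k' x x' /forces_classify[h1 h2] h3 /forces_prob[h4 h5 _].
  apply/forces_classify; split; first exact: ext_rule h1 h3 h4.
  move=> s' h p hh hp; apply: ext_rule (h2 _ _ _ hh hp) _ _.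
    apply/forces_cyl; split=> //=; exact: forces_res hh h3.
  by have /forces_path_eq h6 := h5; exact: h6.
- move=> s k hk; have [z hz] := forces_total u hk.
  have [|y hy] := @forces_pathof_ex _ s (fun j p => rel v (k j, p)).
    move=> s' h p hh hp; apply: (forces_total v (x := fun j => (k (h j), p j))).
    apply/forces_cyl; split=> //=; exact: forces_res hh hk.
  by exists (fun j => (z j, y j)); apply/forces_and.
Defined.

Lemma classify_start : prob_start ∘ classify ≈ u.
Proof.
apply: heq_stage => s k z /forces_comp[x [/forces_classify[h1 _] /forces_start[_ h2]]].
exact: ext_rule h1 (strictl_rule h1) h2.
Qed.

Lemma classify_path : prob_path ∘ cylm path_cylinder classify ≈ v.
Proof.
apply: heq_stage => s k z /forces_comp[x [/forces_cyl_map[h1 h2] /forces_path[_ h3]]].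
have /forces_classify[h4 h5] := h1.
have h6 := h5 _ _ _ (refines_id _ _) (refl_rule (sym_rule h2)).
apply: ext_rule h6 _ h3; apply/forces_cyl; split=> /=; first exact: strictl_rule h1.
exact: sym_rule h2.
Qed.

End Classify.

(** Any n satisfies the relation that defines the classifying map of its own problem, which reduces
    uniqueness to [classify_single]. *)
Lemma prob_rel (K : RT A') (n : Hom K prob_obj) (s : stage) (k : s -> rcarrier K)
    (x : s -> rcarrier prob_obj) : frel s n k x ->
  s ⊩ (fun j => rel (prob_start ∘ n) (k j) (x j).1) /\
  forall (s' : stage) (h : s' -> s) (p : s' -> P), refines h -> feq s' p p ->
    s' ⊩ (fun j => rel (prob_path ∘ cylm path_cylinder n) (k (h j), p j) ((x (h j)).2 (p j))).
Proof.
move=> hx; have hxx := strictr_rule hx; have /forces_prob[h1 h2 h3] := hxx; split.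
  by apply/forces_comp; exists x; split=> //; apply/forces_start.
move=> s' h p hh hp; apply/forces_comp; exists (fun j => (x (h j), p j)); split.
  by apply/forces_cyl_map; split=> //=; exact: forces_res hh hx.
apply/forces_path; split; first by apply/forces_cyl; split=> //=; exact: forces_res hh hxx.
by have /forces_path_eq h4 := h2; exact: h4.
Qed.

Definition path_problem : universal_problem path_cylinder g.
Proof.
refine (@UniversalProblem (RT A') path_cylinder Z W g prob_obj prob_start prob_path probE _ _).
- move=> K u v uv; exists (classify uv); split; [exact: classify_start | exact: classify_path].
- move=> K n n' e1 e2; apply: heq_stage => s k x h.
  have [x' h'] := forces_total n' (strictl_rule h).
  apply: (ext_rule h' (strictl_rule h)).
  have [h1 h2] := prob_rel h; have [h3 h4] := prob_rel h'.
  have uv : g ∘ (prob_start ∘ n') ≈ (prob_path ∘ cylm path_cylinder n') ∘ inc path_cylinder K.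
    by rewrite compA probE -!compA inc_nat.
  apply: (classify_single uv (k := k)); apply/forces_classify; split=> //.
    exact: heq_forces e1 h1.
  move=> s' i p hi hp; exact: heq_forces e2 (h2 _ _ _ hi hp).
Defined.

End Problems.

(** The form in which relations defined by recursion on raw data are proved functional: such a Q
    describes one element of Z, and two descriptions are compared through a common z. *)
Definition is_class (Z : RT A') (Q : rcarrier Z -> A -> Prop) (z : rcarrier Z) : A -> Prop :=
  pand (eqv z z) (pand (allimp Q (eqv z)) (allimp (eqv z) Q)).

Lemma forces_class (Z : RT A') (s : stage) (Q : s -> rcarrier Z -> A -> Prop)
    (z : s -> rcarrier Z) :
  s ⊩ (fun j => is_class (Q j) (z j)) <->
  feq s z z /\ forall (s' : stage) (h : s' -> s) (z' : s' -> rcarrier Z), refines h ->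
    s' ⊩ (fun j => Q (h j) (z' j)) <-> s' ⊩ (fun j => eqv (z (h j)) (z' j)).
Proof.
split=> [/forces_and[h1 /forces_and[h2 h3]]|[h1 h2]].
  split=> // s' h z' hh; split=> h4.
    exact: (forces_allE (P := Q) (Q := fun j => eqv (z j)) h2 hh h4).
  exact: (forces_allE (Q := Q) (P := fun j => eqv (z j)) h3 hh h4).
apply/forces_and; split=> //; apply/forces_and.
by split; apply: forces_allI => s' h z' hh /(h2 _ _ _ hh).
Qed.

Section Classes.
Variables (Z : RT A') (s : stage).
Implicit Types (Q : s -> rcarrier Z -> A -> Prop) (z : s -> rcarrier Z).

Lemma class_refl Q z : s ⊩ (fun j => is_class (Q j) (z j)) -> feq s z z.
Proof. by move/forces_class => []. Qed.

Lemma class_mem Q z z' : s ⊩ (fun j => is_class (Q j) (z j)) -> feq s z z' ->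
  s ⊩ (fun j => Q j (z' j)).
Proof. by move=> /forces_class[_ H]; exact: (proj2 (H s id z' (refines_id _ _))). Qed.

Lemma class_eq Q z z' : s ⊩ (fun j => is_class (Q j) (z j)) ->
  s ⊩ (fun j => Q j (z' j)) -> feq s z z'.
Proof. by move=> /forces_class[_ H]; exact: (proj1 (H s id z' (refines_id _ _))). Qed.

Lemma class_ext Q z z' : s ⊩ (fun j => is_class (Q j) (z j)) -> feq s z z' ->
  s ⊩ (fun j => is_class (Q j) (z' j)).
Proof.
move=> /forces_class[_ H] h; apply/forces_class; split; first exact: refl_rule (sym_rule h).
move=> s' i z'' hi; have h' := forces_res hi h; split=> [/(H _ _ _ hi)|] h''.
  exact: trans_rule (sym_rule h') h''.
by apply/(H _ _ _ hi); exact: trans_rule h' h''.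
Qed.

Lemma class_eqv z z' : feq s z z' -> s ⊩ (fun j => is_class (eqv (z j)) (z' j)).
Proof.
move=> h; apply/forces_class; split; first exact: refl_rule (sym_rule h).
move=> s' i z'' hi; have h' := forces_res hi h; split=> h''.
  exact: trans_rule (sym_rule h') h''.
exact: trans_rule h' h''.
Qed.

Lemma class_funrel (X : RT A') (F : Hom X Z) (x : s -> rcarrier X) z :
  frel s F x z -> s ⊩ (fun j => is_class (rel F (x j)) (z j)).
Proof.
move=> h; apply/forces_class; split; first exact: strictr_rule h.
move=> s' i z'' hi; have h' := forces_res hi h; split=> h''.
  exact: single_rule h' h''.
exact: ext_rule h' (strictl_rule h') h''.
Qed.

End Classes.

(** * The free fibration *)

Section Free.
Variables (X Y : RT A') (f : Hom X Y).

(* The points of the free fibration on f: a point of X followed by finitely many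
   paths in Y, each travelled up to some time *)
Inductive chain :=
| Base of rcarrier X
| Extend of chain & (P -> rcarrier Y) & P.

Definition chain_end (l : chain) (y : rcarrier Y) : A -> Prop :=
  match l with Base x => rel f x y | Extend _ c p => eqv (c p) y end.

(** The clauses are congruence for [Base] and [Extend], deletion of a path stopped at p0, symmetry
    and transitivity. There is no reflexivity: being related to itself is the existence of a chain,
    which requires every path to respect equality and to start at the end of the preceding chain. *)
Definition chain_closed (S : chain -> chain -> A -> Prop) : A -> Prop :=
  pand (allimp (fun z : rcarrier X * rcarrier X => eqv z.1 z.2)
          (fun z => S (Base z.1) (Base z.2)))
 (pand (allimp (fun z : chain * chain * ((P -> rcarrier Y) * (P -> rcarrier Y)) * (P * P) =>
            pand (S z.1.1.1 z.1.1.2) (pand (chain_end z.1.1.1 (z.1.2.1 p0))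
              (pand (path_eq z.1.2.1 z.1.2.2) (eqv z.2.1 z.2.2))))
          (fun z => S (Extend z.1.1.1 z.1.2.1 z.2.1) (Extend z.1.1.2 z.1.2.2 z.2.2)))
 (pand (allimp (fun z : chain * (P -> rcarrier Y) * P =>
            pand (S z.1.1 z.1.1) (pand (chain_end z.1.1 (z.1.2 p0))
              (pand (path_eq z.1.2 z.1.2) (eqv p0 z.2))))
          (fun z => S (Extend z.1.1 z.1.2 z.2) z.1.1))
 (pand (allimp (fun z : chain * chain => S z.1 z.2) (fun z => S z.2 z.1))
       (allimp (fun z : chain * chain * chain => pand (S z.1.1 z.1.2) (S z.1.2 z.2))
          (fun z => S z.1.1 z.2))))).

Record closed_at (s : stage) (S : s -> chain -> chain -> A -> Prop) : Prop := ClosedAt {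
  closed_base : forall (s' : stage) (h : s' -> s) (x x' : s' -> rcarrier X), refines h ->
    feq s' x x' -> s' ⊩ (fun j => S (h j) (Base (x j)) (Base (x' j)));
  closed_extend : forall (s' : stage) (h : s' -> s) (m m' : s' -> chain)
      (c c' : s' -> P -> rcarrier Y) (p p' : s' -> P), refines h ->
    s' ⊩ (fun j => S (h j) (m j) (m' j)) -> s' ⊩ (fun j => chain_end (m j) (c j p0)) ->
    s' ⊩ (fun j => path_eq (c j) (c' j)) -> feq s' p p' ->
    s' ⊩ (fun j => S (h j) (Extend (m j) (c j) (p j)) (Extend (m' j) (c' j) (p' j)));
  closed_zero : forall (s' : stage) (h : s' -> s) (m : s' -> chain)
      (c : s' -> P -> rcarrier Y) (p : s' -> P), refines h ->
    s' ⊩ (fun j => S (h j) (m j) (m j)) -> s' ⊩ (fun j => chain_end (m j) (c j p0)) ->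
    s' ⊩ (fun j => path_eq (c j) (c j)) -> feq s' (fun=> p0) p ->
    s' ⊩ (fun j => S (h j) (Extend (m j) (c j) (p j)) (m j));
  closed_sym : forall (s' : stage) (h : s' -> s) (l l' : s' -> chain), refines h ->
    s' ⊩ (fun j => S (h j) (l j) (l' j)) -> s' ⊩ (fun j => S (h j) (l' j) (l j));
  closed_trans : forall (s' : stage) (h : s' -> s) (l l' l'' : s' -> chain), refines h ->
    s' ⊩ (fun j => S (h j) (l j) (l' j)) -> s' ⊩ (fun j => S (h j) (l' j) (l'' j)) ->
    s' ⊩ (fun j => S (h j) (l j) (l'' j)) }.

Lemma forces_closed (s : stage) (S : s -> chain -> chain -> A -> Prop) :
  s ⊩ (fun j => chain_closed (S j)) <-> closed_at S.
Proof.
split=> [/forces_and[h1 /forces_and[h2 /forces_and[h3 /forces_and[h4 h5]]]]|[h1 h2 h3 h4 h5]].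
  split.
  - move=> s' h x x' hh hx.
    exact: (forces_allE (P := fun _ (z : rcarrier X * rcarrier X) => eqv z.1 z.2)
      (Q := fun j z => S j (Base z.1) (Base z.2)) (z := fun j => (x j, x' j)) h1 hh hx).
  - move=> s' h m m' c c' p p' hh k1 k2 k3 k4.
    apply: (forces_allE (z := fun j => (m j, m' j, (c j, c' j), (p j, p' j))) h2 hh).
    by do 3!(apply/forces_and; split=> //).
  - move=> s' h m c p hh k1 k2 k3 k4.
    apply: (forces_allE (z := fun j => (m j, c j, p j)) h3 hh).
    by do 3!(apply/forces_and; split=> //).
  - move=> s' h l l' hh k1.
    exact: (forces_allE (z := fun j => (l j, l' j)) h4 hh).
  - move=> s' h l l' l'' hh k1 k2.
    apply: (forces_allE (z := fun j => (l j, l' j, l'' j)) h5 hh).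
    exact/forces_and.
apply/forces_and; split; first by apply: forces_allI => s' h z; exact: h1.
apply/forces_and; split.
  apply: forces_allI => s' h z hh /forces_and[k1 /forces_and[k2 /forces_and[k3 k4]]].
  exact: (h2 s' h _ _ _ _ _ _ hh k1 k2 k3 k4).
apply/forces_and; split.
  apply: forces_allI => s' h z hh /forces_and[k1 /forces_and[k2 /forces_and[k3 k4]]].
  exact: (h3 s' h _ _ _ hh k1 k2 k3 k4).
apply/forces_and; split; first by apply: forces_allI => s' h z; exact: h4.
apply: forces_allI => s' h z hh /forces_and[k1 k2].
exact: (h5 s' h _ _ _ hh k1 k2).
Qed.

(* The least closed relation, as an intersection. Realizers are Church encodings,
   so that recursion needs no fixed point combinator. *)
Definition chain_eqv (l l' : chain) : A -> Prop :=
  allimp chain_closed (fun S => S l l').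

Lemma forces_chain (s : stage) (l l' : s -> chain) :
  s ⊩ (fun j => chain_eqv (l j) (l' j)) <->
  forall (s' : stage) (h : s' -> s) (S : s' -> chain -> chain -> A -> Prop),
    refines h -> closed_at S -> s' ⊩ (fun j => S j (l (h j)) (l' (h j))).
Proof.
split=> [H s' h S hh /forces_closed hS|H].
  exact: (forces_allE (P := fun=> chain_closed) (Q := fun j S => S (l j) (l' j)) H hh hS).
by apply: forces_allI => s' h S hh /forces_closed; exact: H.
Qed.

Lemma chain_base (s : stage) (x x' : s -> rcarrier X) :
  feq s x x' -> s ⊩ (fun j => chain_eqv (Base (x j)) (Base (x' j))).
Proof.
move=> hx; apply/forces_chain => s' h S hh hS.
exact: (closed_base hS (refines_id _ _) (forces_res hh hx)).
Qed.

Lemma chain_extend (s : stage) (m m' : s -> chain) (c c' : s -> P -> rcarrier Y) (p p' : s -> P) :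
  s ⊩ (fun j => chain_eqv (m j) (m' j)) -> s ⊩ (fun j => chain_end (m j) (c j p0)) ->
  s ⊩ (fun j => path_eq (c j) (c' j)) -> feq s p p' ->
  s ⊩ (fun j => chain_eqv (Extend (m j) (c j) (p j)) (Extend (m' j) (c' j) (p' j))).
Proof.
move=> /forces_chain h1 h2 h3 h4; apply/forces_chain => s' h S hh hS.
exact: (closed_extend hS (refines_id _ _) (h1 _ _ _ hh hS) (forces_res hh h2)
  (forces_res hh h3) (forces_res hh h4)).
Qed.

Lemma chain_zero (s : stage) (m : s -> chain) (c : s -> P -> rcarrier Y) (p : s -> P) :
  s ⊩ (fun j => chain_eqv (m j) (m j)) -> s ⊩ (fun j => chain_end (m j) (c j p0)) ->
  s ⊩ (fun j => path_eq (c j) (c j)) -> feq s (fun=> p0) p ->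
  s ⊩ (fun j => chain_eqv (Extend (m j) (c j) (p j)) (m j)).
Proof.
move=> /forces_chain h1 h2 h3 h4; apply/forces_chain => s' h S hh hS.
exact: (closed_zero hS (refines_id _ _) (h1 _ _ _ hh hS) (forces_res hh h2)
  (forces_res hh h3) (forces_res hh h4)).
Qed.

Lemma chain_sym (s : stage) (l l' : s -> chain) :
  s ⊩ (fun j => chain_eqv (l j) (l' j)) -> s ⊩ (fun j => chain_eqv (l' j) (l j)).
Proof.
move=> /forces_chain h1; apply/forces_chain => s' h S hh hS.
exact: (closed_sym hS (refines_id _ _) (h1 _ _ _ hh hS)).
Qed.

Lemma chain_trans (s : stage) (l l' l'' : s -> chain) :
  s ⊩ (fun j => chain_eqv (l j) (l' j)) -> s ⊩ (fun j => chain_eqv (l' j) (l'' j)) ->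
  s ⊩ (fun j => chain_eqv (l j) (l'' j)).
Proof.
move=> /forces_chain h1 /forces_chain h2; apply/forces_chain => s' h S hh hS.
exact: (closed_trans hS (refines_id _ _) (h1 _ _ _ hh hS) (h2 _ _ _ hh hS)).
Qed.

(** * Induction on the equality of chains *)

Section ChainInd.
Variable psi : chain -> chain -> A -> Prop.
Hypothesis psi_base : forall (s : stage) (x x' : s -> rcarrier X),
  feq s x x' -> s ⊩ (fun j => psi (Base (x j)) (Base (x' j))).
Hypothesis psi_extend : forall (s : stage) (m m' : s -> chain)
    (c c' : s -> P -> rcarrier Y) (p p' : s -> P),
  s ⊩ (fun j => chain_eqv (m j) (m' j)) -> s ⊩ (fun j => psi (m j) (m' j)) ->
  s ⊩ (fun j => chain_end (m j) (c j p0)) ->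
  s ⊩ (fun j => path_eq (c j) (c' j)) -> feq s p p' ->
  s ⊩ (fun j => psi (Extend (m j) (c j) (p j)) (Extend (m' j) (c' j) (p' j))).
Hypothesis psi_zero : forall (s : stage) (m : s -> chain)
    (c : s -> P -> rcarrier Y) (p : s -> P),
  s ⊩ (fun j => chain_eqv (m j) (m j)) -> s ⊩ (fun j => psi (m j) (m j)) ->
  s ⊩ (fun j => chain_end (m j) (c j p0)) ->
  s ⊩ (fun j => path_eq (c j) (c j)) -> feq s (fun=> p0) p ->
  s ⊩ (fun j => psi (Extend (m j) (c j) (p j)) (m j)).
Hypothesis psi_sym : forall (s : stage) (l l' : s -> chain),
  s ⊩ (fun j => chain_eqv (l j) (l' j)) -> s ⊩ (fun j => psi (l j) (l' j)) ->
  s ⊩ (fun j => psi (l' j) (l j)).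
Hypothesis psi_trans : forall (s : stage) (l l' l'' : s -> chain),
  s ⊩ (fun j => chain_eqv (l j) (l' j)) -> s ⊩ (fun j => psi (l j) (l' j)) ->
  s ⊩ (fun j => chain_eqv (l' j) (l'' j)) -> s ⊩ (fun j => psi (l' j) (l'' j)) ->
  s ⊩ (fun j => psi (l j) (l'' j)).

(** The closed relation to instantiate with is the conjunction of [chain_eqv] and psi, so each case
    may also assume the equality of the chains involved. *)
Lemma chain_ind_stage (s : stage) (l l' : s -> chain) :
  s ⊩ (fun j => chain_eqv (l j) (l' j)) -> s ⊩ (fun j => psi (l j) (l' j)).
Proof.
move/forces_chain => /(_ s id (fun=> fun l l' => pand (chain_eqv l l') (psi l l')))
  /(_ (refines_id _ _)) H.
suff /H/forces_and[] : closed_at (fun (_ : s) l l' => pand (chain_eqv l l') (psi l l')) by [].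
split.
- by move=> s' h x x' hh hx; apply/forces_and; split; [exact: chain_base | exact: psi_base].
- move=> s' h m m' c c' p p' hh /forces_and[h1 h1'] h2 h3 h4; apply/forces_and.
  by split; [exact: chain_extend | exact: psi_extend].
- move=> s' h m c p hh /forces_and[h1 h1'] h2 h3 h4; apply/forces_and.
  by split; [exact: chain_zero | exact: psi_zero].
- move=> s' h m m' hh /forces_and[h1 h2]; apply/forces_and.
  by split; [exact: chain_sym | exact: psi_sym].
- move=> s' h m m' m'' hh /forces_and[h1 h2] /forces_and[h3 h4]; apply/forces_and.
  split; [exact: chain_trans h1 h3 | exact: psi_trans h1 h2 h3 h4].
Qed.

End ChainInd.

(** One y represents the ends of both chains, which yields at once that the end exists, is unique
    and is invariant. *)
Lemma chain_end_class (s : stage) (l l' : s -> chain) :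
  s ⊩ (fun j => chain_eqv (l j) (l' j)) -> exists y : s -> rcarrier Y,
  s ⊩ (fun j => is_class (chain_end (l j)) (y j)) /\
  s ⊩ (fun j => is_class (chain_end (l' j)) (y j)).
Proof.
move=> h; pose psi l l' a := exists y : rcarrier Y,
  pand (is_class (chain_end l) y) (is_class (chain_end l') y) a.
suff /forces_ex[y /forces_and hy] : s ⊩ (fun j => psi (l j) (l' j)) by exists y.
move: s l l' h; apply: chain_ind_stage.
- move=> s x x' hx; have [y hy] := forces_total f (refl_rule hx).
  apply: (forces_exI (y := y)); apply/forces_and; split; apply: class_funrel => //.
  exact: ext_rule hy hx (strictr_rule hy).
- move=> s m m' c c' p p' _ _ _ hc hp; apply: (forces_exI (y := fun j => c j (p j))).
  have h1 := path_eq_at hc hp.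
  by apply/forces_and; split; apply: class_eqv; [exact: refl_rule h1 | exact: sym_rule].
(* At time p0 the new end is c p0, which by hypothesis is the end of m. *)
- move=> s m c p _ /forces_ex[y /forces_and[h1 _]] h2 hc hp.
  apply: (forces_exI (y := y)); apply/forces_and; split=> //.
  apply: class_eqv; have h3 := path_eq_at hc hp.
  exact: trans_rule (sym_rule h3) (sym_rule (class_eq h1 h2)).
- by move=> s l l' _ /forces_ex[y /forces_and[h1 h2]]; apply: (forces_exI (y := y)); apply/forces_and.
- move=> s l l' l'' _ /forces_ex[y /forces_and[h1 h2]] _ /forces_ex[y' /forces_and[h3 h4]].
  apply: (forces_exI (y := y)); apply/forces_and; split=> //.
  exact: class_ext h4 (class_eq h3 (class_mem h2 (class_refl h2))).
Qed.

Definition chain_obj : RT A' := @mk_robj _ _ _ chain_eqv chain_sym chain_trans.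

Definition chain_inj : Hom X chain_obj.
Proof.
refine (@mk_funrel A A' X chain_obj
  (fun x l => pand (eqv x x) (chain_eqv (Base x) l)) _ _ _ _).
- by move=> s x l /forces_and[h1 h2]; split=> //; exact: chain_trans (chain_sym h2) h2.
- move=> s x x' l l' /forces_and[h1 h2] hx hl; apply/forces_and; split.
    exact: refl_rule (sym_rule hx).
  exact: chain_trans (chain_base (sym_rule hx)) (chain_trans h2 hl).
- by move=> s x l l' /forces_and[_ h1] /forces_and[_ h2]; exact: chain_trans (chain_sym h1) h2.
- move=> s x hx; exists (fun j => Base (x j)); apply/forces_and; split=> //.
  exact: chain_base.
Defined.

Lemma forces_inj (s : stage) (x : s -> rcarrier X) (l : s -> chain) :
  frel s chain_inj x l <-> feq s x x /\ s ⊩ (fun j => chain_eqv (Base (x j)) (l j)).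
Proof. exact: forces_and. Qed.

Definition chain_proj : Hom chain_obj Y.
Proof.
refine (@mk_funrel A A' chain_obj Y
  (fun l y => pand (chain_eqv l l) (chain_end l y)) _ _ _ _).
- move=> s l y /forces_and[h1 h2]; split=> //.
  have [y' [h3 _]] := chain_end_class h1; exact: refl_rule (sym_rule (class_eq h3 h2)).
- move=> s l l' y y' /forces_and[h1 h2] hl hy; apply/forces_and; split.
    exact: chain_trans (chain_sym hl) hl.
  have [y'' [h3 h4]] := chain_end_class hl.
  exact: class_mem h4 (trans_rule (class_eq h3 h2) hy).
- move=> s l y y' /forces_and[h1 h2] /forces_and[_ h4].
  have [y'' [h3 _]] := chain_end_class h1.
  exact: trans_rule (sym_rule (class_eq h3 h2)) (class_eq h3 h4).
- move=> s l h; have [y [hy _]] := chain_end_class h.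
  by exists y; apply/forces_and; split=> //; exact: class_mem hy (class_refl hy).
Defined.

Lemma forces_proj (s : stage) (l : s -> chain) (y : s -> rcarrier Y) :
  frel s chain_proj l y <->
  s ⊩ (fun j => chain_eqv (l j) (l j)) /\ s ⊩ (fun j => chain_end (l j) (y j)).
Proof. exact: forces_and. Qed.

Lemma chain_end_eq (s : stage) (l l' : s -> chain) (y : s -> rcarrier Y) :
  s ⊩ (fun j => chain_eqv (l j) (l' j)) -> s ⊩ (fun j => chain_end (l j) (y j)) ->
  s ⊩ (fun j => chain_end (l' j) (y j)).
Proof.
by move=> /chain_end_class[y' [h1 h2]] h; exact: class_mem h2 (class_eq h1 h).
Qed.

Lemma chain_fact : chain_proj ∘ chain_inj ≈ f.
Proof.
apply: heq_stage => s x y /forces_comp[l [/forces_inj[h1 h2] /forces_proj[h3 h4]]].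
exact: chain_end_eq (chain_sym h2) h4.
Qed.

Let N := path_problem chain_proj.

Lemma chain_extend_prob (s : stage) (x x' : s -> rcarrier (cyl_obj (upo N))) :
  feq s x x' -> s ⊩ (fun j => chain_eqv (Extend (x j).1.1 (x j).1.2 (x j).2)
     (Extend (x' j).1.1 (x' j).1.2 (x' j).2)).
Proof.
move=> /forces_cyl[/forces_prob[h1 h2 /forces_proj[_ h3]] h4]; exact: chain_extend.
Qed.

(** A generic problem against [chain_proj] is a chain with a path starting at its end; it is solved
    by appending the path, stopped at the given time. *)
Definition chain_lift : Hom (path_cylinder (upo N)) chain_obj.
Proof.
refine (@mk_funrel A A' (path_cylinder (upo N)) chain_obj
  (fun x l => pand (eqv x x) (chain_eqv (Extend x.1.1 x.1.2 x.2) l)) _ _ _ _).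
- by move=> s x l /forces_and[h1 h2]; split=> //; exact: chain_trans (chain_sym h2) h2.
- move=> s x x' l l' /forces_and[h1 h2] hx hl; apply/forces_and; split.
    exact: refl_rule (sym_rule hx).
  exact: chain_trans (chain_extend_prob (sym_rule hx)) (chain_trans h2 hl).
- by move=> s x l l' /forces_and[_ h1] /forces_and[_ h2]; exact: chain_trans (chain_sym h1) h2.
- move=> s x hx; exists (fun j => Extend (x j).1.1 (x j).1.2 (x j).2).
  by apply/forces_and; split=> //; exact: chain_extend_prob.
Defined.

Lemma forces_lift (s : stage) (x : s -> rcarrier (path_cylinder (upo N))) (l : s -> chain) :
  frel s chain_lift x l <->
  feq s x x /\ s ⊩ (fun j => chain_eqv (Extend (x j).1.1 (x j).1.2 (x j).2) (l j)).
Proof. exact: forces_and. Qed.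

(** This is the purpose of the deletion clause: appending a path stopped at p0 changes nothing. *)
Lemma chain_lift_inc : chain_lift ∘ inc path_cylinder (upo N) ≈ upu N.
Proof.
apply: heq_stage => s x l /forces_comp[x' [/forces_inc[h1 h2] /forces_lift[h3 h4]]].
apply/forces_start; split; first exact: refl_rule h1.
have /forces_cyl[/forces_prob[_ k2 /forces_proj[k3 k4]] _] := h3.
have k5 := chain_trans (chain_sym (chain_zero k3 k4 k2 h2)) h4.
have /forces_prob[k6 _ _] := h1; exact: chain_trans k6 k5.
Qed.

Lemma chain_lift_proj : chain_proj ∘ chain_lift ≈ upv N.
Proof.
apply: heq_stage => s x y /forces_comp[l [/forces_lift[h1 h2] /forces_proj[h3 h4]]].
apply/forces_path; split=> //; exact: chain_end_eq (chain_sym h2) h4.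
Qed.

Definition chain_structure : lift_structure path_cylinder chain_proj :=
  lift_of_universal chain_lift_inc chain_lift_proj.

(** * Maps out of the free fibration *)

Section Target.
Variables (Z W : RT A') (g : Hom Z W) (sg : lift_structure path_cylinder g) (k : Hom Y W).

Let Ng := path_problem g.
(** The solution that sg gives to the universal problem; by naturality it determines all other lifts
    of sg. *)
Variable Phi : Hom (path_cylinder (upo Ng)) Z.
Hypothesis PhiP : lifts sg (upu Ng) (upv Ng) Phi.

Lemma Phi_step (s : stage) (z : s -> rcarrier Z) (c : s -> P -> rcarrier W) (p : s -> P) :
  feq s (fun j => (z j, c j) : rcarrier (upo Ng)) (fun j => (z j, c j)) -> feq s p p ->
  exists2 z' : s -> rcarrier Z, s ⊩ (fun j => rel Phi (z j, c j, p j) (z' j)) &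
    s ⊩ (fun j => rel g (z' j) (c j (p j))).
Proof.
move=> hq hp.
have hx : feq s (fun j => (z j, c j, p j) : rcarrier (path_cylinder (upo Ng)))
   (fun j => (z j, c j, p j)) by apply/forces_cyl.
have [z' hz] := forces_total Phi hx; exists z' => //.
have [_ e] := lifts_sol PhiP.
have [w hw] := forces_total g (strictr_rule hz).
have h : s ⊩ (fun j => rel (g ∘ Phi) (z j, c j, p j) (w j)) by apply/forces_comp; exists z'.
have /forces_path[_ /= h'] := heq_forces e h.
exact: ext_rule hw (strictl_rule hw) (sym_rule h').
Qed.

Lemma Phi_zero (s : stage) (z : s -> rcarrier Z) (c : s -> P -> rcarrier W) (p : s -> P) :
  feq s (fun j => (z j, c j) : rcarrier (upo Ng)) (fun j => (z j, c j)) ->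
  feq s (fun=> p0) p -> s ⊩ (fun j => rel Phi (z j, c j, p j) (z j)).
Proof.
move=> hq hp; have [e _] := lifts_sol PhiP.
have h : s ⊩ (fun j => rel (upu Ng) (z j, c j) (z j)).
  by apply/forces_start; split=> //; have /forces_prob[] := hq.
have /forces_comp[x [/forces_inc[h1 h2] h3]] := heq_forces (heq_sym e) h.
apply: (ext_rule h3) (strictr_rule h3); apply/forces_cyl.
by split; [exact: sym_rule h1 | exact: trans_rule (sym_rule h2) hp].
Qed.

Section Existence.
Variable h : Hom X Z.
Hypothesis gh : g ∘ h ≈ k ∘ f.

(** The value on [Extend] is forced: a morphism must send the lift of c from m to the lift, computed
    by [Phi], of the image of c under k from the value of m. The pair q of this value and this image
    is bound existentially, as k is only a functional relation. *)
Fixpoint ext_rel (l : chain) (z : rcarrier Z) : A -> Prop :=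
  match l with
  | Base x => rel h x z
  | Extend m c p => fun a => exists q : rcarrier (upo Ng),
      pand (ext_rel m q.1) (pand (pathof (fun p => rel k (c p)) q.2) (rel Phi (q, p) z)) a
  end.

Lemma path_image (s : stage) (c c' : s -> P -> rcarrier Y) (d d' : s -> P -> rcarrier W) :
  s ⊩ (fun j => path_eq (c j) (c' j)) ->
  s ⊩ (fun j => pathof (fun p => rel k (c j p)) (d j)) ->
  s ⊩ (fun j => pathof (fun p => rel k (c' j p)) (d' j)) ->
  s ⊩ (fun j => path_eq (d j) (d' j)).
Proof.
move=> /forces_path_eq hc /forces_pathof hd /forces_pathof hd'.
apply/forces_path_eq => s' i p p' hi hp.
have h1 := hd _ _ _ hi (refl_rule hp); have h2 := hd' _ _ _ hi (refl_rule (sym_rule hp)).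
exact: single_rule (ext_rule h1 (hc _ _ _ _ hi hp) (strictr_rule h1)) h2.
Qed.

(** Allowing an equal path and time lets one z', computed from c and p, serve both sides of the
    congruence clause. *)
Lemma ext_extend_class (s : stage) (z z' : s -> rcarrier Z) (d : s -> P -> rcarrier W)
    (m : s -> chain) (c c' : s -> P -> rcarrier Y) (p p' : s -> P) :
  feq s (fun j => (z j, d j) : rcarrier (upo Ng)) (fun j => (z j, d j)) ->
  s ⊩ (fun j => pathof (fun p => rel k (c j p)) (d j)) ->
  s ⊩ (fun j => rel Phi (z j, d j, p j) (z' j)) ->
  s ⊩ (fun j => path_eq (c j) (c' j)) -> feq s p p' ->
  s ⊩ (fun j => is_class (ext_rel (m j)) (z j)) ->
  s ⊩ (fun j => is_class (ext_rel (Extend (m j) (c' j) (p' j))) (z' j)).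
Proof.
move=> hq hd hz hc hp hm; apply/forces_class; split; first exact: strictr_rule hz.
move=> s' i z'' hi; have hq' := forces_res hi hq; have hd' := forces_res hi hd.
have hz' := forces_res hi hz; have hc' := forces_res hi hc.
have hp' := forces_res hi hp; have hm' := forces_res hi hm.
have hx (q : s' -> rcarrier (upo Ng)) :
   feq s' (fun j => (z (i j), d (i j)) : rcarrier (upo Ng)) q ->
   s' ⊩ (fun j => eqv ((z (i j), d (i j), p (i j)) : rcarrier (path_cylinder (upo Ng)))
      (q j, p' (i j))) by move=> hqq; apply/forces_cyl.
split=> [/forces_ex[q /forces_and[h1 /forces_and[h2 h3]]]|hzz].
  apply: single_rule _ h3; apply: (ext_rule hz') (strictr_rule hz').
  apply: hx; have /forces_prob[k1 k2 k3] := hq'; apply/forces_prob; split=> //=.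
    exact: class_eq hm' h1.
  exact: path_image hc' hd' h2.
apply: (forces_exI (y := fun j => (z (i j), d (i j)))); apply/forces_and; split.
  exact: class_mem hm' (class_refl hm').
apply/forces_and; split; last exact: ext_rule hz' (hx _ hq') hzz.
apply/(@forces_pathof _ s' (fun j p => rel k (c' (i j) p)) (fun j => d (i j))).
move=> s'' i' p'' hi' hp''.
have /forces_pathof/(_ s'' i' p'' hi' hp'') h1 := hd'.
have /forces_path_eq/(_ s'' i' p'' p'' hi' hp'') h2 := hc'.
exact: ext_rule h1 h2 (strictr_rule h1).
Qed.

(** The induction also carries that z lies over the k-image w of the end of l. Without this the
    value of m and the image of the next path would not form a lifting problem, and [Phi] could not
    be applied to them. *)
Lemma ext_class (s : stage) (l l' : s -> chain) :
  s ⊩ (fun j => chain_eqv (l j) (l' j)) -> exists (z : s -> rcarrier Z) (y : s -> rcarrier Y)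
    (w : s -> rcarrier W),
  [/\ s ⊩ (fun j => is_class (ext_rel (l j)) (z j)),
      s ⊩ (fun j => is_class (ext_rel (l' j)) (z j)),
      s ⊩ (fun j => chain_end (l j) (y j)),
      s ⊩ (fun j => rel k (y j) (w j)) & s ⊩ (fun j => rel g (z j) (w j))].
Proof.
move=> hl; pose psi l l' a := exists t : rcarrier Z * rcarrier Y * rcarrier W,
  pand (is_class (ext_rel l) t.1.1) (pand (is_class (ext_rel l') t.1.1)
    (pand (chain_end l t.1.2) (pand (rel k t.1.2 t.2) (rel g t.1.1 t.2)))) a.
have psiE (s' : stage) (m m' : s' -> chain) : s' ⊩ (fun j => psi (m j) (m' j)) ->
    exists z y w, [/\ s' ⊩ (fun j => is_class (ext_rel (m j)) (z j)),
      s' ⊩ (fun j => is_class (ext_rel (m' j)) (z j)),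
      s' ⊩ (fun j => chain_end (m j) (y j)),
      s' ⊩ (fun j => rel k (y j) (w j)) & s' ⊩ (fun j => rel g (z j) (w j))].
  move=> /forces_ex[t /forces_and[h1 /forces_and[h2 /forces_and[h3 /forces_and[h4 h5]]]]].
  by exists (fun j => (t j).1.1), (fun j => (t j).1.2), (fun j => (t j).2).
have psiI (s' : stage) (m m' : s' -> chain) z y w :
    s' ⊩ (fun j => is_class (ext_rel (m j)) (z j)) ->
    s' ⊩ (fun j => is_class (ext_rel (m' j)) (z j)) ->
    s' ⊩ (fun j => chain_end (m j) (y j)) ->
    s' ⊩ (fun j => rel k (y j) (w j)) -> s' ⊩ (fun j => rel g (z j) (w j)) ->
    s' ⊩ (fun j => psi (m j) (m' j)).
  move=> h1 h2 h3 h4 h5; apply: (forces_exI (y := fun j => (z j, y j, w j))).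
  by do 4!(apply/forces_and; split=> //).
(* The path d is the image of c under k. It starts over z because the end y of m equals c p0. *)
have step (s' : stage) (m : s' -> chain) (c : s' -> P -> rcarrier Y) z y w :
    s' ⊩ (fun j => is_class (ext_rel (m j)) (z j)) ->
    s' ⊩ (fun j => chain_eqv (m j) (m j)) -> s' ⊩ (fun j => chain_end (m j) (y j)) ->
    s' ⊩ (fun j => rel k (y j) (w j)) -> s' ⊩ (fun j => rel g (z j) (w j)) ->
    s' ⊩ (fun j => chain_end (m j) (c j p0)) -> s' ⊩ (fun j => path_eq (c j) (c j)) ->
    exists d, s' ⊩ (fun j => pathof (fun p => rel k (c j p)) (d j)) /\
      feq s' (fun j => (z j, d j) : rcarrier (upo Ng)) (fun j => (z j, d j)).
  move=> h1 h2 h3 h4 h5 h6 h7.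
  have [|d hd] := @forces_pathof_ex _ s' (fun j p => rel k (c j p)).
    move=> s'' i p hi hp; apply: (forces_total k (x := fun j => c (i j) (p j))).
    by have /forces_path_eq h8 := h7; exact: h8.
  exists d; split=> //; apply/forces_prob; split=> /=.
  - exact: class_refl h1.
  - exact (path_image h7 hd hd).
  - have [y' [h8 _]] := chain_end_class h2.
    have h9 := trans_rule (sym_rule (class_eq h8 h3)) (class_eq h8 h6).
    have h10 := pathof_at hd (p0P s').
    exact: ext_rule h5 (strictl_rule h5)
      (single_rule (ext_rule h4 h9 (strictr_rule h4)) h10).
apply: (psiE _ _ _ _); move: s l l' hl; apply: chain_ind_stage.
- move=> s x x' hx; have [z hz] := forces_total h (refl_rule hx).
  have [w hw] := forces_total g (strictr_rule hz).
  have /(heq_forces gh)/forces_comp[y [h1 h2]] : frel s (g ∘ h) x w.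
    by apply/forces_comp; exists z.
  apply: (psiI s (fun j => Base (x j)) (fun j => Base (x' j)) z y w _ _ h1 h2 hw); apply: class_funrel => //.
  exact: ext_rule hz hx (strictr_rule hz).
- move=> s m m' c c' p p' hm /psiE[z [y [w [h1 h2 h3 h4 h5]]]] h6 h7 hp.
  have hmm := chain_trans hm (chain_sym hm).
  have hcc := path_eq_trans h7 (path_eq_sym h7).
  have [d [h8 h9]] := step _ _ _ _ _ _ h1 hmm h3 h4 h5 h6 hcc.
  have [z' h10 h11] := Phi_step h9 (refl_rule hp).
  have h12 := pathof_at h8 (refl_rule hp).
  apply: (psiI _ _ _ z' (fun j => c j (p j)) (fun j => d j (p j))) => //.
  + exact: ext_extend_class h9 h8 h10 hcc (refl_rule hp) h1.
  + exact: ext_extend_class h9 h8 h10 h7 hp h2.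
  + exact: strictl_rule h12.
(* By [Phi_zero] the value z of m is also the value of the extended chain. *)
- move=> s m c p hm /psiE[z [y [w [h1 _ h3 h4 h5]]]] h6 h7 hp.
  have [d [h8 h9]] := step _ _ _ _ _ _ h1 hm h3 h4 h5 h6 h7.
  have h10 := Phi_zero h9 hp.
  apply: (psiI _ _ _ z y w) => //.
    exact: ext_extend_class h9 h8 h10 h7 (refl_rule (sym_rule hp)) h1.
  exact: chain_end_eq (chain_sym (chain_zero hm h6 h7 hp)) h3.
- move=> s l l' hl /psiE[z [y [w [h1 h2 h3 h4 h5]]]].
  by apply: (psiI _ _ _ z y w) => //; exact: chain_end_eq hl h3.
- move=> s l l' l'' hl /psiE[z [y [w [h1 h2 h3 h4 h5]]]] _ /psiE[z' [y' [w' [h1' h2' _ _ _]]]].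
  apply: (psiI _ _ _ z y w) => //.
  exact: class_ext h2' (class_eq h1' (class_mem h2 (class_refl h2))).
Qed.

Definition chain_ext : Hom chain_obj Z.
Proof.
refine (@mk_funrel A A' chain_obj Z
  (fun l z => pand (chain_eqv l l) (ext_rel l z)) _ _ _ _).
- move=> s l z /forces_and[h1 h2]; split=> //.
  have [z' [y [w [h3 _ _ _ _]]]] := ext_class h1; exact: refl_rule (sym_rule (class_eq h3 h2)).
- move=> s l l' z z' /forces_and[h1 h2] hl hz; apply/forces_and; split.
    exact: chain_trans (chain_sym hl) hl.
  have [z'' [y [w [h3 h4 _ _ _]]]] := ext_class hl.
  exact: class_mem h4 (trans_rule (class_eq h3 h2) hz).
- move=> s l z z' /forces_and[h1 h2] /forces_and[_ h4].
  have [z'' [y [w [h3 _ _ _ _]]]] := ext_class h1.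
  exact: trans_rule (sym_rule (class_eq h3 h2)) (class_eq h3 h4).
- move=> s l hl; have [z [y [w [hz _ _ _ _]]]] := ext_class hl.
  by exists z; apply/forces_and; split=> //; exact: class_mem hz (class_refl hz).
Defined.

Lemma forces_ext (s : stage) (l : s -> chain) (z : s -> rcarrier Z) :
  frel s chain_ext l z <->
  s ⊩ (fun j => chain_eqv (l j) (l j)) /\ s ⊩ (fun j => ext_rel (l j) (z j)).
Proof. exact: forces_and. Qed.

Lemma chain_ext_inj : chain_ext ∘ chain_inj ≈ h.
Proof.
apply: heq_stage => s x z /forces_comp[l [/forces_inj[h1 h2] /forces_ext[h3 h4]]].
have [z' [y [w [h5 h6 _ _ _]]]] := ext_class h2.
exact: class_mem h5 (class_eq h6 h4).
Qed.

Lemma chain_ext_proj : g ∘ chain_ext ≈ k ∘ chain_proj.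
Proof.
apply: heq_stage => s l w /forces_comp[z [/forces_ext[h1 h2] h3]].
have [z' [y [w' [h4 _ h5 h6 h7]]]] := ext_class h1.
apply/forces_comp; exists y; split; first exact/forces_proj.
apply: (ext_rule h6 (strictl_rule h6)).
apply: single_rule _ h3.
exact: ext_rule h7 (class_eq h4 h2) (strictr_rule h7).
Qed.

End Existence.

(** * Preservation of lifts, and uniqueness of the extension *)

Section Morphism.
Variable a : Hom chain_obj Z.
Hypothesis ga : g ∘ a ≈ k ∘ chain_proj.

Lemma image_problem : g ∘ (a ∘ upu N) ≈ (k ∘ upv N) ∘ inc path_cylinder (upo N).
Proof. by rewrite compA ga -!compA upE. Qed.

Lemma image_lifts : lifts sg (a ∘ upu N) (k ∘ upv N)
  (Phi ∘ cylm path_cylinder (classify image_problem)).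
Proof.
apply: lifts_heq (lifts_nat (classify image_problem) PhiP) => //.
  exact: classify_start.
exact: classify_path.
Qed.

(** Only the image of the generic lift matters, and lifts for sg are unique, so being a morphism is
    one equation between maps. *)
Lemma chain_morphismP : lift_morphism chain_structure sg a k <->
  Phi ∘ cylm path_cylinder (classify image_problem) ≈ a ∘ chain_lift.
Proof.
split=> [/lift_morphism_universal-/(_ ga) h|h].
  exact: lifts_uniq image_lifts h.
apply/lift_morphism_universal => //; exact: lifts_heq (heq_refl _) (heq_refl _) h image_lifts.
Qed.

Lemma forces_image (s : stage) (x : s -> rcarrier (upo N)) (q : s -> rcarrier (upo Ng)) :
  frel s (classify image_problem) x q <->
  [/\ feq s x x, s ⊩ (fun j => rel a (x j).1 (q j).1) &
      s ⊩ (fun j => pathof (fun p => rel k ((x j).2 p)) (q j).2)].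
Proof.
split=> [/forces_classify[/forces_comp[m [/forces_start[h1 h2] h3]] h4]|[h1 h2 h3]].
  split=> //; first exact: ext_rule h3 (sym_rule h2) (strictr_rule h3).
  apply/forces_pathof => s' i p hi hp.
  have /forces_comp[y [/forces_path[_ /= h5] h6]] := h4 _ _ _ hi hp.
  exact: ext_rule h6 (sym_rule h5) (strictr_rule h6).
apply/forces_classify; split.
  apply/forces_comp; exists (fun j => (x j).1); split=> //; apply/forces_start.
  by split=> //; have /forces_prob[] := h1.
move=> s' i p hi hp; apply/forces_comp; exists (fun j => (x (i j)).2 (p j)).
split; last by have /forces_pathof h4 := h3; exact: h4.
apply/forces_path; split=> /=; first by apply/forces_cyl; split=> //=; exact: forces_res hi h1.
by have /forces_prob[_ /forces_path_eq h4 _] := h1; exact: h4.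
Qed.

Lemma morphism_extend (s : stage) (m : s -> chain) (c : s -> P -> rcarrier Y) (p : s -> P)
    (z : s -> rcarrier Z) (d : s -> P -> rcarrier W) (z' : s -> rcarrier Z) :
  lift_morphism chain_structure sg a k ->
  feq s (fun j => (m j, c j) : rcarrier (upo N)) (fun j => (m j, c j)) -> feq s p p ->
  s ⊩ (fun j => rel a (m j) (z j)) ->
  s ⊩ (fun j => pathof (fun p => rel k (c j p)) (d j)) ->
  s ⊩ (fun j => rel Phi (z j, d j, p j) (z' j)) ->
  s ⊩ (fun j => rel a (Extend (m j) (c j) (p j)) (z' j)).
Proof.
move=> /chain_morphismP e hm hp hz hd hz'.
have /(heq_forces e)/forces_comp[l [/forces_lift[h1 /= h2] h3]] :
   s ⊩ (fun j => rel (Phi ∘ cylm path_cylinder (classify image_problem))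
     (m j, c j, p j) (z' j)).
  apply/forces_comp; exists (fun j => (z j, d j, p j)); split=> //.
  by apply/forces_cyl_map; split=> //=; apply/forces_image.
exact: ext_rule h3 (chain_sym h2) (strictr_rule h3).
Qed.

End Morphism.

(** Read at elements, the equation of [chain_morphismP] is the [Extend] clause of [ext_rel]. *)
Lemma chain_ext_morphism (h : Hom X Z) (gh : g ∘ h ≈ k ∘ f) :
  lift_morphism chain_structure sg (chain_ext gh) k.
Proof.
apply/(chain_morphismP (chain_ext_proj gh)); apply: heq_stage => s x z.
move=> /forces_comp[q [/forces_cyl_map[/forces_image[h1 /forces_ext[h2 h3] h4] h5] h6]].
have hx : feq s x x by apply/forces_cyl; split=> //; exact: refl_rule h5.
apply/forces_comp; exists (fun j => Extend (x j).1.1 (x j).1.2 (x j).2); split.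
  by apply/forces_lift; split=> //; exact: chain_extend_prob.
apply/forces_ext; split; first exact: chain_extend_prob.
apply: (forces_exI (y := fun j => (q j).1)); apply/forces_and; split=> //.
apply/forces_and; split=> //; apply: (ext_rule h6) (strictr_rule h6).
have /forces_cyl[k1 _] := strictl_rule h6.
by apply/forces_cyl; split=> //=; exact: sym_rule.
Qed.

(** By [morphism_extend], the value of a morphism on an extended chain is determined by its value on
    the shorter one, so induction gives a common value of a and a'. *)
Lemma chain_ext_uniq (a a' : Hom chain_obj Z) :
  lift_morphism chain_structure sg a k -> lift_morphism chain_structure sg a' k ->
  a ∘ chain_inj ≈ a' ∘ chain_inj -> a ≈ a'.
Proof.
move=> ha ha' e; have ga := proj1 ha; have ga' := proj1 ha'.
(* The second chain is a dummy: the induction is over chains that exist, and the symmetry case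
   transports along their equality. *)
pose psi (l _ : chain) b := exists z, pand (rel a l z) (rel a' l z) b.
suff H : forall (s : stage) (l l' : s -> chain), s ⊩ (fun j => chain_eqv (l j) (l' j)) ->
    s ⊩ (fun j => psi (l j) (l' j)).
  apply: heq_stage => s l z hz; have hl := strictl_rule hz.
  have /forces_ex[z' /forces_and[h1 h2]] := H _ _ _ hl.
  exact: ext_rule h2 hl (single_rule h1 hz).
apply: chain_ind_stage.
- move=> s x x' hx; have hb := chain_base (refl_rule hx).
  have [z hz] := forces_total a (hb : feq s (fun j => Base (x j) : rcarrier chain_obj) _).
  have hi : frel s chain_inj x (fun j => Base (x j)).
    by apply/forces_inj; split=> //; exact: refl_rule hx.
  apply: (forces_exI (y := z)); apply/forces_and; split=> //.
  have /(heq_forces e)/forces_comp[l [h1 h2]] : frel s (a ∘ chain_inj) x z.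
    by apply/forces_comp; exists (fun j => Base (x j)).
  exact: ext_rule h2 (single_rule h1 hi) (strictr_rule h2).
- move=> s m m' c c' p p' hm /forces_ex[z /forces_and[h1 h2]] h3 h4 hp.
  have hmm := chain_trans hm (chain_sym hm).
  have hcc := path_eq_trans h4 (path_eq_sym h4).
  have hq : feq s (fun j => (m j, c j) : rcarrier (upo N)) (fun j => (m j, c j)).
    by apply/forces_prob; split=> //; apply/forces_proj.
  have [q hqq] := forces_total (classify (image_problem ga)) hq.
  have /forces_image[_ k1 k2] := hqq.
  (* The problem q was computed from a; through the common value z it is also the image under a'. *)
  have h5 : s ⊩ (fun j => rel a' (m j) (q j).1) by exact: ext_rule h2 hmm (single_rule h1 k1).
  have [z' h6 _] := Phi_step (z := fun j => (q j).1) (c := fun j => (q j).2)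
    (strictr_rule hqq) (refl_rule hp).
  apply: (forces_exI (y := z')); apply/forces_and; split.
    exact: (morphism_extend ga ha hq (refl_rule hp) k1 k2 h6).
  exact: (morphism_extend ga' ha' hq (refl_rule hp) h5 k2 h6).
- move=> s m c p hm /forces_ex[z /forces_and[h1 h2]] h3 h4 hp.
  have hl := chain_sym (chain_zero hm h3 h4 hp).
  apply: (forces_exI (y := z)); apply/forces_and; split.
    exact: ext_rule h1 hl (strictr_rule h1).
  exact: ext_rule h2 hl (strictr_rule h2).
- move=> s l l' hl /forces_ex[z /forces_and[h1 h2]].
  apply: (forces_exI (y := z)); apply/forces_and; split.
    exact: ext_rule h1 hl (strictr_rule h1).
  exact: ext_rule h2 hl (strictr_rule h2).
- by [].
Qed.

End Target.

Definition chain_free : free_lift path_cylinder f.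
Proof.
refine (@FreeLift (RT A') path_cylinder X Y f chain_obj chain_inj chain_proj chain_fact
  chain_structure _ _).
- move=> Z W g sg h k gh.
  have [Phi hPhi] := lifts_ex sg (upE (path_problem g)).
  exists (chain_ext hPhi gh); split; [exact: chain_ext_morphism | exact: chain_ext_inj].
- move=> Z W g sg k a a' ha ha' e.
  have [Phi hPhi] := lifts_ex sg (upE (path_problem g)).
  exact: chain_ext_uniq hPhi _ _ ha ha' e.
Defined.

End Free.

End Paths.

(** * The interval *)

Section Interval.
Variables (A : pca) (A' : subpca A).
Notation "s ⊩ P" := (entails A' (fun j : points s => eq (rz j)) P) (at level 68).
Notation feq s x y := (s ⊩ (fun j => eqv (x j) (y j))).
Notation frel s F x y := (s ⊩ (fun j => rel F (x j) (y j))).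
Notation stage := (stage A).

Variables (I : RT A') (i0 : rcarrier I) (e0 : A).
Hypotheses (e0_in : A' e0) (e0P : eqv i0 i0 e0).

Let T := {q : rcarrier I * A | eqv q.1 q.1 q.2}.

(** Existence means knowing the chosen realizer, while equality compares only the underlying points,
    so different realizers of one point stay identified and nothing but the presentation of I
    changes. *)
Definition pts_eqv (p q : T) : A -> Prop :=
  pand (eq (sval p).2) (pand (eq (sval q).2) (eqv (sval p).1 (sval q).1)).

Lemma forces_pts_eqv (s : stage) (p q : s -> T) :
  s ⊩ (fun j => pts_eqv (p j) (q j)) <->
  [/\ s ⊩ (fun j => eq (sval (p j)).2), s ⊩ (fun j => eq (sval (q j)).2) &
      s ⊩ (fun j => eqv (sval (p j)).1 (sval (q j)).1)].
Proof.
split=> [/forces_and[h1 /forces_and[h2 h3]]|[h1 h2 h3]] //.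
by apply/forces_and; split=> //; exact/forces_and.
Qed.

Lemma pts_sym (s : stage) (p q : s -> T) :
  s ⊩ (fun j => pts_eqv (p j) (q j)) -> s ⊩ (fun j => pts_eqv (q j) (p j)).
Proof.
by move=> /forces_pts_eqv[h1 h2 h3]; apply/forces_pts_eqv; split=> //; exact: sym_rule.
Qed.

Lemma pts_trans (s : stage) (p q r : s -> T) :
  s ⊩ (fun j => pts_eqv (p j) (q j)) -> s ⊩ (fun j => pts_eqv (q j) (r j)) ->
  s ⊩ (fun j => pts_eqv (p j) (r j)).
Proof.
move=> /forces_pts_eqv[h1 h2 h3] /forces_pts_eqv[h4 h5 h6]; apply/forces_pts_eqv.
by split=> //; exact: trans_rule h3 h6.
Qed.

Definition pts : robj A' := @mk_robj _ _ _ pts_eqv pts_sym pts_trans.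

Definition pts_norm (p : pts) : A := (sval p).2.

Lemma forces_pts (s : stage) (p q : s -> pts) :
  feq s p q <->
  [/\ s ⊩ (fun j => eq (sval (p j)).2), s ⊩ (fun j => eq (sval (q j)).2) &
      s ⊩ (fun j => eqv (sval (p j)).1 (sval (q j)).1)].
Proof. exact: forces_pts_eqv. Qed.

Lemma pts_normP (s : stage) (p : s -> pts) :
  feq s p p <-> s ⊩ (fun j => eq (pts_norm (p j))).
Proof.
split=> [/forces_pts[]//|h]; apply/forces_pts; split=> //.
by refine (ent_mono h _ _) => // j a /= <-; exact: (svalP (p j)).
Qed.

Definition pt0 : pts := exist _ (i0, e0) e0P.

Lemma pt0P (s : stage) : feq s (fun=> pt0) (fun=> pt0).
Proof. by apply/pts_normP; exact: forces_cst. Qed.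

Definition pts_to : Hom (pts : RT A') I.
Proof.
refine (@mk_funrel A A' pts I (fun p i => pand (eqv p p) (eqv (sval p).1 i)) _ _ _ _).
- by move=> s p i /forces_and[h1 h2]; split=> //; exact: refl_rule (sym_rule h2).
- move=> s p p' i i' /forces_and[h1 h2] hp hi; apply/forces_and; split.
    exact: refl_rule (sym_rule hp).
  by have /forces_pts[_ _ h3] := hp; exact: trans_rule (sym_rule h3) (trans_rule h2 hi).
- by move=> s p i i' /forces_and[_ h1] /forces_and[_ h2]; exact: trans_rule (sym_rule h1) h2.
- move=> s p hp; exists (fun j => (sval (p j)).1); apply/forces_and; split=> //.
  by have /forces_pts[] := hp.
Defined.

Lemma forces_pts_to (s : stage) (p : s -> pts) (i : s -> rcarrier I) :
  frel s pts_to p i <-> feq s p p /\ s ⊩ (fun j => eqv (sval (p j)).1 (i j)).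
Proof. exact: forces_and. Qed.

Definition pts_of : Hom I (pts : RT A').
Proof.
refine (@mk_funrel A A' I pts (fun i p => pand (eqv p p) (eqv (sval p).1 i)) _ _ _ _).
- by move=> s i p /forces_and[h1 h2]; split=> //; exact: refl_rule (sym_rule h2).
- move=> s i i' p p' /forces_and[h1 h2] hi hp; apply/forces_and; split.
    exact: refl_rule (sym_rule hp).
  by have /forces_pts[_ _ h3] := hp; exact: trans_rule (sym_rule h3) (trans_rule h2 hi).
- move=> s i p p' /forces_and[/pts_normP h1 h2] /forces_and[/pts_normP h3 h4].
  by apply/forces_pts; split=> //; exact: trans_rule h2 (sym_rule h4).
(* The realizer that r computes for the existence of i becomes the chosen realizer of the point. *)
- move=> s i [r hr H].
  have /choice[p hp] j : exists p : pts, (sval p).1 = i j /\ app r (rz j) (sval p).2.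
    have [b rb ib] := H j _ erefl; by exists (exist _ (i j, b) ib).
  exists p; have h : feq s p p.
    by apply/pts_normP; exists r => // j a <-; exists (sval (p j)).2 => //; case: (hp j).
  apply/forces_and; split=> //; have /forces_pts[_ _ h'] := h.
  by refine (ent_mono h' _ _) => // j a; have [-> _] := hp j.
Defined.

Lemma forces_pts_of (s : stage) (i : s -> rcarrier I) (p : s -> pts) :
  frel s pts_of i p <-> feq s p p /\ s ⊩ (fun j => eqv (sval (p j)).1 (i j)).
Proof. exact: forces_and. Qed.

Lemma pts_ofK : pts_to ∘ pts_of ≈ idm I.
Proof.
apply: heq_stage => s i i' /forces_comp[p [/forces_pts_of[_ h1] /forces_pts_to[_ h2]]].
exact: trans_rule (sym_rule h1) h2.
Qed.

Lemma pts_toK : pts_of ∘ pts_to ≈ idm (pts : RT A').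
Proof.
apply: heq_stage => s p p'.
move=> /forces_comp[i [/forces_pts_to[/pts_normP h1 h2] /forces_pts_of[/pts_normP h3 h4]]].
by apply/forces_pts; split=> //; exact: trans_rule h2 (sym_rule h4).
Qed.

Let cy := path_cylinder pt0P.

Definition cyl_time (K : RT A') : Hom (cy K) I := pts_to ∘ cyl_snd pts K.

Lemma cyl_fst_inc (K : RT A') : cyl_fst pts K ∘ inc cy K ≈ idm K.
Proof.
apply: heq_stage => s k k' /forces_comp[x [/forces_inc[h1 _] /forces_fst[h2 _]]].
exact: trans_rule h1 h2.
Qed.

Section Pair.
Variables (K W : RT A') (a : Hom W K) (b : Hom W (pts : RT A')).

Definition cyl_pair : Hom W (cy K).
Proof.
refine (@mk_funrel A A' W (cy K) (fun w x => pand (rel a w x.1) (rel b w x.2)) _ _ _ _).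
- move=> s w x /forces_and[h1 h2]; split; first exact: strictl_rule h1.
  by apply/forces_cyl; split; [exact: strictr_rule h1 | exact: strictr_rule h2].
- move=> s w w' x x' /forces_and[h1 h2] hw /forces_cyl[h3 h4]; apply/forces_and.
  by split; [exact: ext_rule h1 hw h3 | exact: ext_rule h2 hw h4].
- move=> s w x x' /forces_and[h1 h2] /forces_and[h3 h4]; apply/forces_cyl.
  by split; [exact: single_rule h1 h3 | exact: single_rule h2 h4].
- move=> s w hw; have [k hk] := forces_total a hw; have [p hp] := forces_total b hw.
  by exists (fun j => (k j, p j)); apply/forces_and.
Defined.

Lemma forces_pair (s : stage) (w : s -> rcarrier W) (x : s -> rcarrier (cy K)) :
  frel s cyl_pair w x <->
  s ⊩ (fun j => rel a (w j) (x j).1) /\ s ⊩ (fun j => rel b (w j) (x j).2).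
Proof. exact: forces_and. Qed.

Lemma cyl_fst_pair : cyl_fst pts K ∘ cyl_pair ≈ a.
Proof.
apply: heq_stage => s w k /forces_comp[x [/forces_pair[h1 _] /forces_fst[h2 _]]].
exact: ext_rule h1 (strictl_rule h1) h2.
Qed.

Lemma cyl_snd_pair : cyl_snd pts K ∘ cyl_pair ≈ b.
Proof.
apply: heq_stage => s w k /forces_comp[x [/forces_pair[_ h1] /forces_snd[h2 _]]].
exact: ext_rule h1 (strictl_rule h1) h2.
Qed.

End Pair.

Lemma cyl_pair_eta (K W : RT A') (w : Hom W (cy K)) :
  w ≈ cyl_pair (cyl_fst pts K ∘ w) (cyl_snd pts K ∘ w).
Proof.
apply: heq_stage => s o x h; have /forces_cyl[h1 h2] := strictr_rule h.
apply/forces_pair; split; apply/forces_comp; exists x; split=> //.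
  exact/forces_fst.
exact/forces_snd.
Qed.

Lemma cyl_pair_heq (K W : RT A') (a a' : Hom W K) (b b' : Hom W (pts : RT A')) :
  a ≈ a' -> b ≈ b' -> cyl_pair a b ≈ cyl_pair a' b'.
Proof.
move=> ea eb; apply: heq_stage => s o x /forces_pair[h1 h2]; apply/forces_pair.
by split; [exact: heq_forces ea h1 | exact: heq_forces eb h2].
Qed.

Lemma cyl_pair_ex (K W : RT A') (a : Hom W K) (b : Hom W I) :
  exists w : Hom W (cy K), cyl_fst pts K ∘ w ≈ a /\ cyl_time K ∘ w ≈ b.
Proof.
exists (cyl_pair a (pts_of ∘ b)); split; first exact: cyl_fst_pair.
by rewrite /cyl_time -compA cyl_snd_pair compA pts_ofK comp1m.
Qed.

Lemma cyl_pair_uniq (K W : RT A') (w w' : Hom W (cy K)) :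
  cyl_fst pts K ∘ w ≈ cyl_fst pts K ∘ w' -> cyl_time K ∘ w ≈ cyl_time K ∘ w' -> w ≈ w'.
Proof.
move=> e1 e2; rewrite (cyl_pair_eta w) (cyl_pair_eta w'); apply: cyl_pair_heq => //.
have e (z : Hom W (cy K)) : cyl_snd pts K ∘ z ≈ pts_of ∘ (cyl_time K ∘ z).
  by rewrite /cyl_time !compA pts_toK comp1m.
by rewrite e (e w') e2.
Qed.

Variable d : Hom (RT_one A' : RT A') I.
Hypothesis dP : forall (s : stage) (u : s -> rcarrier (RT_one A' : RT A')) (i : s -> rcarrier I),
  frel s d u i <-> s ⊩ (fun j => eqv i0 (i j)).

Lemma cyl_time_inc (K : RT A') : cyl_time K ∘ inc cy K ≈ d ∘ bang (RT_one A') K.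
Proof.
rewrite /cyl_time -compA; apply: heq_stage => s k i.
move=> /forces_comp[p [/forces_comp[x [/forces_inc[h1 h2] /forces_snd[h3 h4]]] /forces_pts_to[h5 h6]]].
apply/forces_comp; exists (fun=> tt); split; first exact: refl_rule h1.
apply/dP; have /forces_pts[_ _ h7] := trans_rule h2 h3.
exact: trans_rule h7 h6.
Qed.

Lemma fibred_rlp_awfs : exists W : awfs (RT A'), forall (X Y : RT A') (f : Hom X Y),
  admits_right_map_structure W f <->
  fibred_rlp (family1 (RT_one A') d) (family1 (RT_one A') f).
Proof.
exists (free_awfs (fun X Y f => chain_free pts_normP pt0P f)) => X Y f.
rewrite free_right_map; last exact: (path_problem pts_normP).
symmetry; apply: fibred_rlpP.
- exact: cyl_fst_inc.
- exact: cyl_time_inc.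
- exact: cyl_pair_ex.
- exact: cyl_pair_uniq.
Qed.

End Interval.

Theorem theorem8p4 (R : realType) :
  exists W : awfs KV, forall (X Y : KV) (f : Hom X Y),
    admits_right_map_structure W f <-> computable_hurewicz_fibration R f.
Proof.
apply: (@fibred_rlp_awfs K2 K2rec (interval R) (zero_pt R) zero_name zero_name_rec).
  by split=> //; exact: zero_nameP.
(* By definition the graph of [delta0] is equality with [zero_pt] in the assembly. *)
by [].
Qed.
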